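(* Each of the 16 framed MP moves is derived as a sequence of the primary framed MP move, the framed pure sliding moves, the framed H-move and their inverses. That is: if a framed normal o-graph $(\Gamma',z')$ is obtained from a framed normal o-graph $(\Gamma,z)$ by a framed MP move, then $(\Gamma',z')$ is obtained from $(\Gamma,z)$ by a finite sequence of primary framed MP moves, framed pure sliding moves, framed H-moves, and inverses of these moves.
   Context: **Normal o-graphs.** A normal o-graph is an oriented virtual link diagram (real crossings with sign $+$ or $-$) up to planar isotopy and the Reidemeister-type moves involving virtual crossings. Equivalently, it is the following data up to isomorphism: a finite nonempty set $V$ of vertices (real crossings), a sign in $\{+,-\}$ for each vertex, four ends (over-in, over-out, under-in, under-out) at each vertex, and a bijection from the set of all out-ends to the set of all in-ends (each matched pair is an edge), such that the resulting 4-valent graph is connected. **Dual branched triangulation.** $T(\Gamma)$: for each vertex of $\Gamma$ take a tetrahedron with ordered vertices $0<1<2<3$; let $F_i$ be the face opposite to $i$. At a positive vertex the frame $(01,02,03)$ is negative, and over-in, over-out, under-in, under-out correspond to $F_0,F_1,F_2,F_3$. At a negative vertex the frame $(01,02,03)$ is positive, and over-in, over-out, under-in, under-out correspond to $F_1,F_0,F_3,F_2$. For each edge of $\Gamma$ glue the two corresponding faces by the order-preserving affine map. $\Gamma\mapsto T(\Gamma)$ is a bijection from normal o-graphs to connected finite complexes of oriented tetrahedra with ordered vertices and order-preserving, orientation-reversing pairings of all faces (up to isomorphism). Edges of $T(\Gamma)$ are directed from smaller to larger end. The dual 2-skeleton $P(\Gamma)$ is a branched standard polyhedron whose true vertices,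 edges, 2-cells are dual to tetrahedra, triangles, edges of $T(\Gamma)$. All moves are described on $T(\Gamma)$. **Closed.** Let $M(\Gamma)$ be the regular neighbourhood of $P(\Gamma)$, $v(\Gamma)$ the nowhere-vanishing field on it positively transverse to (the smoothed) $P(\Gamma)$, crossing each 2-cell in the direction of the dual edge. $\Gamma$ is closed if $\partial M(\Gamma)\cong S^2$ with the parts where $v(\Gamma)$ points outward, is tangent, points inward being $\{z<0\},\{z=0\},\{z>0\}$. **Weights and Euler cochain.** An integral normal o-graph is $(\Gamma,x)$ with $x$ an integer weight on each edge of $\Gamma$, i.e. on each triangle of $T(\Gamma)$; so $x\in C^1(P(\Gamma);\mathbb{Z})$. For an edge $E$ of a triangle $f$ put $\sigma(f,E)=-1$ if $E$ joins the smallest and largest vertices of $f$ and $+1$ otherwise. Then $(\delta x)(E)=\sum_f\sigma(f,E)x(f)$, summing over all occurrences of triangles around $E$. A corner of a tetrahedron at its edge $02$ or $13$ carries one dot, at its other edges none. If $n_E$ is the number of dots around $E$, the Euler cochain is $c_P(E)=-(1-n_E/2)$. A framed integral normal o-graph is an integral closed normal o-graph $(\Gamma,x)$ with $\delta x=c_P$. A framed normal o-graph is a pair $(\Gamma,[x]_2)$, where $(\Gamma,x)$ is a framed integral normal o-graph and $[x]_2\in C^1(P(\Gamma);\mathbb{Z}_2)$ is the reduction of $x$ modulo 2. **Framed moves.** A framed MP move, primary framed MP move, framed pure sliding move, framed H-move is the modulo 2 reduction (on weights) of the corresponding integral move below: $(\Gamma,z)\to(\Gamma',z')$ is such a move if there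 are framed integral normal o-graphs $(\Gamma,x),(\Gamma',x')$ with $[x]_2=z$, $[x']_2=z'$ related by the corresponding integral move. **MP moves.** Two distinct tetrahedra glued along a triangle $c<d<e$, with remaining vertices $a,b$ (five abstractly distinct vertices of a bipyramid $B$); choose a total order on $\{a,b,c,d,e\}$ extending both orders, such that $a,b$ are not both smaller than $c$ and not both larger than $e$; replace by the three tetrahedra $\{a,b,c,d\},\{a,b,d,e\},\{a,b,c,e\}$ around a new edge $ab$, with restricted orders and unchanged outer gluings (16 types). **Integral MP moves.** Assume $x=0$ on the triangle $cde$. Let $w$ be an integer function on the nine triangles of the subdivided $B$ (six outer triangles, three inner triangles $abc,abd,abe$) such that for each of the nine outer edges $E$ of $B$, $\sum_{f\ni E}\sigma(f,E)w(f)=\frac12(d'(E)-d(E))$, where $d(E),d'(E)$ are the numbers of dots at $E$ in the two, resp. three, tetrahedra, and $\sum_{f\ni ab}\sigma(f,ab)w(f)=-1+\frac12d'(ab)$. Such $w$ exists and is unique up to changes realized by integral H-moves at the three new vertices; for each type one such $w$ is fixed. The integral MP move performs the MP move, gives inner triangles weight $w$, and adds to the weights of the other triangles the values of $w$ on the outer triangles of $B$ (added up if outer triangles of $B$ are identified). **Primary integral MP move.** Five vertices $v_0<\dots<v_4$; $\{v_0,v_1,v_2,v_4\},\{v_0,v_2,v_3,v_4\}$ replaced by $\{v_1,v_2,v_3,v_4\},\{v_0,v_1,v_3,v_4\},\{v_0,v_1,v_2,v_3\}$, all five corresponding to positive vertices, with $w=0$. **Integral H-move.** At a vertex of $\Gamma$,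 add $+1$ to the weights of the two incoming edges and $-1$ to the weights of the two outgoing edges (added up if an edge occurs twice). **Pure sliding moves.** Let $E$ be an edge of $T(\Gamma)$ with ends $x_0<y_0$; choose triangles $f_1,f_2$ at two different places around $E$ (a triangle may first be replaced by a stack of two parallel copies, so $f_1,f_2$ may be parallel copies of one triangle). Let $p,q$ be their third vertices. Choose a total order on $\{x_0,y_0,p,q\}$ compatible with $f_1,f_2$ with $p,q$ not both smaller than $x_0$ and not both larger than $y_0$. Cut open along $f_1\cup f_2$ and insert a pillow of two oppositely oriented tetrahedra, both with vertices $x_0,y_0,p,q$ in this order, glued to each other along $x_0pq$ and $y_0pq$, the four outer faces being glued to the sides of the cut. So $f_i$ is replaced by two triangles $f_i',f_i''$, $E$ by two edges $E',E''$, and a new edge $pq$ and two inner triangles $x_0pq,y_0pq$ appear. **Integral pure sliding moves.** From $(\Gamma,x)$ to $(\Gamma',x')$: the underlying move is a pure sliding move; if $f_1,f_2$ are parallel copies of one triangle, its weight is distributed between them as a sum of two integers. $x'=x$ on all triangles other than $f_i',f_i'',x_0pq,y_0pq$, and on these six $x'$ satisfies: (i) for each $s\in\{x_0,y_0\}$, $(i,r)\in\{(1,p),(2,q)\}$: $\sigma(f_i,sr)(x'(f_i')+x'(f_i''))+\sigma(spq,sr)x'(spq)=\sigma(f_i,sr)x(f_i)+\epsilon(sr)$, where $\epsilon(sr)=1$ if $sr$ is the edge $02$ or $13$ of the ordered tetrahedron $x_0y_0pq$ and $0$ otherwise; (ii) $\sigma(x_0pq,pq)x'(x_0pq)+\sigma(y_0pq,pq)x'(y_0pq)=-1+\epsilon(pq)$;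 (iii) $(\delta x')=c_{P'}$ at $E'$ and $E''$. (Parallel copies of a triangle remaining after the move are merged, adding weights.) These conditions determine $x'$ up to integral H-moves at the two new vertices. *)

(* Defs.v *)
From Stdlib Require Import Relations.
From mathcomp Require Import all_boot all_order all_algebra all_fingroup.
From mathcomp Require Import all_classical all_reals all_analysis.

Set Implicit Arguments.
Unset Strict Implicit.
Unset Printing Implicit Defensive.

Import Order.TTheory GRing.Theory Num.Theory.
Import numFieldNormedType.Exports.

Local Open Scope ring_scope.

(* A strand of a crossing: [true] is the over strand, [false] the under strand.
   A pair (v, s) stands for the out-end of strand s at v, or for its in-end,
   according to the context. *)
Definition strand := bool.

(* [og_sign v = true] means that v is positive.  [og_next] sends an out-end to
   the in-end it is matched with. *)
Record ograph := OGraph {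
  og_vertex :> finType;
  og_sign : og_vertex -> bool;
  og_next : {perm og_vertex * strand};
  og_nonempty : (0 < #|og_vertex|)%N;
  og_connected :
    let adj := [rel u v : og_vertex | [exists s, (og_next (u, s)).1 == v]] in
    forall u v, connect [rel u v | adj u v || adj v u] u v
}.

(* An edge of G is denoted by the out-end at which it starts. *)
Definition edge (G : ograph) : Type := (og_vertex G * strand)%type.

(* A side of a triangle of T(G): (t, k) is the face F_k of the tetrahedron t. *)
Definition face (G : ograph) : Type := (og_vertex G * 'I_4)%type.

Section Triangulation.
Variable G : ograph.

Definition in_face (sgn : bool) (s : strand) : 'I_4 :=
  inord (if s then (if sgn then 0 else 1) else (if sgn then 2 else 3)).

Definition out_face (sgn : bool) (s : strand) : 'I_4 :=
  inord (if s then (if sgn then 1 else 0) else (if sgn then 3 else 2)).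

Definition face_strand (k : 'I_4) : strand := (k < 2)%N.

(* Whether F_k corresponds to an in-end: the in-ends are F_0, F_2 at a positive
   vertex and F_1, F_3 at a negative one. *)
Definition incoming (sgn : bool) (k : 'I_4) : bool := sgn (+) odd k.

Definition out_side (e : edge G) : face G := (e.1, out_face (og_sign e.1) e.2).
Definition in_side (e : edge G) : face G := (e.1, in_face (og_sign e.1) e.2).

(* The edge of G, i.e. the triangle of T(G), of which F is a side. *)
Definition triangle (F : face G) : edge G :=
  if incoming (og_sign F.1) F.2 then (og_next G)^-1%g (F.1, face_strand F.2)
  else (F.1, face_strand F.2).

(* The face that F is glued to.  The gluing identifies the vertex [lift F.2 m]
   of the tetrahedron F.1 with the vertex [lift (mate F).2 m] of (mate F).1. *)
Definition mate (F : face G) : face G :=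
  if incoming (og_sign F.1) F.2 then out_side (triangle F)
  else in_side (og_next G (triangle F)).

(* A corner (t, (i, j)) with i < j: the edge ij of the tetrahedron t. *)
Definition corner : finType := (og_vertex G * ('I_4 * 'I_4))%type.

(* The side, opposite to the m-th vertex, of the triangle F. *)
Definition face_side (F : face G) (m : 'I_3) : corner :=
  (F.1, (lift F.2 (lift m (ord0 : 'I_2)), lift F.2 (lift m (ord_max : 'I_2)))).

Definition corner_glue : rel corner := fun c c' =>
  [exists F : face G, exists m, (c == face_side F m) &&
                                (c' == face_side (mate F) m)].

(* Two corners lie on the same edge of T(G). *)
Definition same_edge (c c' : corner) : bool := connect corner_glue c c'.

End Triangulation.

(* sigma(f, E), where i, j are the ends of E and k is the third vertex of f. *)
Definition sigma (i j k : nat) : int :=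
  if (minn i j < k < maxn i j)%N then -1 else 1.

(* ij is the edge 02 or 13 of a tetrahedron 0123. *)
Definition dotted (i j : nat) : bool :=
  (minn i j, maxn i j) \in [:: (0, 2); (1, 3)]%N.

Section Cochains.
Variable G : ograph.
Implicit Type c : corner G.

Definition coboundary (x : edge G -> int) c : int :=
  \sum_(e : og_vertex G * strand)
    \sum_(m < 3 | same_edge (face_side (out_side e) m) c)
      sigma (lift m (ord0 : 'I_2)) (lift m (ord_max : 'I_2)) m * x e.

Definition dots c : nat :=
  #|[pred c' : corner G | [&& (c'.2.1 < c'.2.2)%N, same_edge c' c &
                              dotted c'.2.1 c'.2.2]]|.

Definition euler_cochain c : rat := - (1 - (dots c)%:R / 2).

Definition euler_at (x : edge G -> int) c : Prop :=
  (coboundary x c)%:~R = euler_cochain c.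

End Cochains.

Section Closed.
Local Open Scope classical_set_scope.
Variables (R : realType) (G : ograph).

(* The simplex with barycentric coordinates indexed by the j != i. *)
Definition opposite_simplex n (i : 'I_n) : set 'rV[R]_n :=
  [set l | [/\ l 0 i = 0, forall j, 0 <= l 0 j & \sum_j l 0 j = 1]].

Definition extend (k : 'I_4) (l : 'rV[R]_3) : 'rV[R]_4 :=
  \row_j (if unlift k j is Some m then l 0 m else 0).

(* M(G) is the complement in |T(G)| of open conical neighbourhoods of the
   vertices, so its boundary is the union of the links of the vertices.  It is
   made of one triangle for each vertex i of each tetrahedron t, whose corners
   are the points on the edges ij of t (j != i).  The point ((t, i), l) is the
   one with barycentric coordinates l j at the corner on ij. *)
Definition bd_point : Type := ((og_vertex G * 'I_4) * 'rV[R]_4)%type.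

Definition bd_mem (p : bd_point) : Prop := opposite_simplex p.1.2 p.2.

(* A face glued to another one meets the boundary along three segments, one
   near each of its vertices m. *)
Inductive bd_glue : bd_point -> bd_point -> Prop :=
  BdGlue (F : face G) (m : 'I_3) (l : 'rV[R]_3) :
    opposite_simplex m l ->
    bd_glue ((F.1, lift F.2 m), extend F.2 l)
            (((mate F).1, lift (mate F).2 m), extend (mate F).2 l).

Definition bd_eq : bd_point -> bd_point -> Prop := clos_refl_sym_trans _ bd_glue.

(* The component of v(G) pointing into M(G): the field follows the directed
   edges, hence at the corner on ij it points inward if i < j and outward if
   j < i; it is extended affinely to the triangle. *)
Definition inward (p : bd_point) : R :=
  \sum_(j < 4 | (p.1.2 < j)%N) p.2 0 j - \sum_(j < 4 | (j < p.1.2)%N) p.2 0 j.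

Definition on_sphere (s : 'rV[R]_3) : Prop := \sum_i s 0 i ^+ 2 = 1.

(* h is a homeomorphism from the boundary of M(G) to S^2, given as a map from
   the disjoint union of the triangles (a compact space) that is continuous,
   identifies exactly the glued points, and is onto S^2 (a Hausdorff space).
   The last clause says where v(G) points outward, is tangent, points inward. *)
Definition closed_ograph : Prop :=
  exists h : bd_point -> 'rV[R]_3,
  [/\ forall a, {within opposite_simplex a.2, continuous (fun l => h (a, l))},
      forall p q, bd_mem p -> bd_mem q -> (h p = h q <-> bd_eq p q),
      forall s, on_sphere s <-> exists2 p, bd_mem p & h p = s
    & forall p, bd_mem p -> Num.sg (h p 0 (ord_max : 'I_3)) = Num.sg (inward p)].

End Closed.

Definition framed_integral (R : realType) (G : ograph) (x : edge G -> int) :=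
  closed_ograph R G /\
  forall c : corner G, (c.2.1 < c.2.2)%N -> euler_at x c.

Definition reduces_to (G : ograph) (x : edge G -> int) (z : edge G -> 'F_2) :=
  forall e, (x e)%:~R = z e.

Record framed_ograph (R : realType) := FramedOGraph {
  fo_graph :> ograph;
  fo_weight : edge fo_graph -> 'F_2;
  fo_framed : exists2 x : edge fo_graph -> int,
                framed_integral R x & reduces_to x fo_weight
}.

Arguments fo_weight {R} X e : rename.

Definition integral_move : Type :=
  forall G G' : ograph, (edge G -> int) -> (edge G' -> int) -> Prop.

Definition framed (R : realType) (mv : integral_move)
    (X X' : framed_ograph R) : Prop :=
  exists (x : edge X -> int) (x' : edge X' -> int),
  [/\ framed_integral R x, framed_integral R x',
      reduces_to x (fo_weight X), reduces_to x' (fo_weight X') & mv X X' x x'].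

Definition map_edge (V V' : Type) (f : V -> V') (e : V * strand) : V' * strand :=
  (f e.1, e.2).

Definition ograph_iso (G G' : ograph) (f : G -> G') : Prop :=
  [/\ bijective f, forall v, og_sign (f v) = og_sign v
    & forall e, og_next G' (map_edge f e) = map_edge f (og_next G e)].

Definition framed_iso (R : realType) (X X' : framed_ograph R) : Prop :=
  exists2 f : X -> X', ograph_iso f &
    forall e, fo_weight X' (map_edge f e) = fo_weight X e.

Definition integral_H_move : integral_move := fun G G' x x' =>
  exists2 f : G -> G', ograph_iso f &
  exists v : G, forall e,
    x' (map_edge f e) = x e + ((og_next G e).1 == v)%:Z - (e.1 == v)%:Z.

(* The position of the vertex i in the facet opposite to h. *)
Definition pos n (h i : 'I_n.+2) : 'I_n.+1 := odflt ord0 (unlift h i).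

(* The vertices of the bipyramid are labelled by 'I_5 according to the total
   order, with a < b.  The tetrahedron D_i is the one with vertices all labels
   but i; it is replaced if i is a or b, and new otherwise.  The triangle
   common to D_i and D_j is F_(pos i j) of D_i and has vertex set
   ~: [set i; j]. *)
Definition removed (a b i : 'I_5) : bool := i \in [:: a; b].

(* a, b are not both smaller than c, nor both larger than e, where c and e are
   the smallest and the largest of the other labels. *)
Definition mp_pair (a b : 'I_5) : Prop :=
  [/\ (a < b)%N,
      ~ (forall i : 'I_5, ~~ removed a b i -> (a < i)%N && (b < i)%N)
    & ~ (forall i : 'I_5, ~~ removed a b i -> (i < a)%N && (i < b)%N)].

Definition dot_in (i p q : 'I_5) : bool :=
  [&& p != i, q != i & dotted (pos i p) (pos i q)].

Definition removed_dots (a b p q : 'I_5) : nat :=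
  (\sum_(i < 5 | removed a b i) dot_in i p q)%N.

Definition new_dots (a b p q : 'I_5) : nat :=
  (\sum_(i < 5 | ~~ removed a b i) dot_in i p q)%N.

(* The function w on the triangles of the subdivided bipyramid, a triangle
   being given by its set of vertices; the value at cde = ~: [set a; b] is
   irrelevant. *)
Definition bipyramid_weight : Type := {set 'I_5} -> int.

Definition bipyramid_coboundary (a b : 'I_5) (w : bipyramid_weight)
    (p q : 'I_5) : int :=
  \sum_(r < 5 | (r \notin [:: p; q]) && ([set p; q; r]%SET != ~: [set a; b]%SET))
    sigma p q r * w [set p; q; r]%SET.

Definition admissible (a b : 'I_5) (w : bipyramid_weight) : Prop :=
  (forall p q : 'I_5, (p < q)%N -> (p, q) != (a, b) ->
     (bipyramid_coboundary a b w p q)%:~R =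
       ((new_dots a b p q)%:R - (removed_dots a b p q)%:R) / 2 :> rat) /\
  (bipyramid_coboundary a b w a b)%:~R = - 1 + (new_dots a b a b)%:R / 2 :> rat.

(* Corresponding faces before and after a move, apart from the inner ones.
   An outer face of the bipyramid belongs to D_i before the move and to D_j
   after it. *)
Inductive corresponding (G G' : ograph) (a b : 'I_5)
    (told : 'I_5 -> G) (tnew : 'I_5 -> G') (far : G -> G') :
    face G -> face G' -> Prop :=
| FarFace t k : (forall i, removed a b i -> told i <> t) ->
    corresponding a b told tnew far (t, k) (far t, k)
| OuterFace i j : removed a b i -> ~~ removed a b j ->
    corresponding a b told tnew far (told i, pos i j) (tnew j, pos j i).

(* [mp_told i] and [mp_tnew i] are the positions of D_i in T(G), resp. T(G');
   [mp_far] maps the tetrahedra of T(G) that are not replaced to T(G').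
   The type of the move is (a, b, eps).  The facets D_i of a 4-simplex are
   coherently oriented when their signs alternate with i; the sign is reversed
   for the new ones because both halves must induce the same orientation on
   the boundary of the bipyramid. *)
Record mp_data (a b : 'I_5) (eps : bool) (G G' : ograph) := MPData {
  mp_told : 'I_5 -> G;
  mp_tnew : 'I_5 -> G';
  mp_far : G -> G';
  mp_told_inj : {in removed a b &, injective mp_told};
  mp_tnew_inj : {in predC (removed a b) &, injective mp_tnew};
  mp_far_inj : forall t u,
    (forall i, removed a b i -> mp_told i <> t) ->
    (forall i, removed a b i -> mp_told i <> u) ->
    mp_far t = mp_far u -> t = u;
  mp_far_image : forall t',
    (exists2 t, forall i, removed a b i -> mp_told i <> t & mp_far t = t') <->
    (forall j, ~~ removed a b j -> mp_tnew j <> t');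
  mp_told_sign : forall i, removed a b i ->
    og_sign (mp_told i) = eps (+) odd i;
  mp_tnew_sign : forall j, ~~ removed a b j ->
    og_sign (mp_tnew j) = ~~ eps (+) odd j;
  mp_far_sign : forall t, (forall i, removed a b i -> mp_told i <> t) ->
    og_sign (mp_far t) = og_sign t;
  mp_told_glue : forall i j, removed a b i -> removed a b j -> i != j ->
    mate (mp_told i, pos i j) = (mp_told j, pos j i);
  mp_tnew_glue : forall i j, ~~ removed a b i -> ~~ removed a b j -> i != j ->
    mate (mp_tnew i, pos i j) = (mp_tnew j, pos j i);
  mp_outer_glue : forall F F', corresponding a b mp_told mp_tnew mp_far F F' ->
    corresponding a b mp_told mp_tnew mp_far (mate F) (mate F')
}.

(* The value of w on F if F is an outer face of the bipyramid, and 0 if not. *)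
Definition outer_weight (a b : 'I_5) (G : ograph) (told : 'I_5 -> G)
    (w : bipyramid_weight) (F : face G) : int :=
  \sum_(i < 5 | removed a b i) \sum_(j < 5 | ~~ removed a b j)
    (if F == (told i, pos i j) then w (~: [set i; j])%SET else 0).

(* In the last clause both sides F and mate F of a triangle can be outer faces
   of the bipyramid. *)
Definition integral_mp_with (a b : 'I_5) (eps : bool) (w : bipyramid_weight) :
    integral_move := fun G G' x x' =>
  exists D : mp_data a b eps G G',
  [/\ x (triangle (mp_told D a, pos a b)) = 0,
      forall i j, ~~ removed a b i -> ~~ removed a b j -> i != j ->
        x' (triangle (mp_tnew D i, pos i j)) = w (~: [set i; j])%SET
    & forall F F', corresponding a b (mp_told D) (mp_tnew D) (mp_far D) F F' ->
        x' (triangle F') = x (triangle F) + outer_weight a b (mp_told D) w F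
                           + outer_weight a b (mp_told D) w (mate F)].

(* The choice of one function w for each of the 16 types. *)
Definition mp_choice : Type := 'I_5 -> 'I_5 -> bool -> bipyramid_weight.

Definition admissible_choice (W : mp_choice) : Prop :=
  forall a b eps, mp_pair a b -> admissible a b (W a b eps).

Definition integral_mp (W : mp_choice) : integral_move := fun G G' x x' =>
  exists a b eps, mp_pair a b /\ integral_mp_with a b eps (W a b eps) x x'.

(* D_1 and D_3 are replaced by D_0, D_2, D_4; with eps = false all five are
   positive. *)
Definition primary_integral_mp : integral_move := fun G G' =>
  @integral_mp_with (inord 1) (inord 3) false (fun=> 0) G G'.

Section Pillow.
(* tet s is the tetrahedron of sign s of the pillow. *)
Variables (G' : ograph) (tet : bool -> G').

(* The in-end and the out-end of G' corresponding to the two copies of F_k in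
   the pillow. *)
Definition pillow_in (k : 'I_4) : edge G' := (tet (~~ odd k), face_strand k).
Definition pillow_out (k : 'I_4) : edge G' := (tet (odd k), face_strand k).

End Pillow.

(* The vertices of both tetrahedra of the pillow are labelled by 'I_4 according
   to their order.  The triangle f1 (edge e1 of G) is inserted as the face
   x0 y0 p = F_q, and f2 as x0 y0 q = F_p; the side of f1 opposite to p and the
   side of f2 opposite to q are both E.  Orientations determine on which side
   of each triangle the two tetrahedra are glued.  If e1 = e2, then f1 and f2
   are parallel copies, and they are named so that f1 comes first on the edge;
   the triangles between them are merged. *)
Record sliding_data (x0 y0 p q : 'I_4) (G G' : ograph) := SlidingData {
  ps_e1 : edge G;
  ps_e2 : edge G;
  ps_old : G -> G';
  ps_tet : bool -> G';
  ps_uniq : uniq [:: x0; y0; p; q];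
  ps_lt : (x0 < y0)%N;
  ps_not_below : ~~ ((p < x0)%N && (q < x0)%N);
  ps_not_above : ~~ ((y0 < p)%N && (y0 < q)%N);
  ps_same_edge : same_edge (face_side (out_side ps_e1) (pos q p))
                           (face_side (out_side ps_e2) (pos p q));
  ps_old_inj : injective ps_old;
  ps_tet_inj : injective ps_tet;
  ps_image : forall t', (exists t, ps_old t = t') <-> (forall s, ps_tet s <> t');
  ps_old_sign : forall t, og_sign (ps_old t) = og_sign t;
  ps_tet_sign : forall s, og_sign (ps_tet s) = s;
  ps_next_old : forall e, e <> ps_e1 -> e <> ps_e2 ->
    og_next G' (map_edge ps_old e) = map_edge ps_old (og_next G e);
  ps_next_inner : forall k, k \in [:: x0; y0] ->
    og_next G' (pillow_out ps_tet k) = pillow_in ps_tet k;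
  ps_next_e1 : og_next G' (map_edge ps_old ps_e1) = pillow_in ps_tet q;
  ps_next_q : og_next G' (pillow_out ps_tet q) =
    if ps_e1 == ps_e2 then pillow_in ps_tet p
    else map_edge ps_old (og_next G ps_e1);
  ps_next_e2 : ps_e1 <> ps_e2 ->
    og_next G' (map_edge ps_old ps_e2) = pillow_in ps_tet p;
  ps_next_p : og_next G' (pillow_out ps_tet p) = map_edge ps_old (og_next G ps_e2)
}.

Definition dot_weight (i j : 'I_4) : int := (dotted i j)%:Z.

(* u1, u2 are the values of x at f1, f2, and y1, y1', y2, y2', z, t those of x'
   at f1', f1'', f2', f2'', x0pq, y0pq.  The triangle x0pq is F_(y0), and y0pq
   is F_(x0). *)
Definition integral_sliding : integral_move := fun G G' x x' =>
  exists (x0 y0 p q : 'I_4) (D : sliding_data x0 y0 p q G G'),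
  exists u1 u2 y1 y1' y2 y2' z t : int,
  let e1 := ps_e1 D in let e2 := ps_e2 D in
  let old := map_edge (ps_old D) in
  let pout := pillow_out (ps_tet D) in
  [/\ (if e1 == e2 then u1 + u2 = x e1 else u1 = x e1 /\ u2 = x e2),
      [/\ forall e, e <> e1 -> e <> e2 -> x' (old e) = x e,
          x' (pout y0) = z, x' (pout x0) = t
        & if e1 == e2 then
            [/\ x' (old e1) = y1, x' (pout q) = y1' + y2 & x' (pout p) = y2']
          else
            [/\ x' (old e1) = y1, x' (pout q) = y1', x' (old e2) = y2
              & x' (pout p) = y2']],
      [/\ sigma x0 p y0 * (y1 + y1') + sigma x0 p q * z
            = sigma x0 p y0 * u1 + dot_weight x0 p,
          sigma x0 q y0 * (y2 + y2') + sigma x0 q p * z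
            = sigma x0 q y0 * u2 + dot_weight x0 q,
          sigma y0 p x0 * (y1 + y1') + sigma y0 p q * t
            = sigma y0 p x0 * u1 + dot_weight y0 p
        & sigma y0 q x0 * (y2 + y2') + sigma y0 q p * t
            = sigma y0 q x0 * u2 + dot_weight y0 q],
      sigma p q x0 * z + sigma p q y0 * t = - 1 + dot_weight p q
    & forall s, euler_at x' ((ps_tet D s, (x0, y0)) : corner G')].

Definition framed_step (R : realType) (X X' : framed_ograph R) : Prop :=
  [\/ framed primary_integral_mp X X', framed integral_sliding X X',
      framed integral_H_move X X' | framed_iso X X'].

(* Normal o-graphs are considered up to isomorphism; inverse moves come from
   the symmetric closure. *)
Definition derivable_by_steps (R : realType) :
    framed_ograph R -> framed_ograph R -> Prop :=
  clos_refl_sym_trans _ (@framed_step R).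

(* Main.v *)
(** Label the vertices of the bipyramid by 0, ..., 4 and let D_i be the
    tetrahedron without the label i, so that the move of type (a, b, eps) replaces
    D_a, D_b by D_c, D_d, D_e.  Insert a pillow, made of D_c and its mirror image,
    along the faces of D_a and D_b around the edge de.  The result Y is obtained
    from the initial graph by a pure sliding move.  Now D_a, D_b, D_c surround the
    edge de, and Y is obtained from the final graph by the move of type
    (d, e, ~~ eps), which replaces D_d, D_e by D_a, D_b, D_c.  Hence type (a, b, eps)
    follows from type (d, e, ~~ eps).  The allowed pairs, with disjoint pairs adjacent,
    form the Petersen graph without {0, 1} and {3, 4}, which is connected and contains
    a 5-cycle, so all 16 types follow from the primary one.

    The graph Y has to be framed.  It is closed because an MP move changes the link of
    each vertex v by a bistellar move on a disc: both triangulations of the disc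
    subdivide the cone spanned by the labels other than v modulo one linear relation,
    and when its coefficients are balanced with respect to the signs of the vector
    field, the resulting projective homeomorphism preserves these signs.  Weights are
    simplicial 2-chains with boundary given by the Euler cochain, and H-moves add
    boundaries of tetrahedra; the weights of Y are chosen so that the composite of the
    two moves changes them by a chain carried by D_c. *)

From Stdlib Require Import Relations Operators_Properties.
Require Import Defs.
From mathcomp Require Import all_classical all_reals all_analysis.
From mathcomp Require Import all_boot all_order all_algebra all_fingroup.
From mathcomp Require Import zify ring lra.

Set Implicit Arguments.
Unset Strict Implicit.
Unset Printing Implicit Defensive.

Import Order.TTheory GRing.Theory Num.Theory.
Import numFieldNormedType.Exports.
Local Open Scope ring_scope.

(** * Labels and faces *)

Lemma lift_pos n (h i : 'I_n.+2) : i != h -> lift h (pos h i) = i.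
Proof. by move=> ih; rewrite /pos; case: unliftP ih => [j ->|->] //; rewrite eqxx. Qed.

Lemma pos_lift n (h : 'I_n.+2) (k : 'I_n.+1) : pos h (lift h k) = k.
Proof. by rewrite /pos liftK. Qed.

Lemma pos_inj n (h i j : 'I_n.+2) : i != h -> j != h -> pos h i = pos h j -> i = j.
Proof. by move=> ih jh e; rewrite -(lift_pos ih) -(lift_pos jh) e. Qed.

Lemma val_lift n (h : 'I_n) (k : 'I_n.-1) : lift h k = ((h <= k) + k)%N :> nat.
Proof. by []. Qed.

Lemma val_pos n (h i : 'I_n.+2) : i != h -> pos h i = (i - (h < i))%N :> nat.
Proof.
move=> ih; have := congr1 val (lift_pos ih); rewrite /= /bump.
move: ih; rewrite -val_eqE /=.
by case: (ltngtP h i) => //= hi _; case: (leqP h) => hk; move=> e; lia.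
Qed.

Lemma lift_ltE n (h : 'I_n.+1) (k l : 'I_n) : (lift h k < lift h l)%N = (k < l)%N.
Proof. by rewrite !val_lift; case: (leqP h k) => ?; case: (leqP h l) => ? /=; rewrite ?add0n ?add1n; lia. Qed.

Lemma pos_ltE n (h i j : 'I_n.+2) :
  i != h -> j != h -> (pos h i < pos h j)%N = (i < j)%N.
Proof. by move=> ih jh; rewrite -(lift_ltE h) !lift_pos. Qed.

Lemma odd_pos n (i j : 'I_n.+2) :
  i != j -> odd (pos i j) = ~~ (odd (pos j i) (+) odd i (+) odd j).
Proof.
move=> ij; rewrite !val_pos // 1?eq_sym //; move: ij; rewrite -val_eqE /=.
by case: ltngtP => // ij _; rewrite ?subn0 ?subn1; lia.
Qed.

Lemma lift_lift_pos n (i j : 'I_n.+3) (m : 'I_n.+1) :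
  i != j -> lift i (lift (pos i j) m) = lift j (lift (pos j i) m).
Proof.
move=> ij; have ji : j != i by rewrite eq_sym.
apply: val_inj; rewrite /= !val_pos // /bump.
move: ij; rewrite -val_eqE /=; case: ltngtP => // ij _ /=; rewrite ?subn0 ?subn1.
  by case: (leqP j.-1 m) => ?; case: (leqP i m) => ? /=; rewrite ?add0n ?add1n; lia.
by case: (leqP i.-1 m) => ?; case: (leqP j m) => ? /=; rewrite ?add0n ?add1n; lia.
Qed.

Lemma sigma_lift (h i j k : nat) :
  sigma (bump h i) (bump h j) (bump h k) = sigma i j k.
Proof. by rewrite /sigma /bump; do 2 case: ifP => //; lia. Qed.

Section Faces.
Variable G : ograph.
Implicit Types (e : edge G) (F : face G).

Lemma ord4P (P : 'I_4 -> Prop) :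
  P (inord 0) -> P (inord 1) -> P (inord 2) -> P (inord 3) -> forall k, P k.
Proof.
by move=> P0 P1 P2 P3 k; rewrite -(inord_val k); case: k => [[|[|[|[|]]]]].
Qed.

Lemma incoming_out s st : incoming s (out_face s st) = false.
Proof. by rewrite /incoming /out_face; case: s; case: st; rewrite inordK. Qed.

Lemma incoming_in s st : incoming s (in_face s st).
Proof. by rewrite /incoming /in_face; case: s; case: st; rewrite inordK. Qed.

Lemma strand_out s st : face_strand (out_face s st) = st.
Proof. by rewrite /face_strand /out_face; case: s; case: st; rewrite inordK. Qed.

Lemma strand_in s st : face_strand (in_face s st) = st.
Proof. by rewrite /face_strand /in_face; case: s; case: st; rewrite inordK. Qed.

Lemma out_strand s k : ~~ incoming s k -> out_face s (face_strand k) = k.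
Proof.
rewrite /incoming /out_face /face_strand.
by elim/ord4P: k; rewrite inordK //; case: s.
Qed.

Lemma in_strand s k : incoming s k -> in_face s (face_strand k) = k.
Proof.
rewrite /incoming /in_face /face_strand.
by elim/ord4P: k; rewrite inordK //; case: s.
Qed.

Definition inc F : bool := incoming (og_sign F.1) F.2.

Lemma inc_out e : inc (out_side e) = false.
Proof. exact: incoming_out. Qed.

Lemma inc_in e : inc (in_side e).
Proof. exact: incoming_in. Qed.

Lemma triangle_out e : triangle (out_side e) = e.
Proof. by rewrite /triangle [incoming _ _]inc_out /= strand_out; case: e. Qed.

Lemma triangle_in e : triangle (in_side (og_next G e)) = e.
Proof.
rewrite /triangle [incoming _ _]inc_in /= strand_in -surjective_pairing.
by rewrite permK.
Qed.

Lemma mate_out e : mate (out_side e) = in_side (og_next G e).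
Proof. by rewrite /mate [incoming _ _]inc_out triangle_out. Qed.

Lemma mate_in e : mate (in_side (og_next G e)) = out_side e.
Proof. by rewrite /mate [incoming _ _]inc_in triangle_in. Qed.

Lemma faceP F : F = if inc F then in_side (og_next G (triangle F))
                    else out_side (triangle F).
Proof.
rewrite /triangle -/(inc F); case iF: (inc F); last first.
  by rewrite /out_side /= out_strand ?[incoming _ _]iF //; case: F iF.
by rewrite permKV /in_side /= in_strand //; case: F iF.
Qed.

Lemma out_triangle F : out_side (triangle F) = if inc F then mate F else F.
Proof.
case: ifP => iF; last by rewrite [RHS]faceP iF.
by rewrite [in RHS](faceP F) iF mate_in.
Qed.

Lemma triangle_mate F : triangle (mate F) = triangle F.
Proof.
by rewrite (faceP F); case: ifP; rewrite ?mate_in ?mate_out ?triangle_in ?triangle_out.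
Qed.

Lemma mateK : involutive (@mate G).
Proof. by move=> F; rewrite (faceP F); case: ifP; rewrite ?mate_in ?mate_out ?mate_in. Qed.

Lemma inc_mate F : inc (mate F) = ~~ inc F.
Proof.
by rewrite (faceP F); case: ifP; rewrite ?mate_in ?mate_out ?inc_in ?inc_out.
Qed.

Lemma mate_neq F : mate F != F.
Proof. by apply/eqP => e; have := inc_mate F; rewrite e; case: inc. Qed.

Lemma mate_inj : injective (@mate G).
Proof. exact: inv_inj mateK. Qed.

Lemma triangle_eq F F' : triangle F = triangle F' -> F = F' \/ F = mate F'.
Proof.
move=> e; rewrite (faceP F) (faceP F') e.
by do 2 case: ifP => _; rewrite ?mate_in ?mate_out; [left|right|right|left].
Qed.

Lemma corner_glueP (c c' : corner G) :
  reflect (exists F m, c = face_side F m /\ c' = face_side (mate F) m)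
          (corner_glue c c').
Proof.
apply: (iffP existsP) => -[F].
  by case/existsP => m /andP[/eqP-> /eqP->]; exists F, m.
by case=> m [-> ->]; exists F; apply/existsP; exists m; rewrite !eqxx.
Qed.

Lemma corner_glue_sym : symmetric (@corner_glue G).
Proof.
have s (c c' : corner G) : corner_glue c c' -> corner_glue c' c.
  by case/corner_glueP => F [m [-> ->]]; apply/corner_glueP; exists (mate F), m; rewrite mateK.
by move=> c c'; apply/idP/idP; apply: s.
Qed.

Lemma same_edge_sym : symmetric (@same_edge G).
Proof. exact: sym_connect_sym corner_glue_sym. Qed.

Lemma same_edge_mate F m : same_edge (face_side F m) (face_side (mate F) m).
Proof. by apply: connect1; apply/corner_glueP; exists F, m. Qed.

Lemma sum_triangles (f : face G -> int) : (forall F, f (mate F) = f F) ->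
  (\sum_(e : og_vertex G * strand) f (out_side e)) *+ 2 = \sum_(F : og_vertex G * 'I_4) f F.
Proof.
move=> fm; rewrite (bigID (fun F => inc F)) /= mulr2n; congr (_ + _).
  rewrite (reindex (fun e => mate (@out_side G e))) /=.
    by apply: eq_big => [e|e _]; rewrite ?fm // inc_mate inc_out.
  exists (@triangle G) => [e _|F]; first by rewrite triangle_mate triangle_out.
  by rewrite inE => iF; rewrite out_triangle iF mateK.
rewrite (reindex (@out_side G)) /=; first by apply: eq_bigl => e; rewrite inc_out.
exists (@triangle G) => [e _|F]; first by rewrite triangle_out.
by rewrite inE => iF; rewrite out_triangle (negbTE iF).
Qed.

End Faces.

(** * Replacing one half of the boundary of a 4-simplex by the other *)

Definition side0 (i j : 'I_5) (m : 'I_3) : 'I_5 := lift i (lift (pos i j) (lift m ord0)).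
Definition side1 (i j : 'I_5) (m : 'I_3) : 'I_5 := lift i (lift (pos i j) (lift m ord_max)).

Lemma side0C i j m : i != j -> side0 i j m = side0 j i m.
Proof. exact: lift_lift_pos. Qed.

Lemma side1C i j m : i != j -> side1 i j m = side1 j i m.
Proof. exact: lift_lift_pos. Qed.

Lemma side_neq i j m : i != j ->
  [/\ side0 i j m != i, side0 i j m != j, side1 i j m != i & side1 i j m != j].
Proof.
have n0 k l : side0 k l m != k by rewrite eq_sym neq_lift.
have n1 k l : side1 k l m != k by rewrite eq_sym neq_lift.
by move=> ij; split; rewrite // ?(side0C m ij) ?(side1C m ij).
Qed.

Lemma side_lt i j m : (side0 i j m < side1 i j m)%N.
Proof. by rewrite !lift_ltE. Qed.

Lemma face_sideE (G : ograph) (t : G) i j m :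
  face_side (t, pos i j) m = (t, (pos i (side0 i j m), pos i (side1 i j m))).
Proof. by rewrite /face_side /= !pos_lift. Qed.

Lemma sideP (i j p q : 'I_5) : i != j -> (p < q)%N ->
    p != i -> p != j -> q != i -> q != j ->
  exists2 m, side0 i j m = p & side1 i j m = q.
Proof.
move=> ij pq pi pj qi qj.
have ppj : pos i p != pos i j by apply: contra_neq pj => /pos_inj ->; rewrite // eq_sym.
have pqj : pos i q != pos i j by apply: contra_neq qj => /pos_inj ->; rewrite // eq_sym.
have [m m0 m1] : exists2 m : 'I_3, lift m ord0 = pos (pos i j) (pos i p) &
                                   lift m (ord_max : 'I_2) = pos (pos i j) (pos i q).
  have : (pos (pos i j) (pos i p) < pos (pos i j) (pos i q))%N by rewrite !pos_ltE.
  move: (pos _ (pos i p)) (pos _ (pos i q)) => k l kl.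
  have E m : (m < 3)%N -> lift (inord m) ord0 = k -> lift (inord m) ord_max = l ->
    exists2 m : 'I_3, lift m ord0 = k & lift m (ord_max : 'I_2) = l by exists (inord m).
  case: k kl E => [[|[|[|//]]] kP]; case: l => [[|[|[|//]]] lP] // _ E.
  - by apply: (E 2) => //; apply: val_inj; rewrite /= inordK.
  - by apply: (E 1) => //; apply: val_inj; rewrite /= inordK.
  - by apply: (E 0) => //; apply: val_inj; rewrite /= inordK.
by exists m; rewrite /side0 /side1 ?m0 ?m1 !lift_pos.
Qed.

Section Bistellar.
Variables (S : pred 'I_5) (G G' : ograph) (T : 'I_5 -> G) (T' : 'I_5 -> G').
Variable far : G -> G' -> Prop.

Inductive bs_corr : face G -> face G' -> Prop :=
| BsFar t t' k : far t t' -> bs_corr (t, k) (t', k)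
| BsOuter i j : S i -> ~~ S j -> bs_corr (T i, pos i j) (T' j, pos j i).

Inductive bs_corner : corner G -> corner G' -> Prop :=
| BsFarCorner t t' kl : far t t' -> bs_corner (t, kl) (t', kl)
| BsBipCorner (i j p q : 'I_5) : S i -> ~~ S j -> (p < q)%N ->
    p != i -> p != j -> q != i -> q != j ->
    bs_corner (T i, (pos i p, pos i q)) (T' j, (pos j p, pos j q)).

Record bistellar : Prop := Bistellar {
  bs_inj : {in S &, injective T};
  bs_inj' : {in predC S &, injective T'};
  bs_far : forall t t' i, far t t' -> S i -> T i <> t;
  bs_far' : forall t t' j, far t t' -> ~~ S j -> T' j <> t';
  bs_cover : forall t, (exists2 i, S i & T i = t) \/ exists t', far t t';
  bs_cover' : forall t', (exists2 j, ~~ S j & T' j = t') \/ exists t, far t t';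
  bs_fun : forall t t1 t2, far t t1 -> far t t2 -> t1 = t2;
  bs_fun' : forall t1 t2 t', far t1 t' -> far t2 t' -> t1 = t2;
  bs_glue : forall i j, S i -> S j -> i != j -> mate (T i, pos i j) = (T j, pos j i);
  bs_glue' : forall i j, ~~ S i -> ~~ S j -> i != j ->
    mate (T' i, pos i j) = (T' j, pos j i);
  bs_outer : forall F F', bs_corr F F' -> bs_corr (mate F) (mate F')
}.

Hypothesis B : bistellar.

Lemma bs_faceP F :
  (exists i j, [/\ S i, S j, i != j & F = (T i, pos i j)]) \/ exists F', bs_corr F F'.
Proof.
case: F => t k; case: (bs_cover B t) => [[i Si <-]|[t' ft]]; last first.
  by right; exists (t', k); apply: BsFar.
case Sk: (S (lift i k)); [left|right].
  by exists i, (lift i k); rewrite pos_lift neq_lift.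
exists (T' (lift i k), pos (lift i k) i); rewrite -{1}[k](pos_lift i).
by apply: BsOuter; rewrite ?Sk.
Qed.

Lemma bs_corner_side F F' m : bs_corr F F' -> bs_corner (face_side F m) (face_side F' m).
Proof.
case=> [t t' k ft|i j Si Sj]; first exact: BsFarCorner.
have ij : i != j by apply: contraTneq Si => ->.
rewrite !face_sideE -(side0C m ij) -(side1C m ij).
by have [? ? ? ?] := side_neq m ij; apply: BsBipCorner => //; apply: side_lt.
Qed.

Lemma same_edge_new (i j p q : 'I_5) : ~~ S i -> ~~ S j -> (p < q)%N ->
  p != i -> p != j -> q != i -> q != j ->
  same_edge (T' i, (pos i p, pos i q)) (T' j, (pos j p, pos j q)).
Proof.
move=> Si Sj pq pi pj qi qj; have [<-|ij] := eqVneq i j; first exact: connect0.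
have [m <- <-] := sideP ij pq pi pj qi qj.
have := same_edge_mate (T' i, pos i j) m; rewrite bs_glue' // !face_sideE.
by rewrite -(side0C m ij) -(side1C m ij).
Qed.

Lemma bs_corner_bip i c' p q : bs_corner (T i, (pos i p, pos i q)) c' ->
    S i -> p != i -> q != i ->
  exists j, [/\ ~~ S j, (p < q)%N, p != j, q != j & c' = (T' j, (pos j p, pos j q))].
Proof.
move e: (T i, _) => c h Si pi qi.
case: c c' / h e => [t t' kl ft [tE]|i2 j p2 q2 Si2 Sj lt2 p2i p2j q2i q2j [tE pE qE]].
  by case: (bs_far B ft Si).
have ii : i = i2 by apply: (bs_inj B).
rewrite -ii in pE qE p2i q2i *; exists j.
by rewrite (pos_inj pi p2i pE) (pos_inj qi q2i qE).
Qed.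

Lemma bs_corner_fun c c1 c2 : bs_corner c c1 -> bs_corner c c2 -> same_edge c1 c2.
Proof.
move=> h1; case: c c1 / h1 => [t t' kl ft|i j p q Si Sj pq pi pj qi qj] h2.
  move e: (t, kl) h2 => c h2; case: c c2 / h2 e => [t2 t2' kl2 ft2 [te <-]|].
    by rewrite -te in ft2; rewrite (bs_fun B ft ft2); apply: connect0.
  by move=> i j p q Si _ _ _ _ _ _ [te _]; case: (bs_far B ft Si).
have [j2 [Sj2 _ pj2 qj2 ->]] := bs_corner_bip h2 Si pi qi.
exact: same_edge_new.
Qed.

Lemma bs_corner_glue c d c' : bs_corner c c' -> corner_glue c d ->
  exists2 d', bs_corner d d' & same_edge c' d'.
Proof.
move=> h /corner_glueP[F [m [cE dE]]]; have [[i [j [Si Sj ij FE]]]|[F' FF']] := bs_faceP F.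
  rewrite FE in cE dE *; rewrite bs_glue // in dE.
  rewrite cE face_sideE in h; have [n1 n2 n3 n4] := side_neq m ij.
  have [k [Sk pq pk qk ->]] := bs_corner_bip h Si n1 n3.
  exists (T' k, (pos k (side0 i j m), pos k (side1 i j m))); last exact: connect0.
  by rewrite dE face_sideE -(side0C m ij) -(side1C m ij); apply: BsBipCorner.
exists (face_side (mate F') m); first by rewrite dE; apply: bs_corner_side; apply: bs_outer.
apply: connect_trans (same_edge_mate _ _).
by apply: (bs_corner_fun h); rewrite cE; apply: bs_corner_side.
Qed.

Lemma bs_same_edge c d c' : bs_corner c c' -> same_edge c d ->
  exists2 d', bs_corner d d' & same_edge c' d'.
Proof.
move=> h /connectP[s]; elim: s c c' h => [|c1 s IH] c c' h /=.
  by move=> _ ->; exists c' => //; apply: connect0.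
case/andP=> g p dE; have [c1' h1 e1] := bs_corner_glue h g.
have [d' hd e2] := IH _ _ h1 p dE; exists d' => //; exact: connect_trans e1 e2.
Qed.

Lemma bs_same_edge_corner c d c' d' : bs_corner c c' -> bs_corner d d' ->
  same_edge c d -> same_edge c' d'.
Proof.
move=> hc hd e; have [d2 hd2 e2] := bs_same_edge hc e.
exact: connect_trans e2 (bs_corner_fun hd2 hd).
Qed.

End Bistellar.

Lemma bs_corr_sym S (G G' : ograph) (T : 'I_5 -> G) (T' : 'I_5 -> G') far F F' :
  bs_corr S T T' far F F' <-> bs_corr (predC S) T' T (fun t' t => far t t') F' F.
Proof.
split; case=> [t t' k ft|i j Si Sj]; do ?[exact: BsFar].
  by apply: BsOuter; rewrite //= negbK.
by apply: BsOuter => //; apply/negbNE.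
Qed.

Lemma bistellar_sym S (G G' : ograph) (T : 'I_5 -> G) (T' : 'I_5 -> G') far :
  bistellar S T T' far -> bistellar (predC S) T' T (fun t' t => far t t').
Proof.
case=> i1 i2 f1 f2 c1 c2 u1 u2 g1 g2 o.
split=> //=.
- by move=> i j Si Sj; apply: i1; apply/negbNE.
- by move=> t t' i ft Si; apply: (f2 _ _ _ ft).
- by move=> t t' i ft /negbNE; apply: (f1 _ _ _ ft).
- by move=> t; case: (c1 t) => [[i Si <-]|]; [left; exists i; rewrite ?negbK|right].
- by move=> t t1 t2; apply: u2.
- by move=> t t1 t2; apply: u1.
- by move=> i j /negbNE Si /negbNE Sj; apply: g1.
by move=> F F' h; apply: (proj1 (bs_corr_sym S T T' far _ _)); apply: o; apply: (proj2 (bs_corr_sym S T T' far _ _)).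
Qed.

Lemma bs_corner_sym S (G G' : ograph) (T : 'I_5 -> G) (T' : 'I_5 -> G') far c c' :
  bs_corner S T T' far c c' -> bs_corner (predC S) T' T (fun t' t => far t t') c' c.
Proof.
case=> [t t' kl ft|i j p q Si Sj pq pi pj qi qj]; first exact: BsFarCorner.
by apply: BsBipCorner; rewrite //= negbK.
Qed.

Section OfMP.
Variables (a b : 'I_5) (eps : bool) (G G' : ograph) (D : mp_data a b eps G G').

Definition mp_far_rel (t : G) (t' : G') : Prop :=
  (forall i, removed a b i -> mp_told D i <> t) /\ mp_far D t = t'.

Lemma mp_corrP F F' :
  corresponding a b (mp_told D) (mp_tnew D) (mp_far D) F F' <->
  bs_corr (removed a b) (mp_told D) (mp_tnew D) mp_far_rel F F'.
Proof.
split; case.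
- by move=> t k h; apply: BsFar.
- by move=> i j Si Sj; apply: BsOuter.
- by move=> t t' k [h <-]; apply: FarFace.
- by move=> i j Si Sj; apply: OuterFace.
Qed.

Lemma mp_bistellar : bistellar (removed a b) (mp_told D) (mp_tnew D) mp_far_rel.
Proof.
split.
- exact: mp_told_inj.
- exact: mp_tnew_inj.
- by move=> t t' i [h _]; apply: h.
- move=> t t' j [h e]; have [h2 _] := mp_far_image D t'.
  by apply: h2; exists t.
- move=> t; have [/existsP[i /andP[Si /eqP e]]|/existsPn h] :=
    boolP [exists i, removed a b i && (mp_told D i == t)]; first by left; exists i.
  right; exists (mp_far D t); split=> // i Si e; move: (h i).
  by rewrite Si e eqxx.
- move=> t'; have [/existsP[i /andP[Si /eqP e]]|/existsPn h] :=
    boolP [exists i, ~~ removed a b i && (mp_tnew D i == t')]; first by left; exists i.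
  right; have [_] := mp_far_image D t'.
  case=> [j Sj e|t h2 e]; last by exists t.
  by move: (h j); rewrite Sj e eqxx.
- by move=> t t1 t2 [_ <-] [_ <-].
- by move=> t1 t2 t [h1 e1] [h2 e2]; apply: (mp_far_inj (m := D)); rewrite ?e1 ?e2.
- exact: mp_told_glue.
- exact: mp_tnew_glue.
- by move=> F F' /mp_corrP/(mp_outer_glue (m := D))/mp_corrP.
Qed.

End OfMP.

(** * MP moves and the Euler cochain *)

Section Sums.
Variable V : nmodType.

Lemma big_lift n (h : 'I_n.+2) (P : pred 'I_n.+2) (f : 'I_n.+2 -> V) :
  \sum_(i | (i != h) && P i) f i = \sum_(k | P (lift h k)) f (lift h k).
Proof.
rewrite (reindex_onto (lift h) (pos h)) /=; last by move=> i /andP[/lift_pos].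
by apply: eq_bigl => k; rewrite pos_lift eqxx andbT eq_sym neq_lift.
Qed.

Lemma big_pos n (h : 'I_n.+2) (f : 'I_n.+1 -> V) :
  \sum_k f k = \sum_(i | i != h) f (pos h i).
Proof.
under [RHS]eq_bigl do rewrite -[_ != h]andbT.
by rewrite (big_lift h xpredT); apply: eq_bigr => k _; rewrite pos_lift.
Qed.

Lemma sum_third (i j : 'I_5) (f : 'I_5 -> 'I_5 -> 'I_5 -> V) : i != j ->
  \sum_(m < 3) f (side0 i j m) (side1 i j m) (lift i (lift (pos i j) m)) =
  \sum_(p < 5) \sum_(q < 5) \sum_(r < 5) (if (p < q)%N && uniq [:: p; q; r; i; j] then f p q r else 0).
Proof.
move=> ij; set L := fun k => lift i (lift (pos i j) k).
have L_inj k l : (L k == L l) = (k == l) by rewrite !(inj_eq lift_inj).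
have big_L (g : 'I_5 -> V) : (forall p, p \in [:: i; j] -> g p = 0) ->
    \sum_p g p = \sum_(k < 3) g (L k).
  move=> g0; rewrite (bigD1 i) //= g0 ?mem_head // add0r.
  under eq_bigl do rewrite -[_ != i]andbT.
  rewrite (big_lift i xpredT) (bigD1 (pos i j)) //= lift_pos 1?eq_sym //.
  rewrite g0 ?inE ?eqxx ?orbT // add0r.
  by under eq_bigl do rewrite -[_ != pos i j]andbT; rewrite (big_lift _ xpredT).
have Li k : (L k == i) = false by rewrite eq_sym (negbTE (neq_lift _ _)).
have Lj k : (L k == j) = false.
  by rewrite /L lift_lift_pos // eq_sym (negbTE (neq_lift _ _)).
rewrite [RHS]big_L; last first.
  move=> p pij; apply: big1 => q _; apply: big1 => r _; case: ifP => //.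
  by case/andP=> _ /=; case/and3P; move: pij; rewrite !inE => /orP[]/eqP ->; rewrite eqxx ?orbT.
under [RHS]eq_bigr => k1 _.
  rewrite big_L; last first.
    move=> q qij; apply: big1 => r _; case: ifP => //.
    by case/andP=> _ /=; case/and3P => _; move: qij; rewrite !inE => /orP[]/eqP ->; rewrite eqxx ?orbT.
  under eq_bigr => k2 _.
    rewrite big_L; last first.
      move=> r rij; case: ifP => //.
      by case/andP=> _ /=; case/and4P => _ _; move: rij; rewrite !inE => /orP[]/eqP ->; rewrite eqxx ?orbT.
    under eq_bigr => k3 _.
      have -> : ((L k1 < L k2)%N && uniq [:: L k1; L k2; L k3; i; j]) =
                ((k1 < k2)%N && uniq [:: k1; k2; k3]).
        rewrite !lift_ltE; congr (_ && _).
        by rewrite /= !inE !L_inj !Li !Lj ij !orbF !andbT.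
      over.
    over.
  over.
rewrite /side0 /side1 -!/(L _) !big_ord_recl !big_ord0 /= !addr0 !add0r.
have Le (k l : 'I_3) : k = l :> nat -> L k = L l by move=> /val_inj ->.
rewrite [RHS]addrC [X in _ = _ + X]addrC.
by congr (_ + _); [|congr (_ + _)]; congr f; apply: Le.
Qed.

End Sums.

Lemma eq_setC2 (i j u v : 'I_5) : (~: [set i; j] == ~: [set u; v]) =
  ((i == u) && (j == v)) || ((i == v) && (j == u)).
Proof.
rewrite (inj_eq (@setC_inj _)); apply/eqP/idP => [e|]; last first.
  by case/orP=> /andP[/eqP-> /eqP->] //; rewrite setUC.
have m k : (k \in [set i; j]) = (k \in [set u; v]) by rewrite e.
have := m i; have := m j; have := m u; have := m v.
rewrite !inE !eqxx ?orbT /=.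
rewrite ![u == _]eq_sym ![v == _]eq_sym.
by case: (i == u); case: (i == v); case: (j == u); case: (j == v).
Qed.

Lemma exchange_big3 (V : nmodType) (I J K : finType) (f : I -> J -> K -> V) :
  \sum_i \sum_j \sum_k f i j k = \sum_k \sum_i \sum_j f i j k.
Proof.
rewrite [RHS]exchange_big; apply: eq_bigr => i _.
by rewrite [RHS]exchange_big.
Qed.

Section Pairing.
Variables (a b : 'I_5) (w : bipyramid_weight).
Hypothesis ab : a != b.
Let S := removed a b.

Lemma removedE (u v : 'I_5) : u != v ->
  (S u && S v) = (~: [set u; v] == ~: [set a; b]).
Proof.
move=> uv; rewrite eq_setC2 /S /removed !inE.
have ua : ~~ ((u == a) && (v == a)) by apply: contra uv => /andP[/eqP-> /eqP->].
have ub : ~~ ((u == b) && (v == b)) by apply: contra uv => /andP[/eqP-> /eqP->].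
by move: ua ub; case: (u == a); case: (u == b); case: (v == a); case: (v == b).
Qed.

Lemma sum_complement (p q r : 'I_5) : uniq [:: p; q; r] ->
  \sum_(i < 5) \sum_(j < 5) (if uniq [:: p; q; r; i; j] && ~~ (S i && S j)
                             then w (~: [set i; j])%SET else 0) =
  if [set p; q; r]%SET != ~: [set a; b]%SET then w [set p; q; r]%SET *+ 2 else 0.
Proof.
move=> pqr; have /eqP/cards2P[u [v [uv E]]] : #|~: [set p; q; r]| = 2%N.
  move: pqr; rewrite cardsCs setCK card_ord /= !inE negb_or -!andbA => /and4P[pq pr qr _].
  by rewrite setUC cardsU1 cards2 !inE negb_or ![r == _]eq_sym pr qr pq.
have -> : [set p; q; r] = ~: [set u; v] by rewrite -E setCK.
have mem i : (i \in [:: p; q; r]) = ~~ ((i == u) || (i == v)).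
  have : (i \in ~: [set p; q; r]) = (i \in [set u; v]) by rewrite E.
  by rewrite !inE => <-; rewrite negbK orbA.
have un i j : uniq [:: p; q; r; i; j] =
    ((i == u) && (j == v)) || ((i == v) && (j == u)).
  rewrite -[[:: _, _ & _]]/([:: p; q; r] ++ [:: i; j]) cat_uniq pqr /= !mem inE.
  rewrite orbF negb_or !negbK andbT.
  have /negbTE n1 : ~~ ((i == u) && (i == v)) by apply: contra uv => /andP[/eqP<- /eqP<-].
  have /negbTE n2 : ~~ ((j == u) && (j == v)) by apply: contra uv => /andP[/eqP<- /eqP<-].
  case: (eqVneq i j) => [<-|ij]; first by rewrite andbF n1 andbC n1.
  have n3 : ~~ ((i == u) && (j == u)) by apply: contra ij => /andP[/eqP-> /eqP->].
  have n4 : ~~ ((i == v) && (j == v)) by apply: contra ij => /andP[/eqP-> /eqP->].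
  by move: n1 n2 n3 n4; case: (i == u); case: (i == v); case: (j == u); case: (j == v).
under eq_bigr => i _ do under eq_bigr => j _ do rewrite un.
rewrite pair_bigA /= -big_mkcond -removedE //=.
case SS: (S u && S v) => /=.
  rewrite big1 // => -[i j] /= /andP[/orP[]/andP[/eqP-> /eqP->]];
  by rewrite ?SS // andbC SS.
rewrite (bigD1 (u, v)) /=; last by rewrite !eqxx SS.
rewrite (bigD1 (v, u)) /=; last first.
  by rewrite !eqxx orbT [S v && _]andbC SS xpair_eqE eq_sym (negbTE uv).
rewrite big1 ?addr0 ?mulr2n; last first.
  move=> [i j] /=; rewrite !xpair_eqE => /andP[/andP[/andP[/orP[]]]];
  by case/andP=> -> ->.
by congr (_ + w _); rewrite setUC.
Qed.

Lemma bip_pairing (th : 'I_5 -> 'I_5 -> int) :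
  \sum_(i < 5) \sum_(j < 5 | (j != i) && ~~ (S i && S j)) w (~: [set i; j])%SET *
     \sum_(m < 3) sigma (lift m (ord0 : 'I_2)) (lift m (ord_max : 'I_2)) m *
        th (side0 i j m) (side1 i j m)
  = (\sum_(p < 5) \sum_(q < 5 | (p < q)%N) bipyramid_coboundary a b w p q * th p q) *+ 2.
Proof.
pose N (p q r i j : 'I_5) := if (p < q)%N && uniq [:: p; q; r; i; j] && ~~ (S i && S j)
  then sigma p q r * th p q * w (~: [set i; j]) else 0.
transitivity (\sum_i \sum_j \sum_p \sum_q \sum_r N p q r i j).
  apply: eq_bigr => i _; rewrite big_mkcond /=; apply: eq_bigr => j _.
  case: ifP => [/andP[ji SS]|nij]; last first.
    symmetry; do 3! (apply: big1 => ? _); rewrite /N; case: ifP => // /andP[/andP[_ u] SS].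
    move: nij; rewrite SS andbT eq_sym => /negbFE/eqP ij; move: u.
    by rewrite ij /= !inE eqxx !andbF.
  rewrite eq_sym in ji.
  pose f (p q r : 'I_5) := sigma p q r * th p q * w (~: [set i; j]).
  transitivity (\sum_(m < 3) f (side0 i j m) (side1 i j m) (lift i (lift (pos i j) m))).
    by rewrite mulr_sumr; apply: eq_bigr => m _; rewrite /f /= !sigma_lift mulrC.
  rewrite sum_third //; do 3! (apply: eq_bigr => ? _); rewrite /N SS andbT.
  by case: ifP.
rewrite exchange_big3 -sumrMnl; apply: eq_bigr => p _.
rewrite exchange_big3 -sumrMnl [RHS]big_mkcond; apply: eq_bigr => q _.
rewrite exchange_big3; case: ifP => pq; last first.
  by do 3! (apply: big1 => ? _); rewrite /N pq.
rewrite /bipyramid_coboundary mulr_suml -sumrMnl [RHS]big_mkcond /=; apply: eq_bigr => r _.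
have pq' : p != q by rewrite -val_eqE neq_ltn pq.
case: (boolP (r \in [:: p; q])) => rpq /=.
  do 2! (apply: big1 => ? _); rewrite /N pq /=; case: ifP => // /andP[/and3P[+ + _] _].
  by move: rpq; rewrite !inE ![r == _]eq_sym => /orP[]/eqP->; rewrite eqxx ?orbT.
have u : uniq [:: p; q; r].
  by move: rpq; rewrite /= !inE !negb_or pq' ![r == _]eq_sym => /andP[-> ->].
transitivity (sigma p q r * th p q * \sum_i \sum_j
    (if uniq [:: p; q; r; i; j] && ~~ (S i && S j) then w (~: [set i; j]) else 0)).
  rewrite mulr_sumr; apply: eq_bigr => i _; rewrite mulr_sumr; apply: eq_bigr => j _.
  by rewrite /N pq /=; case: ifP => _; rewrite ?mulr0.
rewrite sum_complement //; case: ifP => _; rewrite ?mulr0 //.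
by rewrite mulrnAr mulrAC.
Qed.
End Pairing.

Section TetSums.
Variables (S : pred 'I_5) (G G' : ograph) (T : 'I_5 -> G) (T' : 'I_5 -> G').
Variable far : G -> G' -> Prop.
Hypothesis B : bistellar S T T' far.

Lemma sum_tets (V : nmodType) (f : G -> V) :
  \sum_t f t = \sum_(i | S i) f (T i) +
    \sum_t \sum_(t' | `[< far t t' >]) f t.
Proof.
have bip t : \sum_(i | S i && (T i == t)) f t =
             if [exists i, S i && (T i == t)] then f t else 0.
  case: existsP => [[i Pi]|nex]; last by rewrite big_pred0 // => i; apply/negP => Pi; case: nex; exists i.
  rewrite (big_pred1 i) // => j /=; apply/idP/eqP => [|->//].
  case/andP: Pi => Si /eqP Ti /andP[Sj /eqP Tj].
  by apply: (bs_inj B); rewrite ?Ti.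
have -> : \sum_(i | S i) f (T i) = \sum_t \sum_(i | S i && (T i == t)) f t.
  rewrite [RHS](exchange_big_dep S) /=; last by move=> t i _ /andP[].
  apply: eq_bigr => i Si; rewrite (big_pred1 (T i)) // => t /=.
  by rewrite Si eq_sym.
rewrite -big_split /=; apply: eq_bigr => t _; rewrite bip.
case: existsP => [[i /andP[Si /eqP Ti]]|nex].
  rewrite big_pred0 ?addr0 // => t'; apply/negbTE/asboolPn => ft.
  exact: (bs_far B ft Si Ti).
have [[i Si Ti]|[t' ft]] := bs_cover B t.
  by case: nex; exists i; rewrite Si Ti eqxx.
rewrite add0r (big_pred1 t') // => u /=; apply/asboolP/eqP => [fu|->//].
exact: (bs_fun B fu ft).
Qed.

End TetSums.

Lemma sum_far_tets (V : zmodType) S (G G' : ograph) (T : 'I_5 -> G) (T' : 'I_5 -> G')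
    far (f : G -> V) (f' : G' -> V) : bistellar S T T' far ->
    (forall t t', far t t' -> f t = f' t') ->
  \sum_t' f' t' - \sum_(j | ~~ S j) f' (T' j) = \sum_t f t - \sum_(i | S i) f (T i).
Proof.
move=> B ff'; rewrite (sum_tets B) (sum_tets (bistellar_sym B)) /= ![_ + _ - _]addrAC !subrr !add0r.
rewrite (exchange_big_dep xpredT) //=; apply: eq_bigr => t _; apply: eq_bigr => t' /asboolP ft.
by rewrite (ff' _ _ ft).
Qed.

Section Pairings.
Variables (G : ograph) (th : corner G -> int).

Definition face_pairing (F : face G) : int :=
  \sum_(m < 3) sigma (lift m (ord0 : 'I_2)) (lift m (ord_max : 'I_2)) m * th (face_side F m).

Definition tri_pairing (x : edge G -> int) : int :=
  \sum_(t : G) \sum_(k < 4) face_pairing (t, k) * x (triangle (t, k)).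

Definition dot_pairing : int :=
  \sum_(t : G) \sum_(k < 4) \sum_(l < 4 | (k < l)%N) (dotted k l)%:Z * th (t, (k, l)).

End Pairings.

Definition edge_ind (G : ograph) (c c' : corner G) : int := (same_edge c' c)%:Z.

Lemma face_pairing_mate (G : ograph) (c : corner G) F :
  face_pairing (edge_ind c) (mate F) = face_pairing (edge_ind c) F.
Proof.
apply: eq_bigr => m _; congr (_ * (_ : bool)%:Z).
have e := same_edge_mate F m.
apply/idP/idP => h; first exact: connect_trans e h.
by apply: connect_trans h; rewrite -/(same_edge _ _) same_edge_sym.
Qed.

Lemma tri_pairing_ind (G : ograph) (x : edge G -> int) c :
  tri_pairing (edge_ind c) x = coboundary x c *+ 2.
Proof.
rewrite /tri_pairing pair_bigA /= -(sum_triangles (f := fun F => face_pairing (edge_ind c) F * x (triangle F))).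
  congr (_ *+ 2); apply: eq_bigr => e _; rewrite triangle_out /face_pairing mulr_suml.
  rewrite [RHS]big_mkcond; apply: eq_bigr => m _; rewrite /edge_ind.
  by case: ifP => _; rewrite ?mulr1 ?mulr0 ?mul0r.
by move=> F; rewrite face_pairing_mate triangle_mate.
Qed.

Lemma dot_pairing_ind (G : ograph) (c : corner G) :
  dot_pairing (edge_ind c) = (dots c)%:Z.
Proof.
rewrite /dots -natz -sum1_card natr_sum [RHS]big_mkcond /= /dot_pairing.
pose f (t : G) (k l : 'I_4) : int :=
  if (k < l)%N then (dotted k l)%:Z * edge_ind c (t, (k, l)) else 0.
transitivity (\sum_(d : G * ('I_4 * 'I_4)) f d.1 d.2.1 d.2.2).
  rewrite -(pair_bigA _ (fun t kl => f t kl.1 kl.2)); apply: eq_bigr => t _.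
  by rewrite -(pair_bigA _ (f t)); apply: eq_bigr => k _; rewrite big_mkcond.
apply: eq_bigr => -[t [k l]] _ /=.
rewrite inE /= /f /edge_ind; case: (k < l)%N => //=.
by case: same_edge; case: dotted.
Qed.

Lemma euler_at_pairing (G : ograph) (x : edge G -> int) c :
  euler_at x c <-> tri_pairing (edge_ind c) x - dot_pairing (edge_ind c) = - 2.
Proof.
rewrite tri_pairing_ind dot_pairing_ind /euler_at /euler_cochain.
set u := coboundary x c; set n := dots c; split=> h.
  have /eqP : (u *+ 2 - n%:Z)%:~R = (- 2)%:~R :> rat.
    rewrite rmorphB rmorphMn /= h -pmulrn !mulrNz.
    by field.
  by rewrite eqr_int => /eqP.
have /(congr1 (fun z : int => z%:~R : rat)) := h.
rewrite rmorphB rmorphMn /= -pmulrn !mulrNz => {}h; lra.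
Qed.

Section Transfer.
Variables (a b : 'I_5) (eps : bool) (G G' : ograph) (D : mp_data a b eps G G').
Variables (w : bipyramid_weight) (x : edge G -> int) (x' : edge G' -> int).
Hypothesis ab : a != b.
Let S := removed a b.
Let T := mp_told D.
Let T' := mp_tnew D.
Let far := mp_far_rel D.
Let B : bistellar S T T' far := mp_bistellar D.

Definition mp_weights : Prop :=
  [/\ x (triangle (mp_told D a, pos a b)) = 0,
      forall i j, ~~ removed a b i -> ~~ removed a b j -> i != j ->
        x' (triangle (mp_tnew D i, pos i j)) = w (~: [set i; j])%SET
    & forall F F', corresponding a b (mp_told D) (mp_tnew D) (mp_far D) F F' ->
        x' (triangle F') = x (triangle F) + outer_weight a b (mp_told D) w F
                           + outer_weight a b (mp_told D) w (mate F)].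

Hypothesis W : mp_weights.

Variables (th : corner G -> int) (th' : corner G' -> int) (th5 : 'I_5 -> 'I_5 -> int).
Hypothesis th_corr : forall c c', bs_corner S T T' far c c' -> th c = th' c'.
Hypothesis th_old : forall i p q : 'I_5, S i -> (p < q)%N -> p != i -> q != i ->
  th (T i, (pos i p, pos i q)) = th5 p q.
Hypothesis th_new : forall i p q : 'I_5, ~~ S i -> (p < q)%N -> p != i -> q != i ->
  th' (T' i, (pos i p, pos i q)) = th5 p q.
Hypothesis th_mate : forall F, face_pairing th (mate F) = face_pairing th F.

Let ow := outer_weight a b T w.

Lemma outer_weight_outer i j : S i -> ~~ S j -> ow (T i, pos i j) = w (~: [set i; j])%SET.
Proof.
move=> Si Sj; rewrite /ow /outer_weight (bigD1 i) //= (bigD1 j) //= eqxx.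
have ne k l : S k -> (k != i) || (l != j) && ~~ S l -> (T i, pos i j) != (T k, pos k l).
  move=> Sk kl; apply/eqP => -[/(bs_inj B Si Sk) ik]; rewrite -ik in kl *.
  case/orP: kl => [|/andP[lj Sl]]; first by rewrite ik eqxx.
  move/pos_inj => e; move: lj; rewrite e ?eqxx //.
    by apply: contraNneq Sj => ->.
  by apply: contraNneq Sl => ->.
rewrite !big1 ?addr0 // => [k /andP[Sk ki]|l /andP[Sl lj]].
  by apply: big1 => l Sl; rewrite (negbTE (ne _ _ _ _)) // ki.
by rewrite (negbTE (ne _ _ _ _)) // lj Sl orbT.
Qed.

Lemma outer_weight_inner i j : S i -> S j -> j != i -> ow (T i, pos i j) = 0.
Proof.
move=> Si Sj ji; rewrite /ow /outer_weight; apply: big1 => k Sk; apply: big1 => l Sl.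
case: eqP => // -[/(bs_inj B Si Sk) ik]; rewrite -ik => /pos_inj e.
have jl : j = l by apply: e => //; apply: contraNneq Sl => ->.
by case/negP: Sl; rewrite -jl.
Qed.

Lemma outer_weight_far t k : (forall i, S i -> T i <> t) -> ow (t, k) = 0.
Proof.
move=> h; rewrite /ow /outer_weight; apply: big1 => i Si; apply: big1 => j Sj.
by case: eqP => // -[/esym/(h i Si)].
Qed.

Let d5 (i j : 'I_5) : int := \sum_(m < 3)
  sigma (lift m (ord0 : 'I_2)) (lift m (ord_max : 'I_2)) m * th5 (side0 i j m) (side1 i j m).

Let d5_old i j : S i -> i != j -> face_pairing th (T i, pos i j) = d5 i j.
Proof.
move=> Si ij; apply: eq_bigr => m _; rewrite face_sideE th_old ?side_lt //;
by case: (side_neq m ij).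
Qed.

Let d5_new i j : ~~ S i -> i != j -> face_pairing th' (T' i, pos i j) = d5 i j.
Proof.
move=> Si ij; apply: eq_bigr => m _; rewrite face_sideE th_new ?side_lt //;
by case: (side_neq m ij).
Qed.

Let d5C i j : i != j -> d5 i j = d5 j i.
Proof. by move=> ij; apply: eq_bigr => m _; rewrite (side0C m ij) (side1C m ij). Qed.

Lemma tri_pairing_mp : tri_pairing th' x' - tri_pairing th x =
  (\sum_(p < 5) \sum_(q < 5 | (p < q)%N) bipyramid_coboundary a b w p q * th5 p q) *+ 2.
Proof.
have [x0 xin xout] := W.
pose g F := face_pairing th F * (x (triangle F) + ow F + ow (mate F)).
pose f t := \sum_(k < 4) g (t, k).
pose f' t' := \sum_(k < 4) face_pairing th' (t', k) * x' (triangle (t', k)).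
have ff' t t' : far t t' -> f t = f' t'.
  move=> ft; apply: eq_bigr => k _; have c := BsFar S T T' k ft; congr (_ * _).
    apply: eq_bigr => m _; congr (_ * _); apply: th_corr.
    exact: bs_corner_side c.
  by rewrite (xout (t, k) (t', k)) //; apply/mp_corrP.
have sum_f : \sum_t f t = tri_pairing th x +
    (\sum_(i | S i) \sum_(j | ~~ S j) w (~: [set i; j])%SET * d5 i j) *+ 2.
  have ow_sum : \sum_(F : G * 'I_4) face_pairing th F * ow F =
      \sum_(i | S i) \sum_(j | ~~ S j) w (~: [set i; j])%SET * d5 i j.
    under eq_bigr => F _ do rewrite /ow /outer_weight mulr_sumr.
    rewrite exchange_big /=; apply: eq_bigr => i Si.
    under eq_bigr => F _ do rewrite mulr_sumr.
    rewrite exchange_big /=; apply: eq_bigr => j Sj.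
    rewrite (bigD1 (T i, pos i j)) //= eqxx big1 ?addr0 => [|F /negbTE ->]; last by rewrite mulr0.
    by rewrite d5_old 1?mulrC //; apply: contraNneq Sj => <-.
  transitivity (tri_pairing th x + \sum_(F : G * 'I_4) face_pairing th F * (ow F + ow (mate F))).
    rewrite /tri_pairing /f !pair_bigA -big_split /=.
    by apply: eq_bigr => -[t k] _; rewrite /g /= -mulrDr addrA.
  congr (_ + _); under eq_bigr => F _ do rewrite mulrDr.
  rewrite big_split /= mulr2n -ow_sum; congr (_ + _).
  rewrite [RHS](reindex_inj (@mate_inj G)) /=.
  by apply: eq_bigr => F _; rewrite th_mate.
have tri_ab i j : S i -> S j -> i != j -> x (triangle (T i, pos i j)) = 0.
  rewrite /S /removed !inE => /orP[]/eqP-> /orP[]/eqP->; rewrite ?eqxx // => _.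
  by rewrite -triangle_mate (bs_glue B) // 1?eq_sym // /S /removed !inE eqxx ?orbT.
have old_f : \sum_(i | S i) f (T i) = \sum_(i | S i) \sum_(j | ~~ S j) g (T i, pos i j).
  apply: eq_bigr => i Si; rewrite /f (big_pos i) (bigID S) /= big1 ?add0r.
    apply: eq_bigl => j; case Sj: (S j); rewrite ?andbF //= andbT.
    by apply: contraFneq Sj => ->.
  move=> j /andP[ji Sj]; rewrite /g tri_ab // 1?eq_sym // outer_weight_inner //.
  by rewrite (bs_glue B) // 1?eq_sym // outer_weight_inner // 1?eq_sym // !addr0 mulr0.
have new_f : \sum_(j | ~~ S j) f' (T' j) =
    \sum_(i | S i) \sum_(j | ~~ S j) g (T i, pos i j) +
    \sum_(i | ~~ S i) \sum_(j | (j != i) && ~~ S j) w (~: [set i; j])%SET * d5 i j.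
  rewrite [X in X + _]exchange_big /= -big_split; apply: eq_bigr => j Sj /=.
  rewrite /f' (big_pos j) (bigID S) /=; congr (_ + _).
    apply: eq_big => [i|i /andP[ij Si]].
      case Si: (S i); rewrite ?andbF //= andbT.
      by apply: contraNneq Sj => <-.
    have c := BsOuter T T' far Si Sj.
    have /mp_corrP/xout -> := c.
    by rewrite d5_new // 1?eq_sym // /g d5_old ?[d5 j i]d5C // 1?eq_sym.
  apply: eq_bigr => i /andP[ij Si].
  by rewrite d5_new // 1?eq_sym // xin // 1?eq_sym // mulrC.
have e : tri_pairing th' x' - \sum_(j | ~~ S j) f' (T' j) =
         \sum_t f t - \sum_(i | S i) f (T i) := sum_far_tets B ff'.
rewrite -(bip_pairing a b w th5).
transitivity ((\sum_(i | S i) \sum_(j | ~~ S j) w (~: [set i; j])%SET * d5 i j) *+ 2 +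
  \sum_(i | ~~ S i) \sum_(j | (j != i) && ~~ S j) w (~: [set i; j])%SET * d5 i j).
  by rewrite sum_f new_f old_f in e; lia.
rewrite [RHS](bigID S) /= -/S mulr2n -addrA; congr (_ + _).
  apply: eq_bigr => i Si; apply: eq_bigl => j; rewrite Si /=.
  by case Sj: (S j); rewrite ?andbF //= andbT; symmetry; apply: contraFneq Sj => ->.
transitivity (\sum_(i | ~~ S i) (\sum_(j | S j) w (~: [set i; j])%SET * d5 i j +
   \sum_(j | (j != i) && ~~ S j) w (~: [set i; j])%SET * d5 i j)).
  rewrite big_split /=; congr (_ + _).
  rewrite exchange_big /=; apply: eq_bigr => i Si; apply: eq_bigr => j Sj.
  by rewrite setUC d5C //; apply: contraNneq Si => <-.
apply: eq_bigr => i Si; rewrite [RHS](bigID S) /=; congr (_ + _); apply: eq_bigl => j.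
  by rewrite (negbTE Si) andbT; case Sj: (S j); rewrite ?andbF // andbT; symmetry; apply: contraTneq Sj => ->.
by rewrite (negbTE Si) andbT.
Qed.

Lemma dot_pairing_mp : dot_pairing th' - dot_pairing th =
  \sum_(p < 5) \sum_(q < 5 | (p < q)%N)
     ((new_dots a b p q)%:Z - (removed_dots a b p q)%:Z) * th5 p q.
Proof.
pose f t := \sum_(k < 4) \sum_(l < 4 | (k < l)%N) (dotted k l)%:Z * th (t, (k, l)).
pose f' t := \sum_(k < 4) \sum_(l < 4 | (k < l)%N) (dotted k l)%:Z * th' (t, (k, l)).
have ff' t t' : far t t' -> f t = f' t'.
  move=> ft; apply: eq_bigr => k _; apply: eq_bigr => l _; congr (_ * _).
  by apply: th_corr; apply: BsFarCorner.
have tet H (U : 'I_5 -> og_vertex H) (u : corner H -> int) i :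
    (forall p q : 'I_5, (p < q)%N -> p != i -> q != i -> u (U i, (pos i p, pos i q)) = th5 p q) ->
  \sum_(k < 4) \sum_(l < 4 | (k < l)%N) (dotted k l)%:Z * u (U i, (k, l)) =
  \sum_(p < 5) \sum_(q < 5 | (p < q)%N) (dot_in i p q)%:Z * th5 p q.
  move=> uE; rewrite (big_pos i) [RHS](bigID (fun p => p == i)) /= [X in _ = X + _]big1 ?add0r; last first.
    by move=> p /eqP->; apply: big1 => q _; rewrite /dot_in eqxx mul0r.
  apply: eq_bigr => p pi; rewrite big_mkcond (big_pos i) [RHS]big_mkcond.
  rewrite [RHS](bigID (fun q => q == i)) /= [X in _ = X + _]big1 ?add0r; last first.
    by move=> q /eqP->; rewrite /dot_in eqxx andbF mul0r if_same.
  apply: eq_bigr => q qi; rewrite pos_ltE //; case: ifP => // pq.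
  by rewrite uE // /dot_in pi qi.
have e : dot_pairing th' - \sum_(j | ~~ S j) f' (T' j) =
         dot_pairing th - \sum_(i | S i) f (T i) := sum_far_tets B ff'.
transitivity (\sum_(j | ~~ S j) f' (T' j) - \sum_(i | S i) f (T i)); first by lia.
rewrite (eq_bigr _ (fun i Si => tet _ _ _ _ (fun p q => @th_new i p q Si))).
rewrite (eq_bigr _ (fun i Si => tet _ _ _ _ (fun p q => @th_old i p q Si))).
rewrite exchange_big [X in _ - X]exchange_big -sumrB; apply: eq_bigr => p _ /=.
rewrite exchange_big [X in _ - X]exchange_big -sumrB; apply: eq_bigr => q _ /=.
rewrite -!mulr_suml -mulrBl; congr ((_ - _) * _);
by rewrite /new_dots /removed_dots -natz natr_sum; apply: eq_bigr => i _; rewrite natz.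
Qed.

End Transfer.

Lemma removed_dots_ab a b : removed_dots a b a b = 0%N.
Proof.
apply: big1 => i; rewrite /removed !inE /dot_in => /orP[]/eqP->; rewrite eqxx //.
by rewrite andbF.
Qed.

Lemma admissibleP (a b : 'I_5) (w : bipyramid_weight) : (a < b)%N ->
  admissible a b w <-> forall p q : 'I_5, (p < q)%N ->
    bipyramid_coboundary a b w p q *+ 2 =
    (new_dots a b p q)%:Z - (removed_dots a b p q)%:Z - ((p, q) == (a, b))%:Z *+ 2.
Proof.
move=> ab; split=> [[h1 h2] p q pq|h].
  apply/eqP; rewrite -(eqr_int rat) !rmorphB !rmorphMn /= -!pmulrn; apply/eqP.
  have [[-> ->]|ne] := eqVneq (p, q) (a, b).
    by rewrite h2 removed_dots_ab /=; lra.
  by rewrite h1 //=; lra.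
split=> [p q pq /negbTE ne|].
  have /(congr1 (fun z : int => z%:~R : rat)) := h p q pq; rewrite ne.
  by rewrite !rmorphB !rmorphMn /= -!pmulrn => e; lra.
have /(congr1 (fun z : int => z%:~R : rat)) := h a b ab; rewrite eqxx removed_dots_ab.
by rewrite !rmorphB !rmorphMn /= -!pmulrn => e; lra.
Qed.

Lemma exists_new (a b p q : 'I_5) : exists j : 'I_5,
  [&& ~~ removed a b j, j != p & j != q].
Proof.
have : (0 < #|~: [set a; b; p; q]|)%N.
  have := cardsC [set a; b; p; q]; rewrite card_ord.
  have : (#|[set a; b; p; q]| <= 4)%N.
    rewrite -!setUA !cardsU1 cards1; by do 3 case: (_ \in _).
  lia.
case/card_gt0P => j; rewrite !inE !negb_or -!andbA => /and4P[ja jb jp jq].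
by exists j; rewrite /removed !inE negb_or ja jb jp jq.
Qed.

Section Euler.
Variables (a b : 'I_5) (eps : bool) (G G' : ograph) (D : mp_data a b eps G G').
Variables (w : bipyramid_weight) (x : edge G -> int) (x' : edge G' -> int).
Hypothesis ab : (a < b)%N.
Hypothesis Wadm : admissible a b w.
Hypothesis W : mp_weights D w x x'.
Hypothesis eulerG : forall c : corner G, (c.2.1 < c.2.2)%N -> euler_at x c.
Let S := removed a b.
Let T := mp_told D.
Let T' := mp_tnew D.
Let far := mp_far_rel D.
Let B : bistellar S T T' far := mp_bistellar D.

Lemma new_edge_isolated j c c' : ~~ S j -> bs_corner S T T' far c c' ->
  ~~ same_edge c' (T' j, (pos j a, pos j b)).
Proof.
move=> Sj h; apply/negP => e.
have B' := bistellar_sym B.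
have [d hd _] := bs_same_edge B' (bs_corner_sym h) e.
have ja : a != j by apply: contraNneq Sj => <-; rewrite /S /removed !inE eqxx.
have jb : b != j by apply: contraNneq Sj => <-; rewrite /S /removed !inE eqxx orbT.
have [i [/negbNE]] := bs_corner_bip B' hd Sj ja jb.
by rewrite /S /removed !inE => /orP[]/eqP->; rewrite eqxx.
Qed.

Lemma corner_counterpart (c' : corner G') : (c'.2.1 < c'.2.2)%N ->
  (exists c, bs_corner S T T' far c c') \/
  exists2 j, ~~ S j & c' = (T' j, (pos j a, pos j b)).
Proof.
case: c' => t' [k l] /= kl; have [[j Sj <-]|[t ft]] := bs_cover' B t'; last first.
  by left; exists (t, (k, l)); apply: BsFarCorner.
rewrite -[k](pos_lift j) -[l](pos_lift j); move: kl; rewrite -(lift_ltE j).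
move: (lift j k) (lift j l) (neq_lift j k) (neq_lift j l) => p q.
rewrite 2![j == _]eq_sym => pj qj pq.
have [/existsP[i /and3P[Si pi qi]]|/existsPn h] :=
  boolP [exists i, [&& S i, p != i & q != i]].
  by left; exists (T i, (pos i p, pos i q)); apply: BsBipCorner.
right; exists j => //; suff [-> ->] : p = a /\ q = b by [].
have := h a; have := h b; rewrite /S /removed !inE !eqxx orbT /= !negb_and !negbK.
have nba : (b == a) = false by rewrite -val_eqE /= gtn_eqF.
case: (eqVneq p b) pq => [->|_] pq /=; last first.
  by case: (eqVneq q b) => [-> _|//]; rewrite nba orbF => /eqP.
by rewrite nba => _ /= /eqP qa; move: pq; rewrite qa => /(ltn_trans ab); rewrite ltnn.
Qed.

Lemma mp_euler (c' : corner G') : (c'.2.1 < c'.2.2)%N -> euler_at x' c'.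
Proof.
move=> c'lt; have nab : a != b by rewrite -val_eqE ltn_eqF.
pose new (p q : 'I_5) : 'I_5 := odflt a [pick j | [&& ~~ S j, j != p & j != q]].
have newP (p q : 'I_5) : [&& ~~ S (new p q), p != new p q & q != new p q].
  rewrite /new ![_ == odflt _ _]eq_sym; case: pickP => //= h.
  by have [j jP] := exists_new a b p q; have := h j; rewrite /S jP.
pose th' := edge_ind c'.
pose th5 (p q : 'I_5) := th' (T' (new p q), (pos (new p q) p, pos (new p q) q)).
have th_new (i p q : 'I_5) : ~~ S i -> (p < q)%N -> p != i -> q != i ->
    th' (T' i, (pos i p, pos i q)) = th5 p q.
  move=> Si pq pi qi; have /and3P[Sj pj qj] := newP p q.
  have e : same_edge (T' i, (pos i p, pos i q)) (T' (new p q), (pos (new p q) p, pos (new p q) q)).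
    exact: (same_edge_new B).
  rewrite /th5 /th' /edge_ind; congr (_ : bool)%:Z; apply/idP/idP => h.
    by apply: connect_trans h; rewrite -/(same_edge _ _) same_edge_sym.
  exact: connect_trans e h.
suff [th [th_corr th_mate th_val]] : exists th, [/\
    forall c d', bs_corner S T T' far c d' -> th c = th' d',
    forall F, face_pairing th (mate F) = face_pairing th F
  & tri_pairing th x - dot_pairing th = (th5 a b - 1) *+ 2].
  have th_old (i p q : 'I_5) : S i -> (p < q)%N -> p != i -> q != i ->
      th (T i, (pos i p, pos i q)) = th5 p q.
    move=> Si pq pi qi; have /and3P[Sj pj qj] := newP p q.
    by apply: th_corr; apply: BsBipCorner.
  have tri := tri_pairing_mp nab W th_corr th_old th_new th_mate.
  have dot := dot_pairing_mp nab th_corr th_old th_new.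
  apply/euler_at_pairing; rewrite -/th'.
  have sum : \sum_(p < 5) \sum_(q < 5 | (p < q)%N)
      (bipyramid_coboundary a b w p q *+ 2 -
       ((new_dots a b p q)%:Z - (removed_dots a b p q)%:Z)) * th5 p q = - (th5 a b *+ 2).
    rewrite (bigD1 a) //= (bigD1 b) //= !big1 ?addr0.
    - move/(admissibleP _ ab): Wadm => /(_ a b ab); rewrite eqxx => ->.
      by rewrite [_ - _ - (_ - _)]addrAC subrr add0r mulNr mulrnAl mul1r.
    - move=> p pa; apply: big1 => q pq; move/(admissibleP _ ab): Wadm => /(_ p q pq) ->.
      by rewrite xpair_eqE (negbTE pa) subr0 subrr mul0r.
    - move=> q /andP[aq qb]; move/(admissibleP _ ab): Wadm => /(_ a q aq) ->.
      by rewrite xpair_eqE (negbTE qb) andbF subr0 subrr mul0r.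
  move: sum; under eq_bigr => p _.
    under eq_bigr => q _ do rewrite mulrBl mulrnAl.
    rewrite sumrB sumrMnl; over.
  by rewrite sumrB sumrMnl -tri -dot; lia.
have [[c hc]|[j Sj c'E]] := corner_counterpart c'lt.
  have clt : (c.2.1 < c.2.2)%N.
    suff H d d' : bs_corner S T T' far d d' -> (d'.2.1 < d'.2.2)%N -> (d.2.1 < d.2.2)%N by exact: H hc c'lt.
    by case=> // i j p q Si Sj pq pi pj qi qj _ /=; rewrite pos_ltE.
  exists (edge_ind c); split=> [d d' hd|F|].
  - rewrite /th' /edge_ind; congr (_ : bool)%:Z; apply/idP/idP => h.
      exact: (bs_same_edge_corner B hd hc h).
    exact: (bs_same_edge_corner (bistellar_sym B) (bs_corner_sym hd) (bs_corner_sym hc) h).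
  - exact: face_pairing_mate.
  have /euler_at_pairing -> := eulerG clt.
  rewrite /th5 /th' /edge_ind; have /and3P[Sj _ _] := newP a b.
  have /negbTE := new_edge_isolated Sj hc; rewrite same_edge_sym => ->.
  by [].
exists (fun=> 0); split=> [d d' hd|F|].
- rewrite /th' /edge_ind c'E; have /negbTE -> // := new_edge_isolated Sj hd.
- by rewrite /face_pairing !big1 // => m _; rewrite mulr0.
have -> : th5 a b = 1.
  rewrite -(th_new j) //; first by rewrite /th' /edge_ind c'E [same_edge _ _]connect0.
    by apply: contraNneq Sj => <-; rewrite /S /removed !inE eqxx.
  by apply: contraNneq Sj => <-; rewrite /S /removed !inE eqxx orbT.
have -> : tri_pairing (fun=> 0) x = 0.
  apply: big1 => t _; apply: big1 => k _.
  by rewrite /face_pairing big1 ?mul0r // => m _; rewrite mulr0.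
have -> : @dot_pairing G (fun=> 0) = 0.
  by apply: big1 => t _; apply: big1 => k _; apply: big1 => l _; rewrite mulr0.
by [].
Qed.

End Euler.

(** * MP moves preserve closedness *)

Section Links.
Variable R : realType.

(* Points of the links are written in the barycentric coordinates given by the
   labels of the vertices of the 4-simplex; [res i] forgets the label i. *)
Definition res (i : 'I_5) (lam : 'I_5 -> R) : 'rV[R]_4 := \row_k lam (lift i k).

Definition ext (i : 'I_5) (l : 'rV[R]_4) (k : 'I_5) : R :=
  if unlift i k is Some m then l 0 m else 0.

Lemma ext_lift i l k : ext i l (lift i k) = l 0 k.
Proof. by rewrite /ext liftK. Qed.

Lemma ext_self i l : ext i l i = 0.
Proof. by rewrite /ext unlift_none. Qed.

Lemma res_ext i l : res i (ext i l) = l.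
Proof. by apply/rowP => k; rewrite mxE ext_lift. Qed.

Lemma res_inj i lam mu : lam i = mu i -> res i lam = res i mu -> lam = mu.
Proof.
move=> e /rowP h; apply/funext => k; have [->//|ki] := eqVneq k i.
by have := h (pos i k); rewrite !mxE lift_pos.
Qed.

(* A point of the link of the vertex v, lying in the link triangle of D_i. *)
Definition in_link (i v : 'I_5) (lam : 'I_5 -> R) : Prop :=
  [/\ lam i = 0, lam v = 0, forall k, 0 <= lam k & \sum_k lam k = 1].

Lemma in_link_res i v lam : v != i -> lam i = 0 ->
  in_link i v lam <-> opposite_simplex (pos i v) (res i lam).
Proof.
move=> vi li; have sumE : \sum_k lam k = \sum_k res i lam 0 k.
  rewrite (bigD1 i) //= li add0r; under eq_bigl do rewrite -[_ != i]andbT.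
  by rewrite (big_lift i xpredT); apply: eq_bigr => k _; rewrite mxE.
split=> [[_ lv l0 l1]|[lv l0 l1]].
  by split; rewrite -?sumE ?mxE ?lift_pos // => k; rewrite mxE.
split=> //; first by rewrite mxE lift_pos in lv.
  move=> k; have [->|ki] := eqVneq k i; first by rewrite li.
  by have := l0 (pos i k); rewrite mxE lift_pos.
by rewrite sumE.
Qed.

Lemma glue_labels (i j : 'I_5) (m : 'I_3) (l : 'rV[R]_3) : i != j -> opposite_simplex m l ->
  exists v lam, [/\ v != i, v != j, in_link i v lam, in_link j v lam &
    [/\ lift (pos i j) m = pos i v, extend (pos i j) l = res i lam,
        lift (pos j i) m = pos j v & extend (pos j i) l = res j lam]].
Proof.
move=> ij [lm l0 l1]; have ji : j != i by rewrite eq_sym.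
pose L k := lift i (lift (pos i j) k).
have LE k : L k = lift j (lift (pos j i) k) by apply: lift_lift_pos.
pose lam := ext i (extend (pos i j) l).
have lamL k : lam (L k) = l 0 k by rewrite /lam ext_lift mxE liftK.
have lami : lam i = 0 by rewrite /lam ext_self.
have lamj : lam j = 0.
  by rewrite -[j](lift_pos ji) /lam ext_lift mxE unlift_none.
have sum1 : \sum_k lam k = 1.
  rewrite (bigD1 i) //= lami add0r; under eq_bigl do rewrite -[_ != i]andbT.
  rewrite (big_lift i xpredT) (bigD1 (pos i j)) //= lift_pos // lamj add0r.
  under eq_bigl do rewrite -[_ != pos i j]andbT.
  by rewrite (big_lift _ xpredT) -l1; apply: eq_bigr => k _; rewrite lamL.
have ge0 k : 0 <= lam k.
  rewrite /lam /ext; case: unliftP => // u _; rewrite mxE.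
  by case: unliftP.
have lamv : lam (L m) = 0 by rewrite lamL.
exists (L m), lam; split.
- by rewrite eq_sym neq_lift.
- by rewrite LE eq_sym neq_lift.
- by split.
- by split.
split.
- by rewrite /L pos_lift.
- by rewrite /lam res_ext.
- by rewrite LE pos_lift.
apply/rowP => k; rewrite !mxE; case: unliftP => [u ->|->]; last by rewrite lift_pos.
by rewrite -LE lamL.
Qed.

Lemma bd_glue_labels (G : ograph) (t t' : G) (i j v : 'I_5) (lam : 'I_5 -> R) :
  i != j -> v != i -> v != j -> in_link i v lam -> lam j = 0 ->
  mate (t, pos i j) = (t', pos j i) ->
  bd_glue ((t, pos i v), res i lam) ((t', pos j v), res j lam).
Proof.
move=> ij vi vj li lj e; have ji : j != i by rewrite eq_sym.
have nv : pos i v != pos i j by apply: contra_neq vj => /pos_inj ->.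
pose m := pos (pos i j) (pos i v).
pose L k := lift i (lift (pos i j) k).
have LE k : L k = lift j (lift (pos j i) k) by apply: lift_lift_pos.
pose l : 'rV[R]_3 := \row_k lam (L k).
have [li0 lv0 ge0 sum1] := li.
have lm : lift (pos i j) m = pos i v by rewrite lift_pos.
have Lm : L m = v by rewrite /L lm lift_pos.
have ol : opposite_simplex m l.
  split=> [|k|]; rewrite ?mxE ?Lm //.
  move: sum1; rewrite (bigD1 i) //= li0 add0r; under eq_bigl do rewrite -[_ != i]andbT.
  rewrite (big_lift i xpredT) (bigD1 (pos i j)) //= lift_pos // lj add0r.
  under eq_bigl do rewrite -[_ != pos i j]andbT.
  by rewrite (big_lift _ xpredT) => <-; apply: eq_bigr => k _; rewrite mxE.
have := @BdGlue R G (t, pos i j) m l ol; rewrite e /=.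
have -> : lift (pos j i) m = pos j v by rewrite -[LHS](pos_lift j) -LE Lm.
have -> : extend (pos j i) l = res j lam.
  apply/rowP => k; rewrite !mxE; case: unliftP => [u ->|->]; last by rewrite lift_pos.
  by rewrite mxE LE.
have -> : extend (pos i j) l = res i lam.
  apply/rowP => k; rewrite !mxE; case: unliftP => [u ->|->]; last by rewrite lift_pos.
  by rewrite mxE.
by rewrite lm.
Qed.

Lemma bd_glue_sym (G : ograph) (p q : bd_point R G) : bd_glue p q -> bd_glue q p.
Proof. by case=> F m l ol; have := BdGlue (mate F) ol; rewrite mateK. Qed.

End Links.

Section BistellarLinks.
Variable R : realType.
Variables (S : pred 'I_5) (kap : 'I_5 -> 'I_5 -> R).
Hypothesis kap_gt0 : forall v i, i != v -> 0 < kap v i.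
Hypothesis S_two : forall v, exists2 i, S i & i != v.
Hypothesis S'_two : forall v, exists2 i, ~~ S i & i != v.

Definition skap v i : R := if S i then kap v i else - kap v i.

Hypothesis skap_balanced : forall v,
  \sum_(i | i != v) skap v i * (if (v < i)%N then 1 else -1) = 0.

Section Relation.
Variables (G G' : ograph) (T : 'I_5 -> G) (T' : 'I_5 -> G').
Variable far : G -> G' -> Prop.
Hypothesis B : bistellar S T T' far.

(* The two triangulations of the link of v are subdivisions of the same cone:
   the labels satisfy one linear relation, with coefficients [skap v], and
   points are related when they span the same ray modulo this relation. *)
Inductive bs_point : bd_point R G -> bd_point R G' -> Prop :=
| BsFarPoint t t' i l : far t t' -> bs_point ((t, i), l) ((t', i), l)
| BsBipPoint i j v lam mu c s : S i -> ~~ S j -> v != i -> v != j ->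
    in_link i v lam -> in_link j v mu -> 0 < c ->
    (forall k, k != v -> mu k = c * lam k + s * skap v k) ->
    bs_point ((T i, pos i v), res i lam) ((T' j, pos j v), res j mu).

Lemma bs_point_bip i v lam p' : bs_point ((T i, pos i v), res i lam) p' ->
    S i -> v != i -> lam i = 0 ->
  exists j mu c s, [/\ ~~ S j, v != j, in_link i v lam, in_link j v mu & [/\ 0 < c,
    forall k, k != v -> mu k = c * lam k + s * skap v k &
    p' = ((T' j, pos j v), res j mu)]].
Proof.
move e: (_, res i lam) => p h Si vi li.
case: p p' / h e => [t t' u l ft [tE]|i2 j v2 lam2 mu c s Si2 Sj vi2 vj2 l2 m2 c0 muE [tE vE lE]].
  by case: (bs_far B ft Si).
have ii : i = i2 by apply: (bs_inj B).
rewrite -ii in vE lE vi2 l2 *.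
have vv := pos_inj vi vi2 vE; rewrite -vv in vj2 l2 m2 muE *.
have [l2i _ _ _] := l2.
have ll : lam = lam2 by apply: res_inj lE; rewrite li l2i.
by rewrite -ll in l2 muE; exists j, mu, c, s; split.
Qed.

Lemma bs_point_mem p p' : bs_point p p' -> bd_mem p -> bd_mem p'.
Proof.
case=> [//|i j v lam mu c s _ _ _ vj _ mj _ _ _].
by rewrite /bd_mem /=; apply/in_link_res => //; case: mj.
Qed.

Lemma bs_point_unique p p1 p2 : bs_point p p1 -> bs_point p p2 -> bd_eq p1 p2.
Proof.
move=> h1; case: p p1 / h1 => [t t' u l ft h2|i j1 v lam mu1 c1 s1 Si Sj1 vi vj1 li m1 c1_gt0 mu1E h2].
  move e: ((t, u), l) h2 => p h2; case: p p2 / h2 e => [t2 t2' u2 l2 ft2 [te <- <-]|].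
    by rewrite -te in ft2; rewrite (bs_fun B ft ft2); apply: rst_refl.
  by move=> i j v lam mu c s Si _ _ _ _ _ _ _ [te _ _]; case: (bs_far B ft Si).
have [li0 lv _ _] := li.
have [j2 [mu2 [c2 [s2 [Sj2 vj2 _ m2 [c2_gt0 mu2E ->]]]]]] := bs_point_bip h2 Si vi li0.
have [m1j m1v m1_ge0 m1_sum] := m1; have [m2j m2v m2_ge0 m2_sum] := m2.
have le j u mu c s c' s' : 0 < c -> 0 < c' -> ~~ S j -> v != j ->
    (forall k, k != v -> mu k = c * lam k + s * skap v k) -> mu j = 0 ->
    (forall k, k != v -> u k = c' * lam k + s' * skap v k) -> (forall k, 0 <= u k) ->
    s' / c' <= s / c.
  move=> c0 c'0 Sj vj muE muj uE u0; have jv : j != v by rewrite eq_sym.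
  have := u0 j; rewrite uE //; move: muj; rewrite muE // /skap (negbTE Sj) => e h.
  have clam : c * lam j = s * kap v j.
    by move: e; rewrite mulrN => /eqP; rewrite subr_eq0 => /eqP.
  have lamE : lam j = s / c * kap v j.
    by rewrite mulrAC -clam [c * _]mulrC mulfK // lt0r_neq0.
  have : 0 <= c' * (s / c - s' / c') * kap v j.
    have -> : c' * (s / c - s' / c') * kap v j = c' * lam j + s' * - kap v j.
      by rewrite lamE; field; rewrite !lt0r_neq0.
    by [].
  by rewrite pmulr_lge0 ?kap_gt0 // pmulr_rge0 // subr_ge0.
have ss : s1 / c1 = s2 / c2.
  apply/le_anti/andP; split.
    exact: (le j2 mu1 mu2 c2 s2 c1 s1).
  exact: (le j1 mu2 mu1 c1 s1 c2 s2).
pose W := \sum_(k | k != v) (lam k + s1 / c1 * skap v k).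
have sumW mu c s : 0 < c -> mu v = 0 -> \sum_k mu k = 1 ->
    (forall k, k != v -> mu k = c * lam k + s * skap v k) -> s / c = s1 / c1 -> c * W = 1.
  move=> c0 muv mu1s muE e; rewrite -mu1s (bigD1 v) //= muv add0r /W mulr_sumr.
  by apply: eq_bigr => k kv; rewrite muE // -e; field; rewrite lt0r_neq0.
have cc : c1 = c2.
  have W1 := sumW _ _ _ c1_gt0 m1v m1_sum mu1E erefl.
  have W2 := sumW _ _ _ c2_gt0 m2v m2_sum mu2E (esym ss).
  have W0 : W != 0 by apply: contra_eq_neq W1 => ->; rewrite mulr0 eq_sym oner_eq0.
  by apply: (mulIf W0); rewrite W1 W2.
have mm : mu1 = mu2.
  apply/funext => k; have [->|kv] := eqVneq k v; first by rewrite m1v m2v.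
  rewrite mu1E // mu2E // -cc; congr (_ + _ * _).
  by move: ss; rewrite -cc => /mulIf; apply; rewrite invr_neq0 // lt0r_neq0.
have [->|jj] := eqVneq j1 j2; first by rewrite mm; apply: rst_refl.
rewrite -mm; apply: rst_step; apply: bd_glue_labels => //; first by rewrite mm.
exact: (bs_glue' B).
Qed.

Definition slide (v j : 'I_5) (lam : 'I_5 -> R) (k : 'I_5) : R :=
  if k == v then 0 else lam k + lam j / kap v j * skap v k.

Lemma bs_point_slide i v lam j : S i -> v != i -> in_link i v lam -> ~~ S j -> j != v ->
    (forall k, ~~ S k -> k != v -> lam j / kap v j <= lam k / kap v k) ->
  0 < \sum_k slide v j lam k /\
  bs_point ((T i, pos i v), res i lam)
    ((T' j, pos j v), res j (fun k => slide v j lam k / \sum_k slide v j lam k)).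
Proof.
move=> Si vi li Sj jv jmin; have [li0 lv l_ge0 l_sum] := li.
set nu := slide v j lam; set f := lam j / kap v j.
have f_ge0 : 0 <= f by rewrite divr_ge0 // ltW // kap_gt0.
have nu_ge0 k : 0 <= nu k.
  rewrite /nu /slide; case: eqVneq => // kv; rewrite /skap; case: ifPn => Sk.
    by rewrite addr_ge0 // mulr_ge0 // ltW // kap_gt0.
  by rewrite mulrN subr_ge0 -ler_pdivlMr ?kap_gt0 // jmin.
have nuj : nu j = 0.
  rewrite /nu /slide (negbTE jv) /skap (negbTE Sj) mulrN mulfVK ?subrr //.
  by rewrite lt0r_neq0 // kap_gt0.
have sum_gt0 : 0 < \sum_k nu k.
  rewrite lt_neqAle sumr_ge0 ?andbT; last by move=> k _; apply: nu_ge0.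
  apply/eqP => /esym/eqP; rewrite psumr_eq0; last by move=> k _; apply: nu_ge0.
  move/allP => nu0; have {}nu0 k : nu k = 0.
    by apply/eqP; have := nu0 k; rewrite mem_index_enum => /(_ isT).
  have [i1 Si1 i1v] := S_two v.
  have fj0 : f = 0.
    move: (nu0 i1); rewrite /nu /slide (negbTE i1v) /skap Si1 -/f => /eqP.
    have h : 0 <= f * kap v i1 by apply: mulr_ge0 => //; apply/ltW/kap_gt0.
    rewrite paddr_eq0 // => /andP[_].
    by rewrite mulf_eq0 (negbTE (lt0r_neq0 (kap_gt0 i1v))) orbF => /eqP.
  have lam0 k : lam k = 0.
    have [->//|kv] := eqVneq k v.
    by have := nu0 k; rewrite /nu /slide (negbTE kv) -/f fj0 mul0r addr0.
  move: l_sum; rewrite big1 => [/eqP|k _]; last exact: lam0.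
  by rewrite eq_sym oner_eq0.
split=> //; set sg := \sum_k nu k in sum_gt0 *.
apply: (BsBipPoint (c := sg^-1) (s := f / sg)) => //; first by rewrite eq_sym.
- split=> [||k|]; first by rewrite nuj mul0r.
  + by rewrite /nu /slide eqxx mul0r.
  + by apply: divr_ge0 => //; apply: ltW.
  by rewrite -mulr_suml mulfV // lt0r_neq0.
- by rewrite invr_gt0.
by move=> k kv; rewrite /nu /slide (negbTE kv) -/f; field; rewrite lt0r_neq0.
Qed.

Lemma bs_point_ex p : bd_mem p -> exists p', bs_point p p'.
Proof.
case: p => -[t u] l; have [[i Si <-]|[t' ft] _] := bs_cover B t; last first.
  by exists ((t', u), l); apply: BsFarPoint.
rewrite /bd_mem /=; set v := lift i u => ol.
have vi : v != i by rewrite eq_sym neq_lift.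
have li : in_link i v (ext i l).
  by apply/(in_link_res vi (ext_self _ _)); rewrite res_ext pos_lift.
have [j0 Sj0 j0v] := S'_two v.
pose f k := ext i l k / kap v k.
have P0 : ~~ S j0 && (j0 != v) by rewrite Sj0.
case: (@arg_minP _ R 'I_5 j0 (fun j => ~~ S j && (j != v)) f P0) => j /andP[Sj jv] jmin.
have [k Sk kv|_ h] := bs_point_slide Si vi li Sj jv; first by apply: jmin; rewrite Sk.
by move: h; rewrite res_ext pos_lift => h; eexists; exact: h.
Qed.

Lemma bs_point_glue p q p' : bs_point p p' -> bd_glue p q ->
  exists2 q', bs_point q q' & bd_eq p' q'.
Proof.
move=> h g; case: p q / g h => F m l ol h.
have [[i [j [Si Sj ij FE]]]|[F' FF']] := bs_faceP B F.
  have ji : j != i by rewrite eq_sym.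
  have [v [lam [vi vj li lj [lm lE lm' lE']]]] := glue_labels ij ol.
  rewrite FE (bs_glue B) //= in h *; rewrite lm lE in h; rewrite lm' lE'.
  have [li0 _ _ _] := li; have [lj0 _ _ _] := lj.
  have [k [mu [c [s [Sk vk _ mk [c0 muE ->]]]]]] := bs_point_bip h Si vi li0.
  exists ((T' k, pos k v), res k mu); last exact: rst_refl.
  exact: (BsBipPoint (c := c) (s := s)).
have canon F1 F1' : bs_corr S T T' far F1 F1' ->
    bs_point ((F1.1, lift F1.2 m), extend F1.2 l) ((F1'.1, lift F1'.2 m), extend F1'.2 l).
  case=> [t t' k ft|i j Si Sj] /=; first exact: BsFarPoint.
  have ij : i != j by apply: contraTneq Si => ->.
  have [v [lam [vi vj li lj [-> -> -> ->]]]] := glue_labels ij ol.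
  apply: (BsBipPoint (c := 1) (s := 0)) => // k _.
  by rewrite mul0r addr0 mul1r.
exists (((mate F').1, lift (mate F').2 m), extend (mate F').2 l).
  exact/canon/(bs_outer B).
apply: rst_trans (rst_step _ _ _ _ (BdGlue F' ol)).
exact: bs_point_unique h (canon _ _ FF').
Qed.

Lemma bs_bd_eq p q p' q' : bs_point p p' -> bs_point q q' -> bd_eq p q -> bd_eq p' q'.
Proof.
move=> hp hq /clos_rst_rst1n_iff e; elim: e p' hp hq => {p} [p|p p1 q1 st _ IH] p' hp hq.
  exact: bs_point_unique hp hq.
have {}st : bd_glue p p1 by case: st => // /bd_glue_sym.
have [p1' h1 e1] := bs_point_glue hp st.
exact: rst_trans e1 (IH _ h1 hq).
Qed.

Lemma inward_res (t : G) i v (lam : 'I_5 -> R) : v != i -> in_link i v lam ->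
  inward ((t, pos i v), res i lam) =
  \sum_(k | k != v) lam k * (if (v < k)%N then 1 else -1).
Proof.
move=> vi [li lv _ _]; rewrite /inward /=.
have E (P : pred 'I_5) : \sum_(j < 4 | P (lift i j)) res i lam 0 j = \sum_(k | P k) lam k.
  rewrite [RHS](bigID (fun k => k == i)) /= [X in _ = X + _]big1 ?add0r; last by move=> k /andP[_ /eqP->].
  under [RHS]eq_bigl do rewrite andbC.
  by rewrite big_lift; apply: eq_bigr => k _; rewrite mxE.
have lt1 (j : 'I_4) : (pos i v < j)%N = (v < lift i j)%N by rewrite -(lift_ltE i) lift_pos.
have lt2 (j : 'I_4) : (j < pos i v)%N = (lift i j < v)%N by rewrite -(lift_ltE i) lift_pos.
under eq_bigl do rewrite lt1; under [X in _ - X]eq_bigl do rewrite lt2.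
rewrite (E (fun k => v < k)%N) (E (fun k => k < v)%N).
rewrite [RHS](bigID (fun k : 'I_5 => (v < k)%N)) /= -sumrN; congr (_ + _).
  apply: eq_big => [k|k vk]; last by rewrite vk mulr1.
  by case: eqVneq => [->|_]; rewrite ?ltnn.
apply: eq_big => [k|k kv]; last by rewrite ltnNge ltnW //= mulrN1.
by rewrite -leqNgt ltn_neqAle.
Qed.

End Relation.

Lemma bs_point_sign (G G' : ograph) (T : 'I_5 -> G) (T' : 'I_5 -> G') far p p' :
  bs_point T T' far p p' ->
  Num.sg (inward p') = Num.sg (inward p).
Proof.
case=> [t t' i l _|i j v lam mu c s Si Sj vi vj li mj c0 muE]; first by [].
rewrite !inward_res //; have -> : \sum_(k | k != v) mu k * (if (v < k)%N then 1 else -1) =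
   c * \sum_(k | k != v) lam k * (if (v < k)%N then 1 else -1).
  transitivity (c * (\sum_(k | k != v) lam k * (if (v < k)%N then 1 else -1)) +
    s * \sum_(k | k != v) skap v k * (if (v < k)%N then 1 else -1)); last first.
    by rewrite skap_balanced mulr0 addr0.
  rewrite !mulr_sumr -big_split /=.
  by apply: eq_bigr => k kv; rewrite muE //; ring.
by rewrite sgrM gtr0_sg // mul1r.
Qed.

End BistellarLinks.

Section Topology.
Local Open Scope classical_set_scope.

Lemma cvg_row (R : realType) n (X : Type) (F : set_system X) (f : X -> 'I_n -> R)
    (g : 'I_n -> R) : Filter F ->
  (forall k, f ^~ k @ F --> g k) -> (fun x => \row_k f x k) @ F --> \row_k g k.
Proof.
move=> FF fg; apply/cvg_ballP => e e0.
have : \forall x \near F, forall k, ball (g k) e (f x k).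
  by apply: filter_forall => k; have /cvg_ballP/(_ e e0) := fg k.
apply: filterS => x h; split=> // i k; rewrite !mxE; exact: h.
Qed.

Lemma within_continuous_comp_at (X Y Z : topologicalType) (A : set X) (C : set Y)
    (phi : X -> Y) (h : Y -> Z) :
  {within C, continuous h} -> (forall x, A x -> phi @ x --> phi x) ->
  (forall x, A x -> C (phi x)) -> {within A, continuous (h \o phi)}.
Proof.
move=> /subspace_continuousP hC phiA AC; apply/subspace_continuousP => x Ax U /= nU.
have := hC _ (AC _ Ax) _ nU; rewrite /= /nbhs /= => hU.
have := phiA _ Ax _ hU; rewrite /= /nbhs /= => h2.
by apply: filterS h2 => z /= hz Az; apply: hz; apply: AC.
Qed.

Section Continuity.
Variable R : realType.

Lemma cvg_fsum (X : Type) (F : set_system X) (I : Type) (r : seq I) (f : X -> I -> R)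
    (g : I -> R) : Filter F ->
  (forall k, f ^~ k @ F --> g k) -> (fun x => \sum_(k <- r) f x k) @ F --> \sum_(k <- r) g k.
Proof.
move=> FF fg; elim: r => [|i r IH].
  by under eq_fun do rewrite big_nil; rewrite big_nil; apply: cvg_cst.
by under eq_fun do rewrite big_cons; rewrite big_cons; apply: cvgD.
Qed.

Variables (S : pred 'I_5) (kap : 'I_5 -> 'I_5 -> R).

Lemma cvg_res_slide (X : Type) (F : set_system X) (f : X -> 'I_5 -> R) (g : 'I_5 -> R)
    (v i : 'I_5) : Filter F ->
    (forall k, f ^~ k @ F --> g k) -> \sum_k slide S kap v i g k != 0 ->
  (fun x => res i (fun k => slide S kap v i (f x) k / \sum_k slide S kap v i (f x) k)) @ F
    --> res i (fun k => slide S kap v i g k / \sum_k slide S kap v i g k).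
Proof.
move=> FF fg s0.
have cs k : (fun x => slide S kap v i (f x) k) @ F --> slide S kap v i g k.
  rewrite /slide; case: (k == v); first exact: cvg_cst.
  apply: cvgD; first exact: fg.
  by apply: cvgM; [apply: cvgM; [exact: fg|exact: cvg_cst]|exact: cvg_cst].
apply: cvg_row => k; apply: cvgM; first exact: cs.
by apply: cvgV => //; apply: cvg_fsum => m; apply: cs.
Qed.

Lemma cvg_ext_label (j k : 'I_5) (l : 'rV[R]_4) : (fun l => ext j l k) @ l --> ext j l k.
Proof.
rewrite /ext; case: (unlift j k) => [m|]; first exact: coord_continuous.
by apply: cvg_cst; exact: nbhs_filter.
Qed.

Lemma closed_preimage (f : 'rV[R]_4 -> R) (C : set R) :
  (forall l : 'rV[R]_4, f @ l --> f l) -> topology_structure.closed C -> topology_structure.closed (f @^-1` C).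
Proof. by move=> cf; apply: preimage_closed => l _; apply: cf. Qed.

Lemma closed_simplex (u : 'I_4) : topology_structure.closed (@opposite_simplex R 4 u).
Proof.
have -> : opposite_simplex u = (fun l : 'rV[R]_4 => l 0 u) @^-1` [set x | x = 0] `&`
    (\bigcap_(k in classical_sets.setT) (fun l : 'rV[R]_4 => l 0 k) @^-1` [set x | 0 <= x] `&`
    (fun l : 'rV[R]_4 => \sum_k l 0 k) @^-1` [set x | x = 1]).
  rewrite predeqE => l; split=> [[l0 lk l1]|[l0 [lk l1]]].
    by split=> //; split=> // k _; apply: lk.
  by split=> // k; apply: lk.
apply: closedI; first by apply: closed_preimage; [move=> l; apply: coord_continuous|apply: closed_eq].
apply: closedI; first apply: closed_bigI => k _.
  by apply: closed_preimage; [move=> l; apply: coord_continuous|apply: closed_ge].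
apply: closed_preimage; last exact: closed_eq.
move=> l; have FF : Filter (nbhs l) by exact: nbhs_filter.
by apply: cvg_fsum => k; apply: coord_continuous.
Qed.

Lemma closed_ratio (j i k : 'I_5) (u w : R) :
  topology_structure.closed [set l : 'rV[R]_4 | ext j l i / u <= ext j l k / w].
Proof.
have -> : [set l : 'rV[R]_4 | ext j l i / u <= ext j l k / w] =
    (fun l => ext j l k / w - ext j l i / u) @^-1` [set x | 0 <= x].
  by rewrite predeqE => l /=; rewrite subr_ge0.
apply: closed_preimage; last exact: closed_ge.
move=> l; have FF : Filter (nbhs l) by exact: nbhs_filter.
have e m : (fun l => ext j l m) @ l --> ext j l m by apply: cvg_ext_label.
by apply: cvgB; (apply: cvgM; [exact: e|exact: cvg_cst]).
Qed.

End Continuity.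

Lemma bs_point_sym (R : realType) S (kap : 'I_5 -> 'I_5 -> R) (G G' : ograph)
    (T : 'I_5 -> G) (T' : 'I_5 -> G') far p p' :
  bs_point S kap T T' far p p' ->
  bs_point (predC S) kap T' T (fun t' t => far t t') p' p.
Proof.
case=> [t t' i l ft|i j v lam mu c s Si Sj vi vj li mj c0 muE]; first exact: BsFarPoint.
apply: (BsBipPoint _ _ _ (c := c^-1) (s := s / c)) => //=; first by rewrite negbK.
  by rewrite invr_gt0.
move=> k kv; rewrite muE // /skap /=; case: (S k) => /=; field; exact: lt0r_neq0.
Qed.

Section ClosedTransfer.
Variables (R : realType) (S : pred 'I_5) (kap : 'I_5 -> 'I_5 -> R).
Variables (G G' : ograph) (T : 'I_5 -> G) (T' : 'I_5 -> G') (far : G -> G' -> Prop).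
Hypothesis B : bistellar S T T' far.
Hypothesis kap_gt0 : forall v i, i != v -> 0 < kap v i.
Hypothesis S_two : forall v, exists i1 i2, [/\ S i1, S i2, i1 != v, i2 != v &
  forall i, S i -> i != v -> i = i1 \/ i = i2].
Hypothesis S'_two : forall v, exists2 i, ~~ S i & i != v.
Hypothesis skap_balanced : forall v,
  \sum_(i | i != v) skap S kap v i * (if (v < i)%N then 1 else -1) = 0.

Let rel := bs_point S kap T T' far.
Let rel' := bs_point (predC S) kap T' T (fun t' t => far t t').
Let B' := bistellar_sym B.

Let S_one v : exists2 i, S i & i != v.
Proof. by have [i [_ [Si _ iv _ _]]] := S_two v; exists i. Qed.

Let S''_one v : exists2 i, ~~ predC S i & i != v.
Proof. by have [i Si iv] := S_one v; exists i => //=; rewrite negbK. Qed.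

Let rel_sym p p' : rel p p' -> rel' p' p. Proof. exact: bs_point_sym. Qed.

Let rel'_sym p p' : rel' p' p -> rel p p'.
Proof.
rewrite /rel; move/bs_point_sym; case=> [t t' i l ft|i j v lam mu c s Si Sj vi vj li mj c0 muE].
  exact: BsFarPoint.
apply: (BsBipPoint _ _ _ (c := c) (s := s)) => //=; first by move: Si => /=; rewrite negbK.
  by move: Sj => /=; rewrite negbK.
by move=> k kv; rewrite muE // /skap /= negbK.
Qed.

Lemma closed_bistellar : closed_ograph R G -> closed_ograph R G'.
Proof.
case=> h [h_cont h_eq h_onto h_sign].
have [g gP] : {g & forall p', bd_mem p' -> rel (g p') p' /\ bd_mem (g p')}.
  apply: (@choice _ _ (fun p' p => bd_mem p' -> rel p p' /\ bd_mem p)) => p'; have [m|nm] := pselect (bd_mem p'); last first.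
    have [t _] : exists t : G, true by have [i Si _] := S_one ord0; exists (T i).
    by exists ((t, ord0), 0) => /nm.
  have [p hp] := bs_point_ex kap_gt0 S'_two S''_one B' m.
  exists p => _; split; first exact: rel'_sym.
  exact: bs_point_mem hp m.
have eq_rel p' p : bd_mem p' -> rel p p' -> h (g p') = h p.
  move=> m pp; have [gp gm] := gP _ m.
  have pm : bd_mem p by exact: bs_point_mem (rel_sym pp) m.
  by apply/h_eq => //; apply: (bs_point_unique kap_gt0 B' (rel_sym gp) (rel_sym pp)).
exists (h \o g); split.
- case=> t' u /=; have [[j Sj <-]|[t ft]] := bs_cover' B t'; last first.
    apply: subspace_eq_continuous (h_cont (t, u)) => l; rewrite in_setE => /= ol.
    by symmetry; apply: eq_rel => //; apply: BsFarPoint.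
  set v := lift j u; have vj : v != j by rewrite eq_sym neq_lift.
  have uE : u = pos j v by rewrite /v pos_lift.
  pose phi i (l : 'rV[R]_4) := res i (fun k => slide (predC S) kap v i (ext j l) k /
     \sum_k slide (predC S) kap v i (ext j l) k).
  have link (l : 'rV[R]_4) : opposite_simplex u l -> in_link j v (ext j l).
    by move=> ol; apply/(in_link_res vj (ext_self _ _)); rewrite res_ext -uE.
  have piece i (A : set 'rV[R]_4) : S i -> i != v ->
      (forall l, A l -> opposite_simplex u l) ->
      (forall l, A l -> forall k, S k -> k != v ->
         ext j l i / kap v i <= ext j l k / kap v k) ->
      {within A, continuous (fun l => h (g ((T' j, u), l)))}.
    move=> Si iv Au Amin.
    have sl l : A l -> 0 < \sum_k slide (predC S) kap v i (ext j l) k /\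
        rel' ((T' j, u), l) ((T i, pos i v), phi i l).
      move=> Al; have Si' : ~~ predC S i by rewrite /= negbK.
      have := @bs_point_slide R (predC S) kap kap_gt0 S'_two _ _ T' T (fun t' t => far t t') j v
        (ext j l) i Sj vj (link _ (Au _ Al)) Si' iv.
      by rewrite res_ext -uE; apply=> k; rewrite /= negbK; apply: Amin.
    apply: (@subspace_eq_continuous _ A _ ((fun l => h ((T i, pos i v), l)) \o phi i)).
      move=> l; rewrite in_setE => Al /=; symmetry; apply: eq_rel; first exact: Au.
      by apply: rel'_sym; case: (sl l Al).
    apply: (within_continuous_comp_at (h_cont (T i, pos i v))) => l Al.
      apply: cvg_res_slide; first exact: nbhs_filter.
        by move=> k; apply: cvg_ext_label.
      by apply: lt0r_neq0; case: (sl l Al).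
    have [_ /bs_point_mem] := sl l Al; apply; exact: Au.
  have [i1 [i2 [Si1 Si2 i1v i2v S_i]]] := S_two v.
  pose A1 := opposite_simplex u `&` [set l : 'rV[R]_4 | ext j l i1 / kap v i1 <= ext j l i2 / kap v i2].
  pose A2 := opposite_simplex u `&` [set l : 'rV[R]_4 | ext j l i2 / kap v i2 <= ext j l i1 / kap v i1].
  have -> : opposite_simplex u = A1 `|` A2.
    rewrite predeqE => l; split=> [ol|[[]|[]]//].
    by case/orP: (le_total (ext j l i1 / kap v i1) (ext j l i2 / kap v i2)) => ?; [left|right].
  apply: withinU_continuous.
  + by apply: closedI; [exact: closed_simplex|exact: closed_ratio].
  + by apply: closedI; [exact: closed_simplex|exact: closed_ratio].
  + apply: (piece i1) => // l [? le12] // k Sk kv.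
    by have [->|->] := S_i k Sk kv.
  apply: (piece i2) => // l [? le21] // k Sk kv.
  by have [->|->] := S_i k Sk kv.
- move=> p' q' pm qm /=; have [gp gpm] := gP _ pm; have [gq gqm] := gP _ qm.
  split=> [/(h_eq _ _ gpm gqm)|e].
    exact: (bs_bd_eq kap_gt0 B gp gq).
  apply/h_eq => //.
  exact: (bs_bd_eq kap_gt0 B' (rel_sym gp) (rel_sym gq) e).
- move=> s; split=> [/h_onto[p pm <-]|[p' pm <-]].
    have [p' pp] := bs_point_ex kap_gt0 S_one S'_two B pm.
    have pm' := bs_point_mem pp pm.
    by exists p' => //=; apply: eq_rel.
  by apply/h_onto; exists (g p') => //; case: (gP _ pm).
move=> p' pm /=; have [gp gm] := gP _ pm.
by rewrite h_sign // (bs_point_sign skap_balanced gp).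
Qed.

End ClosedTransfer.

End Topology.

Section MPClosed.
Variables (R : realType) (a b : 'I_5).
Hypothesis ab : mp_pair a b.
Let S := removed a b.

(* Whether the coefficient of i in the relation pairs positively with the
   value of the field at the corner i of the link of v. *)
Let agree (v i : 'I_5) : bool := S i == (v < i)%N.

Let count (v : 'I_5) (e : bool) : nat := #|[pred i : 'I_5 | (i != v) && (agree v i == e)]|.

Definition mp_kap (v i : 'I_5) : R := (count v (~~ agree v i))%:R.

Let count_gt0 v e : (0 < count v e)%N.
Proof.
have [altb nlow nhigh] := ab.
have Sa : S a by rewrite /S /removed !inE eqxx.
have Sb : S b by rewrite /S /removed !inE eqxx orbT.
rewrite lt0n; apply/negP => /eqP/card0_eq h.
have agreeE i : i != v -> agree v i = ~~ e.
  by move=> iv; have := h i; rewrite !inE iv /=; case: agree; case: (e).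
have lt_of i j : ~~ S j -> (i == v) || ((i < v)%N) -> (j == v) || (v < j)%N -> S i -> (i < j)%N.
  move=> Sj /orP[/eqP iv|iv] /orP[/eqP jv|vj] Si.
  - by case/negP: Sj; rewrite jv -iv.
  - by rewrite iv.
  - by rewrite jv.
  exact: ltn_trans vj.
have gt_of i j : ~~ S j -> (i == v) || (v < i)%N -> (j == v) || (j < v)%N -> S i -> (j < i)%N.
  move=> Sj /orP[/eqP iv|iv] /orP[/eqP jv|vj] Si.
  - by case/negP: Sj; rewrite jv -iv.
  - by rewrite iv.
  - by rewrite jv.
  exact: ltn_trans iv.
case: e agreeE {h} => agreeE.
- have S_low i : S i -> (i == v) || (i < v)%N.
    move=> Si; case: eqVneq => //= iv; have := agreeE i iv; rewrite /agree Si.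
    by move: iv; rewrite -val_eqE /=; case: ltngtP.
  have S_high j : ~~ S j -> (j == v) || (v < j)%N.
    move=> Sj; case: eqVneq => //= jv; have := agreeE j jv; rewrite /agree (negbTE Sj).
    by case: ltnP.
  by apply: nlow => j Sj; rewrite (lt_of a j Sj (S_low a Sa) (S_high j Sj) Sa) (lt_of b j Sj (S_low b Sb) (S_high j Sj) Sb).
have S_high i : S i -> (i == v) || (v < i)%N.
  move=> Si; case: eqVneq => //= iv; have := agreeE i iv; rewrite /agree Si.
  by case: ltnP.
have S_low j : ~~ S j -> (j == v) || (j < v)%N.
  move=> Sj; case: eqVneq => //= jv; have := agreeE j jv; rewrite /agree (negbTE Sj).
  by move: jv; rewrite -val_eqE /=; case: ltngtP.
by apply: nhigh => j Sj; rewrite (gt_of a j Sj (S_high a Sa) (S_low j Sj) Sa) (gt_of b j Sj (S_high b Sb) (S_low j Sj) Sb).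
Qed.

Lemma mp_closed eps (G G' : ograph) : mp_data a b eps G G' ->
  closed_ograph R G -> closed_ograph R G'.
Proof.
move=> D; have [altb _ _] := ab.
have nab : a != b by rewrite -val_eqE ltn_eqF.
apply: (closed_bistellar (mp_bistellar D) (kap := mp_kap)).
- by move=> v i _; rewrite ltr0n count_gt0.
- move=> v; have Sa : S a by rewrite /S /removed !inE eqxx.
  have Sb : S b by rewrite /S /removed !inE eqxx orbT.
  case: (eqVneq a v) => [av|nav].
    exists b, b; rewrite -av eq_sym nab; split=> // i.
    by rewrite /removed !inE => /orP[->//|/eqP]; left.
  case: (eqVneq b v) => [bv|nbv].
    exists a, a; rewrite -bv nab; split=> // i.
    by rewrite /removed !inE => /orP[/eqP|->//]; left.
  by exists a, b; split=> // i; rewrite /removed !inE => /orP[]/eqP; [left|right].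
- by move=> v; have [j /and3P[Sj jv _]] := exists_new a b v v; exists j.
move=> v; rewrite (bigID (agree v)) /=.
have term i : skap (removed a b) mp_kap v i * (if (v < i)%N then 1 else -1) =
    if agree v i then (count v false)%:R else - (count v true)%:R.
  rewrite /skap /mp_kap -/(S i) /agree; case: (S i); case: (v < i)%N => /=;
  by rewrite ?mulr1 ?mulrN1 ?opprK.
rewrite (eq_bigr (fun=> (count v false)%:R)) => [|i /andP[_ e]]; last by rewrite term e.
rewrite [X in _ + X](eq_bigr (fun=> - (count v true)%:R)) => [|i /andP[_ /negbTE e]]; last by rewrite term e.
rewrite !sumr_const.
have -> : #|[pred i : 'I_5 | (i != v) && agree v i]| = count v true.
  by apply: eq_card => i; rewrite !inE eqb_id.
have -> : #|[pred i : 'I_5 | (i != v) && ~~ agree v i]| = count v false.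
  by apply: eq_card => i; rewrite !inE eqbF_neg.
by rewrite mulNrn -!mulrnA mulnC subrr.
Qed.

End MPClosed.

(** * Pillow insertion *)

Section FromMate.
Variables (V : finType) (sgn : V -> bool) (mu : V * 'I_4 -> V * 'I_4).
Hypothesis muK : involutive mu.
Hypothesis mu_inc : forall F, incoming (sgn (mu F).1) (mu F).2 = ~~ incoming (sgn F.1) F.2.
Hypothesis V_nonempty : (0 < #|V|)%N.
Hypothesis mu_connected : forall u v,
  connect [rel u v : V | [exists k, (mu (u, k)).1 == v]] u v.

Definition mu_out (e : V * strand) : V * 'I_4 := (e.1, out_face (sgn e.1) e.2).

Definition mu_next (e : V * strand) : V * strand :=
  ((mu (mu_out e)).1, face_strand (mu (mu_out e)).2).

Lemma mu_in e : ((mu (mu_out e)).1, in_face (sgn (mu (mu_out e)).1) (face_strand (mu (mu_out e)).2))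
  = mu (mu_out e).
Proof. by rewrite in_strand ?mu_inc ?incoming_out //; case: (mu _). Qed.

Lemma mu_next_inj : injective mu_next.
Proof.
move=> e e' h.
have h1 : (mu (mu_out e)).1 = (mu (mu_out e')).1 := congr1 fst h.
have h2 : face_strand (mu (mu_out e)).2 = face_strand (mu (mu_out e')).2 := congr1 snd h.
have /(inv_inj muK) o : mu (mu_out e) = mu (mu_out e').
  by rewrite -(mu_in e) -(mu_in e') h1 h2.
have o1 : e.1 = e'.1 := congr1 fst o.
have o2 : out_face (sgn e.1) e.2 = out_face (sgn e'.1) e'.2 := congr1 snd o.
rewrite (surjective_pairing e) (surjective_pairing e') -o1; congr (_, _).
by rewrite -(strand_out (sgn e.1) e.2) o2 strand_out.
Qed.

Lemma mu_adj_connected :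
  let adj := [rel u v : V | [exists s, ((perm mu_next_inj) (u, s)).1 == v]] in
  forall u v, connect [rel u v | adj u v || adj v u] u v.
Proof.
move=> adj u v; apply: connect_sub (mu_connected u v) => {u v} u v /= /existsP[k /eqP uv].
apply: connect1; rewrite /=; have [ik|ok] := boolP (incoming (sgn u) k); apply/orP.
  right; apply/existsP; exists (face_strand (mu (u, k)).2); rewrite permE /= /mu_next /mu_out /=.
  have := mu_inc (u, k); rewrite ik uv /= => /negbT o.
  by rewrite out_strand // -uv -surjective_pairing muK.
left; apply/existsP; exists (face_strand k); rewrite permE /= /mu_next /mu_out /=.
by rewrite out_strand // uv.
Qed.

Definition ograph_of_mate : ograph := OGraph sgn V_nonempty mu_adj_connected.

Lemma mate_of_mate (F : face ograph_of_mate) : mate F = mu F.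
Proof.
have out (F' : face ograph_of_mate) : ~~ inc F' -> mate F' = mu F'.
  move=> oF; have e := faceP F'; rewrite (negbTE oF) in e.
  by rewrite e mate_out /in_side /= permE /mu_next; apply: mu_in.
have [iF|oF] := boolP (inc F); last exact: out.
pose F' : face ograph_of_mate := mu F.
have o : ~~ inc F' by rewrite /inc /F' /= mu_inc negbK.
have h : mate F' = F by rewrite out // /F' muK.
by rewrite -h mateK /F' -/F' h.
Qed.

End FromMate.

Section Pillow.
Variables (G : ograph) (A B : face G) (kq kp : 'I_4) (s : bool).
Hypothesis AB : A != B.
Hypothesis kqp : kq != kp.
Hypothesis incA : inc A = ~~ incoming s kq.
Hypothesis incB : inc B = ~~ incoming s kp.

Definition pillow_vertex : finType := (og_vertex G + bool)%type.

Definition pillow_sign (u : pillow_vertex) : bool :=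
  match u with inl t => og_sign t | inr x => x end.

(* The triangles of A and B are cut open and the pillow [inr s], [inr (~~ s)] is
   inserted, with [inr s] glued to A and B themselves; [pillow_tau F] is what is
   seen from [mate F] in the place of F. *)
Definition pillow_tau (F : face G) : pillow_vertex * 'I_4 :=
  if F == A then (inr (~~ s), kq) else if F == B then (inr (~~ s), kp) else (inl F.1, F.2).

Definition pillow_mate (F : pillow_vertex * 'I_4) : pillow_vertex * 'I_4 :=
  match F with
  | (inl t, k) => if (t, k) == A then (inr s, kq) else if (t, k) == B then (inr s, kp)
                  else pillow_tau (mate (t, k))
  | (inr x, k) => if k == kq then (if x == s then (inl A.1, A.2) else pillow_tau (mate A))
                  else if k == kp then (if x == s then (inl B.1, B.2) else pillow_tau (mate B))
                  else (inr (~~ x), k)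
  end.

Let nss : (~~ s == s) = false. Proof. by case: s. Qed.
Let BA : (B == A) = false. Proof. by rewrite eq_sym (negbTE AB). Qed.
Let kpq : (kp == kq) = false. Proof. by rewrite eq_sym (negbTE kqp). Qed.

Lemma pillow_mate_tau F : pillow_mate (pillow_tau F) = pillow_tau (mate F).
Proof.
rewrite {1}/pillow_tau; case: eqVneq => [->|FA]; first by rewrite /= eqxx nss.
case: eqVneq => [->|FB]; first by rewrite /= kpq eqxx nss.
by rewrite /= -surjective_pairing (negbTE FA) (negbTE FB).
Qed.

Lemma pillow_tau_inl F : F != A -> F != B -> pillow_tau F = (inl F.1, F.2).
Proof. by rewrite /pillow_tau => /negbTE -> /negbTE ->. Qed.

Lemma pillow_mateK : involutive pillow_mate.
Proof.
case=> [[t|x] k].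
  rewrite {2}/pillow_mate; case: eqVneq => [e|FA]; first by rewrite /= !eqxx -e.
  case: eqVneq => [FB|FB]; first by rewrite /= kpq eqxx eqxx -FB.
  by rewrite pillow_mate_tau mateK pillow_tau_inl.
rewrite {2}/pillow_mate; case: eqVneq => [->|kq'].
  case: eqVneq => [->|xs]; first by rewrite /= -surjective_pairing eqxx.
  rewrite pillow_mate_tau mateK /pillow_tau eqxx.
  by congr (inr _, _); move: xs; case: x; case: s.
case: eqVneq => [->|kp'].
  case: eqVneq => [->|xs]; first by rewrite /= -surjective_pairing BA eqxx.
  rewrite pillow_mate_tau mateK /pillow_tau BA eqxx.
  by congr (inr _, _); move: xs; case: x; case: s.
by rewrite /= (negbTE kq') (negbTE kp') negbK.
Qed.

Let pinc (F : pillow_vertex * 'I_4) := incoming (pillow_sign F.1) F.2.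

Let pinc_neg x k : incoming (~~ x) k = ~~ incoming x k.
Proof. by rewrite /incoming addNb. Qed.

Lemma pillow_tau_inc F : pinc (pillow_tau F) = inc F.
Proof.
rewrite /pillow_tau; case: eqVneq => [->|_]; first by rewrite /pinc /= pinc_neg incA.
by case: eqVneq => [->|_]; first by rewrite /pinc /= pinc_neg incB.
Qed.

Lemma pillow_mate_inc F : pinc (pillow_mate F) = ~~ pinc F.
Proof.
case: F => [[t|x] k]; rewrite /pillow_mate.
  case: eqVneq => [e|_].
    by rewrite -[pinc (inl t, k)]/(inc (t, k)) e incA negbK.
  case: eqVneq => [e|_].
    by rewrite -[pinc (inl t, k)]/(inc (t, k)) e incB negbK.
  by rewrite pillow_tau_inc inc_mate.
case: eqVneq => [->|_].
  case: eqVneq => [->|xs]; first by rewrite -[pinc (inl _, _)]/(inc A) incA.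
  rewrite pillow_tau_inc inc_mate incA negbK /pinc /= -pinc_neg.
  by congr incoming; move: xs; case: x; case: s.
case: eqVneq => [->|_].
  case: eqVneq => [->|xs]; first by rewrite -[pinc (inl _, _)]/(inc B) incB.
  rewrite pillow_tau_inc inc_mate incB negbK /pinc /= -pinc_neg.
  by congr incoming; move: xs; case: x; case: s.
by rewrite /pinc /= pinc_neg.
Qed.

Lemma pillow_nonempty : (0 < #|pillow_vertex|)%N.
Proof. by apply/card_gt0P; exists (inr true). Qed.

Let adj := [rel u v : pillow_vertex | [exists k, (pillow_mate (u, k)).1 == v]].

Let adj_mate F : connect adj F.1 (pillow_mate F).1.
Proof.
by apply: connect1; apply/existsP; exists F.2; rewrite -surjective_pairing.
Qed.

Let adj_sym : connect_sym adj.
Proof.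
have sub u v : adj u v -> adj v u.
  move=> /existsP[k /eqP <-]; apply/existsP; exists (pillow_mate (u, k)).2.
  by rewrite -surjective_pairing pillow_mateK.
by apply: sym_connect_sym => u v; apply/idP/idP; apply: sub.
Qed.

Lemma pillow_connected u v : connect adj u v.
Proof.
have [k kq' kp'] : exists2 k, k != kq & k != kp.
  have : (0 < #|~: [set kq; kp]|)%N.
    by have := cardsC [set kq; kp]; rewrite card_ord cards2 kqp; lia.
  by case/card_gt0P => k; rewrite !inE negb_or => /andP[? ?]; exists k.
have pil x : connect adj (inr s) (inr x).
  have [->|xs] := eqVneq x s; first exact: connect0.
  have := adj_mate (inr s, k); rewrite /= (negbTE kq') (negbTE kp') /=.
  by have -> : ~~ s = x by move: xs; case: x; case: s.
have cA : connect adj (inr s) (inl A.1) by have := adj_mate (inr s, kq); rewrite /= !eqxx.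
have cB : connect adj (inr s) (inl B.1) by have := adj_mate (inr s, kp); rewrite /= kpq !eqxx.
have tau F : connect adj (inl F.1) (pillow_tau F).1.
  rewrite /pillow_tau; case: eqVneq => [->|_] /=.
    by apply: connect_trans (pil _); rewrite adj_sym.
  case: eqVneq => [->|_] /=; last exact: connect0.
  by apply: connect_trans (pil _); rewrite adj_sym.
have mateC F : connect adj (inl F.1) (inl (mate F).1).
  apply: connect_trans (tau F) _; rewrite adj_sym.
  apply: connect_trans (tau (mate F)) _; rewrite adj_sym -pillow_mate_tau.
  exact: adj_mate.
have old t t' : connect adj (inl t) (inl t').
  have := og_connected t t'; move: t t' => t0 t1 /connectP[p].
  elim: p t0 => [|t2 p IH] t0 /=; first by move=> _ ->; apply: connect0.
  case/andP=> h /IH{}IH /IH{}IH; apply: connect_trans IH.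
  have {h} : exists st, ((og_next G (t0, st)).1 == t2) || ((og_next G (t2, st)).1 == t0).
    by case/orP: h => /existsP[st h]; exists st; rewrite h ?orbT.
  case=> st /orP[] /eqP <-.
    by have := mateC (out_side (t0, st)); rewrite mate_out.
  by rewrite adj_sym; have := mateC (out_side (t2, st)); rewrite mate_out.
have all u' : connect adj (inr s) u'.
  case: u' => [t|x]; last exact: pil.
  exact: connect_trans cA (old _ _).
by apply: connect_trans (all v); rewrite adj_sym.
Qed.

Definition pillow_graph : ograph :=
  ograph_of_mate pillow_mateK pillow_mate_inc pillow_nonempty pillow_connected.

Lemma mate_pillow_graph (F : face pillow_graph) : mate F = pillow_mate F.
Proof. exact: mate_of_mate. Qed.

End Pillow.

Lemma og_next_mate (G : ograph) (F : face G) : ~~ inc F ->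
  og_next G (F.1, face_strand F.2) = ((mate F).1, face_strand (mate F).2).
Proof.
move=> oF; have tF : triangle F = (F.1, face_strand F.2).
  by rewrite /triangle [incoming _ _](negbTE oF).
rewrite /mate [incoming _ _](negbTE oF) tF /in_side strand_in.
by case: (og_next G _).
Qed.

Section PillowSliding.
Variables (G : ograph) (A B : face G) (kq kp x0 y0 : 'I_4) (s : bool).
Hypothesis AB : A != B.
Hypothesis kqp : kq != kp.
Hypothesis incA : inc A = ~~ incoming s kq.
Hypothesis incB : inc B = ~~ incoming s kp.
Hypothesis first : triangle A = triangle B -> ~~ inc A.

Let Y := pillow_graph AB kqp incA incB.
Let old (t : G) : Y := inl t.
Let tet (x : bool) : Y := inr x.
Let oldF (F : face G) : face Y := (old F.1, F.2).
Let mateY (F : face Y) : mate F = pillow_mate A B kq kp s F := mate_pillow_graph F.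

Let mate_old F : triangle F <> triangle A -> triangle F <> triangle B ->
  mate (oldF F) = oldF (mate F).
Proof.
move=> FA FB; rewrite mateY /oldF /= -surjective_pairing.
have ne C : triangle F <> triangle C -> (F == C) = false.
  by move=> h; apply/eqP => e; apply: h; rewrite e.
by rewrite !ne // pillow_tau_inl //; apply/eqP => e; [apply: FA|apply: FB]; rewrite -e triangle_mate.
Qed.

Let next_old (F : face G) : ~~ inc F ->
  og_next Y (map_edge old (triangle F)) = ((mate (oldF F)).1, face_strand (mate (oldF F)).2).
Proof.
move=> oF; rewrite -og_next_mate //.
by rewrite /triangle [incoming _ _](negbTE oF).
Qed.

Let next_mate (F : face G) : ~~ inc F ->
  map_edge old (og_next G (triangle F)) = (old (mate F).1, face_strand (mate F).2).
Proof.
move=> oF; have -> : triangle F = (F.1, face_strand F.2).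
  by rewrite /triangle [incoming _ _](negbTE oF).
by rewrite og_next_mate.
Qed.

Let pout_inc (k : 'I_4) : ~~ inc ((tet (odd k), k) : face Y).
Proof. by rewrite /inc /= /incoming addbb. Qed.

Let next_pout (k : 'I_4) : og_next Y (pillow_out tet k) =
  ((mate ((tet (odd k), k) : face Y)).1, face_strand (mate ((tet (odd k), k) : face Y)).2).
Proof. exact: og_next_mate (pout_inc k). Qed.

Let BA : (B == A) = false. Proof. by rewrite eq_sym (negbTE AB). Qed.
Let kpq : (kp == kq) = false. Proof. by rewrite eq_sym (negbTE kqp). Qed.

Let mateAB : mate A = B <-> triangle A = triangle B.
Proof.
split=> [<-|e]; first by rewrite triangle_mate.
case: (triangle_eq e) => [e'|->]; last by rewrite mateK.
by move: AB; rewrite e' eqxx.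
Qed.

Let inc_odd (k : 'I_4) (C : face G) : inc C = ~~ incoming s k -> odd k = (inc C) (+) ~~ s.
Proof. by move=> ->; rewrite /incoming; case: s; case: (odd k). Qed.

Let incA_first : triangle A = triangle B -> inc A = false /\ inc B = true.
Proof.
move=> e; have /negbTE iA := first e; split=> //.
by move/mateAB: e => <-; rewrite inc_mate iA.
Qed.

Lemma pillow_sliding : uniq [:: x0; y0; kp; kq] -> (x0 < y0)%N ->
  ~~ ((kp < x0)%N && (kq < x0)%N) -> ~~ ((y0 < kp)%N && (y0 < kq)%N) ->
  same_edge (face_side A (pos kq kp)) (face_side B (pos kp kq)) ->
  exists D : sliding_data x0 y0 kp kq G Y,
    [/\ ps_e1 D = triangle A, ps_e2 D = triangle B, ps_old D = old & ps_tet D = tet].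
Proof.
move=> un lt nb na se.
have side_out (F : face G) m : same_edge (face_side F m) (face_side (out_side (triangle F)) m).
  by rewrite out_triangle; case: ifP => _; [apply: same_edge_mate|apply: connect0].
have se' : same_edge (face_side (out_side (triangle A)) (pos kq kp))
                     (face_side (out_side (triangle B)) (pos kp kq)).
  apply: connect_trans (side_out _ _); apply: connect_trans se.
  by rewrite -/(same_edge _ _) same_edge_sym.
have out_tri (F : face G) : inc F = false -> triangle (out_side (triangle F)) = triangle F.
  by move=> iF; rewrite out_triangle iF.
have oddq := inc_odd incA; have oddp := inc_odd incB.
have i_old : injective old by move=> t t' [].
have i_tet : injective tet by move=> t t' [].
have img (t' : Y) : (exists t, old t = t') <-> (forall x, tet x <> t').
  by case: t' => [t|x]; split=> [[] //|h]; [exists t|have := h x].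
have n_old (e : edge G) : e <> triangle A -> e <> triangle B ->
    og_next Y (map_edge old e) = map_edge old (og_next G e).
  move=> eA eB; have o : ~~ inc (out_side e) by rewrite inc_out.
  have := next_old o; have := next_mate o; rewrite triangle_out => -> ->.
  by rewrite mate_old ?triangle_out.
have n_in k : k \in [:: x0; y0] -> og_next Y (pillow_out tet k) = pillow_in tet k.
  move=> kxy; rewrite next_pout mateY /=.
  move: un kxy; rewrite /= !inE !negb_or => /and4P[/and3P[_ xp xq] /andP[yp yq] _ _].
  by case/orP=> /eqP->; rewrite (negbTE xp) (negbTE xq) || rewrite (negbTE yp) (negbTE yq).
have n_e1 : og_next Y (map_edge old (triangle A)) = pillow_in tet kq.
  case iA: (inc A).
    have o : ~~ inc (mate A) by rewrite inc_mate iA.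
    rewrite -triangle_mate next_old // mateY /= -surjective_pairing (negbTE (mate_neq A)).
    have -> : (mate A == B) = false.
      by apply/eqP => /mateAB/incA_first[]; rewrite iA.
    by rewrite mateK /pillow_tau eqxx /= /pillow_in /tet oddq iA negbK.
  rewrite next_old ?iA // mateY /= -surjective_pairing eqxx.
  by rewrite /pillow_in /tet oddq iA negbK.
have n_e2 : triangle A <> triangle B -> og_next Y (map_edge old (triangle B)) = pillow_in tet kp.
  move=> eAB; case iB: (inc B).
    have o : ~~ inc (mate B) by rewrite inc_mate iB.
    rewrite -triangle_mate next_old // mateY /= -surjective_pairing (negbTE (mate_neq B)).
    have -> : (mate B == A) = false.
      by apply/eqP => h; apply: eAB; rewrite -h triangle_mate.
    by rewrite mateK /pillow_tau BA eqxx /= /pillow_in /tet oddp iB negbK.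
  rewrite next_old ?iB // mateY /= -surjective_pairing BA eqxx.
  by rewrite /pillow_in /tet oddp iB negbK.
have n_q : og_next Y (pillow_out tet kq) =
    if triangle A == triangle B then pillow_in tet kp else map_edge old (og_next G (triangle A)).
  rewrite next_pout mateY /= eqxx oddq; case iA: (inc A) => /=.
    rewrite negbK eqxx; case: eqP => [/incA_first[]|_]; first by rewrite iA.
    have o : ~~ inc (mate A) by rewrite inc_mate iA.
    by rewrite -triangle_mate next_mate // mateK.
  rewrite (_ : (~~ s == s) = false); last by case: (s).
  case: eqP => [e|ne].
    have [_ iB] := incA_first e; move/mateAB: e => ->.
    by rewrite /pillow_tau BA eqxx /pillow_in /tet oddp iB negbK.
  rewrite pillow_tau_inl ?mate_neq // ?next_mate ?iA //.
  by apply/eqP => /mateAB.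
have n_p : og_next Y (pillow_out tet kp) = map_edge old (og_next G (triangle B)).
  rewrite next_pout mateY /= kpq eqxx oddp; case iB: (inc B) => /=.
    rewrite negbK eqxx.
    have o : ~~ inc (mate B) by rewrite inc_mate iB.
    by rewrite -triangle_mate next_mate // mateK.
  rewrite (_ : (~~ s == s) = false); last by case: (s).
  rewrite pillow_tau_inl ?mate_neq // ?next_mate ?iB //.
  apply/eqP => h; have e : triangle A = triangle B by rewrite -h triangle_mate.
  by have [] := incA_first e; rewrite iB.
exists (SlidingData un lt nb na se' i_old i_tet img (fun t => erefl) (fun x => erefl)
          n_old n_in n_e1 n_q n_e2 n_p).
by split.
Qed.

End PillowSliding.

Lemma label_cases (a b c d e i : 'I_5) : uniq [:: a; b; c; d; e] ->
  [|| i == a, i == b, i == c, i == d | i == e].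
Proof.
move=> un; have : i \in [:: a; b; c; d; e].
  have : [:: a; b; c; d; e] =i 'I_5.
    by apply/subset_cardP; [rewrite (card_uniqP un) card_ord|apply/subsetP].
  by move=> ->.
by rewrite !inE.
Qed.

Definition full_coboundary (u : bipyramid_weight) (p q : 'I_5) : int :=
  \sum_(r < 5 | r \notin [:: p; q]) sigma p q r * u [set p; q; r]%SET.

Lemma bip_coboundary_full a b (u v : bipyramid_weight) p q :
  u (~: [set a; b])%SET = 0 -> (forall S, S != (~: [set a; b])%SET -> v S = u S) ->
  bipyramid_coboundary a b v p q = full_coboundary u p q.
Proof.
move=> u0 vu; rewrite /bipyramid_coboundary big_mkcondr; apply: eq_bigr => r _.
by case: eqVneq => [->|ne]; rewrite ?u0 ?mulr0 // vu.
Qed.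

Lemma full_coboundaryB (u v : bipyramid_weight) p q :
  full_coboundary (fun S => u S - v S) p q = full_coboundary u p q - full_coboundary v p q.
Proof. by rewrite -sumrB; apply: eq_bigr => r _; rewrite mulrBr. Qed.

Lemma full_coboundaryZ (k : int) (u : bipyramid_weight) p q :
  full_coboundary (fun S => k * u S) p q = k * full_coboundary u p q.
Proof. by rewrite mulr_sumr; apply: eq_bigr => r _; rewrite mulrCA. Qed.

(* The 2-chain with value f l on the triangle common to D_c and D_l. *)
Definition tet_chain (c : 'I_5) (f : 'I_5 -> int) : bipyramid_weight := fun S =>
  \sum_(l | l != c) (if S == ~: [set c; l] then f l else 0).

Lemma tet_chain_self c l f : l != c -> tet_chain c f (~: [set c; l])%SET = f l.
Proof.
move=> lc; rewrite /tet_chain (bigD1 l) //= eqxx big1 ?addr0 // => k /andP[kc kl].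
by rewrite eq_setC2 eqxx /= eq_sym (negbTE kl) /= eq_sym (negbTE kc).
Qed.

Lemma tet_chain_other c i j f : i != c -> j != c -> tet_chain c f (~: [set i; j])%SET = 0.
Proof.
move=> ic jc; rewrite /tet_chain big1 // => k _.
by rewrite eq_setC2 (negbTE ic) (negbTE jc) andbF.
Qed.

Lemma compl3 (c p q l1 l2 : 'I_5) : uniq [:: c; p; q; l1; l2] ->
  [set p; q; l1] = ~: [set c; l2].
Proof.
move=> un; apply/setP => r; rewrite !inE.
have := label_cases r un; move: un => /= /and5P[]; rewrite !inE !negb_or.
move=> /and4P[cp cq c1 c2] /and3P[pq p1 p2] /andP[q1 q2] l12 _.
case: (eqVneq r c) => [->|_]; first by rewrite (negbTE cp) (negbTE cq) (negbTE c1).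
case: (eqVneq r l2) => [->|_] /=; last by rewrite orbF -orbA.
by rewrite ![l2 == _]eq_sym (negbTE p2) (negbTE q2) (negbTE l12).
Qed.

Lemma tet_coboundary_in (c p q l1 l2 : 'I_5) f : uniq [:: c; p; q; l1; l2] ->
  full_coboundary (tet_chain c f) p q = sigma p q l2 * f l1 + sigma p q l1 * f l2.
Proof.
move=> un; have un2 : uniq [:: c; p; q; l2; l1].
  by move: un; rewrite /= !inE !negb_or [l2 == l1]eq_sym => /and5P[/and4P[-> -> -> ->] /and3P[-> -> ->] /andP[-> ->] -> _].
have E1 := compl3 un; have E2 := compl3 un2.
have lab r := label_cases r un.
move: un => /= /and5P[]; rewrite !inE !negb_or.
move=> /and4P[cp cq c1 c2] /and3P[pq p1 p2] /andP[q1 q2] l12 _.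
rewrite /full_coboundary (bigD1 l1) /=; last by rewrite !inE negb_or ![l1 == _]eq_sym p1 q1.
rewrite (bigD1 l2) /=; last by rewrite !inE negb_or ![l2 == _]eq_sym p2 q2 l12.
rewrite big1 ?addr0 => [|r].
  by rewrite E1 E2 !tet_chain_self 1?eq_sym // addrC.
rewrite !inE negb_or -!andbA => /and4P[rp rq r1 r2].
have := lab r; rewrite (negbTE rp) (negbTE rq) (negbTE r1) (negbTE r2) !orbF => /eqP->.
rewrite /tet_chain big1 ?mulr0 // => k _; case: eqP => // /setP/(_ c).
by rewrite !inE eqxx orbT.
Qed.

Lemma tet_coboundary_out (c p q : 'I_5) f : (c == p) || (c == q) ->
  full_coboundary (tet_chain c f) p q = 0.
Proof.
move=> cpq; apply: big1 => r _; rewrite /tet_chain big1 ?mulr0 // => k _.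
by case: eqP => // /setP/(_ c); rewrite !inE eqxx cpq.
Qed.

Lemma sigma_pos (c p q r : 'I_5) : p != c -> q != c -> r != c ->
  sigma p q r = sigma (pos c p) (pos c q) (pos c r).
Proof.
by move=> pc qc rc; rewrite -{1}(lift_pos pc) -{1}(lift_pos qc) -{1}(lift_pos rc) /= sigma_lift.
Qed.

Lemma uniq_pos (c p q r s : 'I_5) : uniq [:: c; p; q; r; s] ->
  uniq [:: pos c p; pos c q; pos c r; pos c s].
Proof.
rewrite cons_uniq => /andP[cn un].
rewrite -[X in uniq X]/(map (pos c) [:: p; q; r; s]) map_inj_in_uniq // => i j ic jc.
by apply: pos_inj; apply: contraNneq cn => <-.
Qed.

Definition dot_chain (x0 y0 k : 'I_4) : int :=
  if dotted x0 y0 then 0 else (k == 2 :> nat)%:Z - (k == 3 :> nat)%:Z.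

(* The boundary of the 2-chain [dot_chain] of the tetrahedron is the sum of its
   dotted edges minus the edges x0 y0 and pq. *)
Lemma dot_chainP (x0 y0 p q : 'I_4) : uniq [:: x0; y0; p; q] -> (x0 < y0)%N ->
    ~~ ((p < x0)%N && (q < x0)%N) -> ~~ ((y0 < p)%N && (y0 < q)%N) ->
  forall k1 k2 m1 m2 : 'I_4, uniq [:: k1; k2; m1; m2] ->
  sigma k1 k2 m2 * dot_chain x0 y0 m1 + sigma k1 k2 m1 * dot_chain x0 y0 m2 =
  dot_weight k1 k2 - ((k1 \in [:: x0; y0]) == (k2 \in [:: x0; y0]))%:Z.
Proof.
pose t (x0 y0 k1 k2 m1 m2 : nat) : bool :=
  let g k : int := if dotted x0 y0 then 0 else (k == 2)%:Z - (k == 3)%:Z in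
  sigma k1 k2 m2 * g m1 + sigma k1 k2 m1 * g m2 ==
  (dotted k1 k2)%:Z - ((k1 \in [:: x0; y0]) == (k2 \in [:: x0; y0]))%:Z.
have T : (all (fun x0 => all (fun y0 => all (fun p => all (fun q =>
    [&& uniq [:: x0; y0; p; q], x0 < y0, ~~ ((p < x0) && (q < x0)) & ~~ ((y0 < p) && (y0 < q))] ==>
    all (fun k1 => all (fun k2 => all (fun m1 => all (fun m2 =>
      uniq [:: k1; k2; m1; m2] ==> t x0 y0 k1 k2 m1 m2)
    (iota 0 4)) (iota 0 4)) (iota 0 4)) (iota 0 4))
    (iota 0 4)) (iota 0 4)) (iota 0 4)) (iota 0 4))%N by vm_compute.
have mem (i : 'I_4) : (i : nat) \in iota 0 4 by rewrite mem_iota /=.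
move=> un lt nb na k1 k2 m1 m2 un2.
move/allP/(_ x0 (mem _))/allP/(_ y0 (mem _))/allP/(_ p (mem _))/allP/(_ q (mem _)): T.
have mu : uniq [:: x0 : nat; y0 : nat; p : nat; q : nat] by rewrite -(map_inj_uniq val_inj) in un.
have mu2 : uniq [:: k1 : nat; k2 : nat; m1 : nat; m2 : nat] by rewrite -(map_inj_uniq val_inj) in un2.
rewrite mu lt nb na => /implyP/(_ isT).
move/allP/(_ k1 (mem _))/allP/(_ k2 (mem _))/allP/(_ m1 (mem _))/allP/(_ m2 (mem _)).
by rewrite mu2 => /eqP.
Qed.

Lemma alternating_chainP (k1 k2 m1 m2 : 'I_4) : uniq [:: k1; k2; m1; m2] ->
  sigma k1 k2 m2 * (-1) ^+ odd m1 + sigma k1 k2 m1 * (-1) ^+ odd m2 = 0 :> int.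
Proof.
have T : all (fun k1 => all (fun k2 => all (fun m1 => all (fun m2 =>
      uniq [:: k1; k2; m1; m2] ==>
      (sigma k1 k2 m2 * (-1) ^+ odd m1 + sigma k1 k2 m1 * (-1) ^+ odd m2 == 0 :> int))
    (iota 0 4)) (iota 0 4)) (iota 0 4)) (iota 0 4) by vm_compute.
have mem (i : 'I_4) : (i : nat) \in iota 0 4 by rewrite mem_iota /=.
move=> un; have mu : uniq [:: k1 : nat; k2 : nat; m1 : nat; m2 : nat].
  by rewrite -(map_inj_uniq val_inj) in un.
move/allP/(_ k1 (mem _))/allP/(_ k2 (mem _))/allP/(_ m1 (mem _))/allP/(_ m2 (mem _)): T.
by rewrite mu => /eqP.
Qed.

Section PillowMP.
Variables (a b al be c d e : 'I_5) (eps : bool) (G G' : ograph) (D : mp_data a b eps G G').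
Hypothesis labels : uniq [:: a; b; c; d; e].
Hypothesis albe : (al = a /\ be = b) \/ (al = b /\ be = a).

Let Told := mp_told D.
Let Tnew := mp_tnew D.
Let far := mp_far_rel D.
Let B0 : bistellar (removed a b) Told Tnew far := mp_bistellar D.

Definition cut_face1 : face G := (mp_told D al, pos al c).
Definition cut_face2 : face G := (mp_told D be, pos be c).
Let s : bool := eps (+) odd c.

Let ne : [/\ al != be, al != c, be != c & al \in [:: a; b] /\ be \in [:: a; b]].
Proof.
move: labels => /= /and5P[]; rewrite !inE !negb_or => /and4P[ab ac _ _] /and3P[bc _ _] _ _ _.
by case: albe => -[-> ->]; rewrite ?ab ?ac ?bc ?(eq_sym b) ?ab ?eqxx ?orbT.
Qed.

Lemma cut_faces_neq : cut_face1 != cut_face2.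
Proof.
have [ab ac bc [ra rb]] := ne; apply/eqP => -[/(bs_inj B0 ra rb) e' _].
by rewrite e' eqxx in ab.
Qed.

Lemma cut_pos_neq : pos c al != pos c be.
Proof. by have [ab ac bc _] := ne; apply: contra_neq ab; apply: pos_inj. Qed.

Lemma cut_face1_inc : inc cut_face1 = ~~ incoming s (pos c al).
Proof.
have [_ ac _ [ra _]] := ne; rewrite /inc /= mp_told_sign // /incoming odd_pos // /s.
by case: eps; case: (odd (pos c al)); case: (odd al); case: (odd c).
Qed.

Lemma cut_face2_inc : inc cut_face2 = ~~ incoming s (pos c be).
Proof.
have [_ _ bc [_ rb]] := ne; rewrite /inc /= mp_told_sign // /incoming odd_pos // /s.
by case: eps; case: (odd (pos c be)); case: (odd be); case: (odd c).
Qed.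

Definition mp_pillow : ograph := pillow_graph cut_faces_neq cut_pos_neq cut_face1_inc cut_face2_inc.
Let Y := mp_pillow.

Definition pillow_seen : face G -> pillow_vertex G * 'I_4 := pillow_tau cut_face1 cut_face2 (pos c al) (pos c be) s.
Let mateY (F : face Y) : mate F = pillow_mate cut_face1 cut_face2 (pos c al) (pos c be) s F := mate_pillow_graph F.
Let mate_tau F : mate (pillow_seen F : face Y) = pillow_seen (mate F).
Proof. by rewrite mateY; apply: pillow_mate_tau; exact: cut_pos_neq. Qed.

Definition far_inv (t' : G') : G := odflt (Told a) [pick t | `[< far t t' >]].

Let far_invP t t' : far t t' -> far_inv t' = t.
Proof.
move=> ft; rewrite /far_inv; case: pickP => [u /asboolP fu|/(_ t)/asboolP//].
exact: (bs_fun' B0 fu ft).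
Qed.

Definition pillow_tet (j : 'I_5) : Y := if j == c then inr s else inl (Told j).
Definition pillow_far (t' : G') : Y := if t' == Tnew c then inr (~~ s) else inl (far_inv t').

Let rem i : removed a b i = (i == a) || (i == b).
Proof. by rewrite /removed !inE. Qed.
Let rem2 i : removed d e i = (i == d) || (i == e).
Proof. by rewrite /removed !inE. Qed.

Let label i : [|| i == a, i == b, i == c, i == d | i == e].
Proof. exact: label_cases labels. Qed.

Lemma labels_neq : [/\ [/\ a != b, a != c, a != d & a != e], [/\ b != c, b != d & b != e],
              c != d /\ c != e & d != e].
Proof.
move: labels => /= /and5P[]; rewrite !inE !negb_or.
by move=> /and4P[-> -> -> ->] /and3P[-> -> ->] /andP[-> ->] -> _.
Qed.

Lemma removed_ab_labels : [/\ removed a b a, removed a b b, ~~ removed a b c, ~~ removed a b d & ~~ removed a b e].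
Proof.
have [[ab ac ad ae] [bc bd be'] [cd ce] de] := labels_neq.
by rewrite !rem !eqxx orbT ![_ == a]eq_sym ![_ == b]eq_sym !negb_or ac bc ad bd ae be'.
Qed.

Lemma removed_de_labels : [/\ ~~ removed d e a, ~~ removed d e b, ~~ removed d e c, removed d e d & removed d e e].
Proof.
have [[ab ac ad ae] [bc bd be'] [cd ce] de] := labels_neq.
by rewrite !rem2 !eqxx orbT !negb_or ad ae bd be' cd ce.
Qed.

Lemma removed_de_kept i : removed d e i -> ~~ removed a b i /\ i != c.
Proof.
have [_ _ [cd ce] _] := labels_neq; have [_ _ _ nd nn] := removed_ab_labels.
by rewrite rem2 => /orP[]/eqP->; rewrite eq_sym.
Qed.

Lemma kept_de j : ~~ removed d e j -> (j == c) || removed a b j.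
Proof.
rewrite rem2 rem negb_or => /andP[/negbTE jd /negbTE je].
by have := label j; rewrite jd je !orbF => /or3P[]->; rewrite ?orbT.
Qed.

Lemma removed_ab_kept i : removed a b i -> ~~ removed d e i /\ (i == c) = false.
Proof.
have [na nb nc _ _] := removed_de_labels; have [[_ ac _ _] [bc _ _] _ _] := labels_neq.
by rewrite rem => /orP[]/eqP->; rewrite ?na ?nb ?(negbTE ac) ?(negbTE bc).
Qed.

Let pillow_corr := corresponding d e Tnew pillow_tet pillow_far.

Lemma cut_face_neq i j k : removed a b i -> removed a b k -> j != c -> j != i ->
  ((Told i, pos i j) == (Told k, pos k c)) = false.
Proof.
move=> Si Sk jc ji; have [_ kc] := removed_ab_kept Sk.
apply/eqP => -[/(bs_inj B0 Si Sk) ik]; rewrite -ik in kc * => /pos_inj e'.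
by move: jc; rewrite e' ?eqxx // eq_sym kc.
Qed.

Lemma pillow_seen_old i j : removed a b i -> j != c -> j != i ->
  pillow_seen (Told i, pos i j) = (inl (Told i), pos i j).
Proof.
move=> Si jc ji; have [_ _ _ [ra rb]] := ne.
by rewrite /pillow_seen /pillow_tau !cut_face_neq.
Qed.

Lemma pillow_seen_cut i : removed a b i -> pillow_seen (Told i, pos i c) = (inr (~~ s), pos c i).
Proof.
move=> Si; have [ab _ _ [ra rb]] := ne.
have : i = al \/ i = be.
  by move: Si; rewrite rem; case: albe => -[-> ->] /orP[]/eqP; tauto.
case=> ->; rewrite /pillow_seen /pillow_tau ?eqxx //.
by rewrite eq_sym (negbTE cut_faces_neq).
Qed.

Lemma pillow_seen_far t k : (forall i, removed a b i -> Told i <> t) -> pillow_seen (t, k) = (inl t, k).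
Proof.
have [_ _ _ [ra rb]] := ne => h; rewrite /pillow_seen /pillow_tau.
have nk i : removed a b i -> ((t, k) == (Told i, pos i c)) = false.
  by move=> Si; apply/eqP => -[e' _]; case: (h i Si).
by rewrite !nk.
Qed.

Lemma mate_cut_face i : removed a b i ->
  mate ((inl (Told i), pos i c) : face Y) = (inr s, pos c i).
Proof.
move=> Si; have [ab _ _ [ra rb]] := ne.
have : i = al \/ i = be.
  by move: Si; rewrite rem; case: albe => -[-> ->] /orP[]/eqP; tauto.
case=> ->; rewrite mateY /= -/cut_face1 -/cut_face2 ?eqxx //.
by rewrite eq_sym (negbTE cut_faces_neq).
Qed.

Lemma mate_inner_face x i : removed d e i ->
  mate ((inr x, pos c i) : face Y) = (inr (~~ x), pos c i).
Proof.
move=> Si; have [nS ic] := removed_de_kept Si; have [_ ac bc [ra rb]] := ne.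
have nk k : removed a b k -> k != c -> (pos c i == pos c k) = false.
  by move=> Sk kc; apply/eqP => /pos_inj e'; move: nS; rewrite e' // Sk.
by rewrite mateY /= !nk.
Qed.

Let pillow_far_old t t' : far t t' -> pillow_far t' = inl t.
Proof.
move=> ft; rewrite /pillow_far; case: eqP => [e'|_]; last by rewrite (far_invP ft).
have [_ _ nc _ _] := removed_ab_labels.
by case: (bs_far' B0 ft nc); rewrite e'.
Qed.

Let pillow_far_c : pillow_far (Tnew c) = inr (~~ s).
Proof. by rewrite /pillow_far eqxx. Qed.

Lemma far_not_de t t' i : far t t' -> removed d e i -> Tnew i <> t'.
Proof. by move=> ft /removed_de_kept[nS _]; apply: (bs_far' B0 ft nS). Qed.

Lemma tet_c_not_de i : removed d e i -> Tnew i <> Tnew c.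
Proof.
have [_ _ nc _ _] := removed_ab_labels.
by move=> /removed_de_kept[nS ic] /(bs_inj' B0 nS nc) e'; rewrite e' eqxx in ic.
Qed.

Lemma pillow_seen_corr F0 F1 : bs_corr (removed a b) Told Tnew far F0 F1 -> pillow_corr F1 (pillow_seen F0 : face Y).
Proof.
case=> [t t' k ft|i j Si Sj].
  rewrite pillow_seen_far; last by move=> i; apply: (bs_far B0 ft).
  rewrite -(pillow_far_old ft); apply: FarFace => i; exact: far_not_de ft.
have ji : j != i by apply: contraNneq Sj => ->.
have [nSi ic] := removed_ab_kept Si.
have [->|jc] := eqVneq j c.
  rewrite pillow_seen_cut // -pillow_far_c; apply: FarFace; exact: tet_c_not_de.
have Sj2 : removed d e j.
  by have := @kept_de j; case: (removed d e j) => // /(_ isT); rewrite (negbTE jc) (negbTE Sj).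
rewrite pillow_seen_old //; have -> : inl (Told i) = pillow_tet i by rewrite /pillow_tet ic.
exact: OuterFace.
Qed.

Let mate_corr_tau F0 F1 : bs_corr (removed a b) Told Tnew far F0 F1 ->
  pillow_corr (mate F1) (mate (pillow_seen F0 : face Y)).
Proof. by move=> /(bs_outer B0); rewrite mate_tau; apply: pillow_seen_corr. Qed.

Lemma pillow_outer_glue F F' : pillow_corr F F' -> pillow_corr (mate F) (mate F').
Proof.
have [_ _ nc _ _] := removed_ab_labels; have [_ _ nc2 _ _] := removed_de_labels.
case=> [t' k h|i j Si Sj].
  have [[j Sj tE]|[t ft]] := bs_cover' B0 t'; last first.
    rewrite (pillow_far_old ft) -(pillow_seen_far k (t := t)); last by move=> i; apply: (bs_far B0 ft).
    exact/mate_corr_tau/BsFar.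
  have jc : j = c.
    apply/eqP; case j2: (removed d e j); first by case: (h j j2).
    by have /kept_de := negbT j2; rewrite (negbTE Sj) orbF.
  rewrite -tE jc pillow_far_c -[k](pos_lift c).
  move: (lift c k) (neq_lift c k) => l; rewrite eq_sym => lc.
  case l2: (removed d e l).
    have [nSl _] := removed_de_kept l2.
    rewrite mate_inner_face // negbK (bs_glue' B0) // 1?eq_sym //.
    have -> : (inr s : Y) = pillow_tet c by rewrite /pillow_tet eqxx.
    exact: OuterFace.
  have Sl : removed a b l by have /kept_de := negbT l2; rewrite (negbTE lc).
  rewrite -(pillow_seen_cut Sl); apply: mate_corr_tau.
  exact: BsOuter.
have [nSi ic] := removed_de_kept Si.
case: (kept_de Sj) => [] ; case: (eqVneq j c) => [->|jc] /=; last first.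
- move=> Sj1; have ij : i != j by apply: contraNneq nSi => ->.
  have -> : pillow_tet j = inl (Told j) by rewrite /pillow_tet (negbTE jc).
  by rewrite -pillow_seen_old //; apply: mate_corr_tau; apply: BsOuter.
move=> _; rewrite (bs_glue' B0) // /pillow_tet eqxx mate_inner_face // -pillow_far_c.
apply: FarFace; exact: tet_c_not_de.
Qed.

Lemma pillow_mp : exists D' : mp_data d e (~~ eps) G' Y,
  [/\ mp_told D' = Tnew, mp_tnew D' = pillow_tet & mp_far D' = pillow_far].
Proof.
have [_ _ nc _ _] := removed_ab_labels; have [_ _ nc2 _ _] := removed_de_labels.
have no_far t' : (forall i, removed d e i -> Tnew i <> t') -> t' <> Tnew c ->
    exists t, far t t'.
  move=> h tc; have [[j Sj tE]|//] := bs_cover' B0 t'.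
  case j2: (removed d e j); first by case: (h j j2).
  have /kept_de := negbT j2; rewrite (negbTE Sj) orbF => /eqP jc.
  by case: tc; rewrite -tE jc.
have h1 : {in removed d e &, injective Tnew}.
  by move=> i j /removed_de_kept[Si _] /removed_de_kept[Sj _]; apply: (bs_inj' B0 Si Sj).
have h2 : {in predC (removed d e) &, injective pillow_tet}.
  move=> i j /kept_de Si /kept_de Sj; rewrite /pillow_tet.
  case: (eqVneq i c) Si => [->|_] /= Si; case: (eqVneq j c) Sj => [->|_] //= Sj [].
  exact: (bs_inj B0 Si Sj).
have h3 t u : (forall i, removed d e i -> Tnew i <> t) ->
    (forall i, removed d e i -> Tnew i <> u) -> pillow_far t = pillow_far u -> t = u.
  move=> ht hu; rewrite /pillow_far; case: (eqVneq t (Tnew c)) => [->|/eqP tc];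
    case: (eqVneq u (Tnew c)) => [->|/eqP uc] // [].
  have [t0 f0] := no_far t ht tc; have [u0 g0] := no_far u hu uc.
  by rewrite (far_invP f0) (far_invP g0) => e'; rewrite e' in f0; apply: (bs_fun B0 f0 g0).
have h4 (t' : Y) : (exists2 t, forall i, removed d e i -> Tnew i <> t & pillow_far t = t') <->
    (forall j, ~~ removed d e j -> pillow_tet j <> t').
  split.
    case=> t ht <- j /kept_de Sj; rewrite /pillow_far /pillow_tet.
    case: (eqVneq t (Tnew c)) => [tE|/eqP tc]; case: (eqVneq j c) Sj => [jc|jc] /= Sj //.
      by case; case: (s).
    have [t0 f0] := no_far t ht tc; rewrite (far_invP f0) => -[].
    exact: (bs_far B0 f0).
  case: t' => [t|x] h.
    have ht i : removed a b i -> Told i <> t.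
      move=> Si e'; have [nSi ic] := removed_ab_kept Si.
      by case: (h i nSi); rewrite /pillow_tet ic e'.
    have [[i Si e']|[t' ft]] := bs_cover B0 t; first by case: (ht i Si).
    by exists t'; [move=> i; apply: far_not_de ft|apply: pillow_far_old].
  exists (Tnew c); first exact: tet_c_not_de.
  rewrite pillow_far_c; congr inr; have := h c nc2; rewrite /pillow_tet eqxx.
  by case: (x); case: (s) => // h'; case: h'.
have h5 i : removed d e i -> og_sign (Tnew i) = ~~ eps (+) odd i.
  by move=> /removed_de_kept[Si _]; apply: mp_tnew_sign.
have h6 j : ~~ removed d e j -> og_sign (pillow_tet j) = ~~ ~~ eps (+) odd j.
  move=> /kept_de; rewrite negbK /pillow_tet; case: (eqVneq j c) => [->|jc] //= Sj.
  exact: mp_told_sign.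
have h7 t : (forall i, removed d e i -> Tnew i <> t) -> og_sign (pillow_far t) = og_sign t.
  move=> ht; have [->|/eqP tc] := eqVneq t (Tnew c).
    by rewrite pillow_far_c /= mp_tnew_sign // /s addNb.
  have [t0 f0] := no_far t ht tc; rewrite (pillow_far_old f0) /=.
  by case: f0 => f1 <-; rewrite mp_far_sign.
have h8 i j : removed d e i -> removed d e j -> i != j ->
    mate (Tnew i, pos i j) = (Tnew j, pos j i).
  by move=> /removed_de_kept[Si _] /removed_de_kept[Sj _]; apply: (bs_glue' B0).
have h9 i j : ~~ removed d e i -> ~~ removed d e j -> i != j ->
    mate ((pillow_tet i, pos i j) : face Y) = (pillow_tet j, pos j i).
  move=> /kept_de Si /kept_de Sj ij; rewrite /pillow_tet; have ji : j != i by rewrite eq_sym.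
  have [ic|ic] := eqVneq i c; have [jc|jc] := eqVneq j c.
  - by move: ij; rewrite ic jc eqxx.
  - rewrite (negbTE jc) /= in Sj; rewrite ic -mate_cut_face // mateK.
    by rewrite -ic.
  - by rewrite (negbTE ic) /= in Si; rewrite jc mate_cut_face.
  rewrite (negbTE ic) /= in Si; rewrite (negbTE jc) /= in Sj.
  by rewrite -(pillow_seen_old Si jc ji) mate_tau (bs_glue B0) // pillow_seen_old.
exists (@MPData d e (~~ eps) G' Y Tnew pillow_tet pillow_far h1 h2 h3 h4 h5 h6 h7 h8 h9 pillow_outer_glue).
by split.
Qed.

End PillowMP.

Section Existence.
Variables (a b : 'I_5) (eps : bool) (G G' : ograph) (D : mp_data a b eps G G').
Let T := mp_told D.
Let T' := mp_tnew D.
Let far := mp_far_rel D.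
Let B : bistellar (removed a b) T T' far := mp_bistellar D.

Lemma bs_corr_inner F i j : ~~ removed a b i -> ~~ removed a b j -> i != j ->
  ~ bs_corr (removed a b) T T' far F (T' i, pos i j).
Proof.
move=> Si Sj ij; move e: (T' i, _) => F' h; case: F F' / h e => [t t' k ft [te _]|i2 j2 Si2 Sj2 [te pe]].
  exact: (bs_far' B ft Si te).
have ii : i = j2 by apply: (bs_inj' B).
rewrite -ii in pe; have ij2 : j = i2.
  apply: pos_inj pe; first by rewrite eq_sym.
  by apply: contraTneq Si2 => ->.
by rewrite ij2 Si2 in Sj.
Qed.

Lemma face_new_inj i j i2 j2 : ~~ removed a b i -> ~~ removed a b i2 -> i != j -> i2 != j2 ->
  (T' i, pos i j) = (T' i2, pos i2 j2) -> i = i2 /\ j = j2.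
Proof.
move=> Si Si2 ij ij2 [/(bs_inj' B Si Si2) ii]; rewrite -ii in ij2 * => pe; split=> //.
by apply: pos_inj pe; rewrite eq_sym.
Qed.

Lemma bs_corr_unique F F2 F' : bs_corr (removed a b) T T' far F F' ->
  bs_corr (removed a b) T T' far F2 F' -> F = F2.
Proof.
case=> [t t' k ft|i j Si Sj].
  move e: (t', k) => F1 h; case: F2 F1 / h e => [t2 t2' k2 ft2 [te ->]|i j Si Sj [te _]].
    by rewrite te in ft; rewrite (bs_fun' B ft ft2).
  by case: (bs_far' B ft Sj).
move e: (T' j, _) => F1 h; case: F2 F1 / h e => [t2 t2' k2 ft2 [te _]|i2 j2 Si2 Sj2 [te pe]].
  by case: (bs_far' B ft2 Sj).
have jj : j = j2 by apply: (bs_inj' B).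
rewrite -jj in pe *; have -> // : i = i2.
by apply: pos_inj pe; apply: contraNneq Sj => <-.
Qed.

Lemma mp_weights_ex (w : bipyramid_weight) (x : edge G -> int) :
  x (triangle (mp_told D a, pos a b)) = 0 -> exists y, mp_weights D w x y.
Proof.
move=> x0; pose f F := x (triangle F) + outer_weight a b T w F + outer_weight a b T w (mate F).
have f_mate F : f (mate F) = f F by rewrite /f triangle_mate mateK addrAC.
pose P (e : edge G') (v : int) :=
  (forall i j, ~~ removed a b i -> ~~ removed a b j -> i != j ->
     triangle (T' i, pos i j) = e -> v = w (~: [set i; j])%SET) /\
  (forall F F', bs_corr (removed a b) T T' far F F' -> triangle F' = e -> v = f F).
suff [y yP] : {y & forall e, P e (y e)}.
  exists y; split=> // [i j Si Sj ij|F F' /mp_corrP FF'].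
    by have [h _] := yP (triangle (T' i, pos i j)); apply: h.
  by have [_ h] := yP (triangle F'); apply: h FF' _.
apply: choice => e.
have [[i [j [/= Si Sj ij eE]]]|[F FF']] := bs_faceP (bistellar_sym B) (out_side e).
  have cases F' : triangle F' = e -> F' = (T' i, pos i j) \/ F' = (T' j, pos j i).
    by rewrite -{1}[e]triangle_out => /triangle_eq; rewrite eE (bs_glue' B).
  have ji : j != i by rewrite eq_sym.
  exists (w (~: [set i; j])); split=> [i2 j2 Si2 Sj2 ij2 /cases|F F' FF' /cases].
    case=> /face_new_inj[] // -> -> //; by rewrite setUC.
  by case=> FE; rewrite FE in FF'; [case: (bs_corr_inner Si Sj ij FF')|case: (bs_corr_inner Sj Si ji FF')].
have {}FF' := proj2 (bs_corr_sym (removed a b) T T' far F (out_side e)) FF'; have FF'm := bs_outer B FF'.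
have cases F' : triangle F' = e -> F' = out_side e \/ F' = mate (out_side e).
  by rewrite -{1}[e]triangle_out => /triangle_eq.
exists (f F); split=> [i j Si Sj ij /cases|F2 F' FF2 /cases].
  by case=> FE; [rewrite -FE in FF'; case: (bs_corr_inner Si Sj ij FF')
                |rewrite -FE in FF'm; case: (bs_corr_inner Si Sj ij FF'm)].
case=> FE; rewrite FE in FF2; first by rewrite (bs_corr_unique FF2 FF').
by rewrite (bs_corr_unique FF2 FF'm) f_mate.
Qed.

End Existence.

(** * H-moves *)

Section HMoves.
Variable G : ograph.

Definition H_weight (v : G) (e : edge G) : int := ((og_next G e).1 == v)%:Z - (e.1 == v)%:Z.

Definition H_side (v : G) (F : face G) : int :=
  if F.1 == v then (if inc F then 1 else -1) else 0.

Lemma H_weight_sides v F : H_weight v (triangle F) = H_side v F + H_side v (mate F).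
Proof.
suff h (e : edge G) : H_weight v e = H_side v (out_side e) + H_side v (mate (out_side e)).
  have [iF|oF] := boolP (inc F); have := h (triangle F); rewrite out_triangle.
    by rewrite iF mateK addrC.
  by rewrite (negbTE oF).
rewrite mate_out /H_weight /H_side inc_out inc_in /= addrC.
by case: (e.1 == v); case: ((og_next G e).1 == v).
Qed.

Lemma tetrahedron_boundary2 (f : 'I_4 -> 'I_4 -> int) :
  \sum_(k < 4) (-1) ^+ odd k * \sum_(m < 3) sigma (lift m (ord0 : 'I_2)) (lift m (ord_max : 'I_2)) m *
     f (lift k (lift m (ord0 : 'I_2))) (lift k (lift m (ord_max : 'I_2))) = 0.
Proof.
pose g (i j : nat) := f (inord i) (inord j).
under eq_bigr => k _.
  under eq_bigr => m _.
    rewrite -[X in f X _]inord_val -[X in f _ X]inord_val -/(g _ _).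
    over.
  over.
rewrite !big_ord_recl !big_ord0 /= /bump /= /sigma /=.
ring.
Qed.

Lemma coboundary_H v c : coboundary (H_weight v) c = 0.
Proof.
apply: (@pmulrnI _ 2) => //; rewrite mul0rn -tri_pairing_ind.
set th := edge_ind c.
transitivity ((\sum_(F : G * 'I_4) face_pairing th F * H_side v F) *+ 2).
  rewrite /tri_pairing pair_bigA mulr2n [X in _ + X](reindex_inj (@mate_inj G)) /=.
  rewrite -big_split /=; apply: eq_bigr => -[t k] _ /=.
  by rewrite H_weight_sides mulrDr face_pairing_mate.
rewrite -(pair_bigA _ (fun t k => face_pairing th (t, k) * H_side v (t, k))) /=.
rewrite (bigD1 v) //= [X in _ + X]big1 ?addr0; last first.
  by move=> t /negbTE tv; apply: big1 => k _; rewrite /H_side /= tv mulr0.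
pose sg : int := if og_sign v then 1 else -1.
rewrite (eq_bigr (fun k : 'I_4 => sg * ((-1) ^+ odd k * face_pairing th (v, k)))); last first.
  move=> k _; rewrite /H_side /= eqxx /inc /= /incoming /sg.
  by case: (og_sign v); case: (odd k) => /=; ring.
by rewrite -mulr_sumr (tetrahedron_boundary2 (fun i j => th (v, (i, j)))) mulr0 mul0rn.
Qed.

Lemma euler_H (x y : edge G -> int) v (k : int) c :
  (forall e, y e = x e + k * H_weight v e) -> euler_at x c -> euler_at y c.
Proof.
move=> yE; rewrite /euler_at => <-; congr (_%:~R).
have : coboundary y c = coboundary x c + k * coboundary (H_weight v) c.
  rewrite /coboundary mulr_sumr -big_split /=; apply: eq_bigr => e _.
  rewrite mulr_sumr -big_split /=; apply: eq_bigr => m _.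
  by rewrite yE; ring.
by rewrite coboundary_H mulr0 addr0.
Qed.

End HMoves.

Section Framed.
Variable R : realType.

Definition framed_of (G : ograph) (x : edge G -> int) (hx : framed_integral R x) : framed_ograph R :=
  FramedOGraph (ex_intro2 _ _ x hx (fun e => erefl) :
    exists2 x0, framed_integral R x0 & reduces_to x0 (fun e => (x e)%:~R)).

Lemma framed_of_self (X : framed_ograph R) (x : edge X -> int) (hx : framed_integral R x) :
  reduces_to x (fo_weight X) -> derivable_by_steps X (framed_of hx).
Proof.
move=> xz; apply: rst_step; apply: Or44; exists id; last by move=> [v s]; rewrite /= -xz.
by split=> // [|[v s]]; [exists id|rewrite /map_edge /=; case: (og_next X _)].
Qed.

Lemma framed_of_move (mv : integral_move) (G G' : ograph) (x : edge G -> int) (x' : edge G' -> int)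
    (hx : framed_integral R x) (hx' : framed_integral R x') :
  mv G G' x x' -> framed mv (framed_of hx) (framed_of hx').
Proof. by move=> h; exists x, x'; split. Qed.

Lemma framed_H (G : ograph) (x y : edge G -> int) v (k : int) :
  (forall e, y e = x e + k * H_weight v e) -> framed_integral R x -> framed_integral R y.
Proof. by move=> yE [cl eu]; split=> // c /eu; apply: euler_H yE. Qed.

Lemma derivable_H (G : ograph) (x y : edge G -> int) v (k : int)
    (hx : framed_integral R x) (hy : framed_integral R y) :
  (forall e, y e = x e + k * H_weight v e) -> derivable_by_steps (framed_of hx) (framed_of hy).
Proof.
have same (x1 x2 : edge G -> int) (h1 : framed_integral R x1) (h2 : framed_integral R x2) :
    x1 =1 x2 -> derivable_by_steps (framed_of h1) (framed_of h2).
  by move=> e; apply: framed_of_self => a; rewrite /= e.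
have nat_case (n : nat) (x1 x2 : edge G -> int) (h1 : framed_integral R x1) (h2 : framed_integral R x2) :
    (forall e, x2 e = x1 e + n%:Z * H_weight v e) -> derivable_by_steps (framed_of h1) (framed_of h2).
  elim: n x2 h2 => [|n IH] x2 h2 x2E; first by apply: same => e; rewrite x2E mul0r addr0.
  pose x3 e := x1 e + n%:Z * H_weight v e.
  have h3 : framed_integral R x3 by exact: (framed_H (fun e => erefl) h1).
  apply: rst_trans (IH x3 h3 (fun e => erefl)) _.
  apply: rst_step; apply: Or43; apply: framed_of_move.
  exists id; first by split=> // [|[u s]]; [exists id|rewrite /map_edge /=; case: (og_next G _)].
  exists v => -[u s]; rewrite /map_edge /= x2E /x3 -addn1 PoszD /H_weight /=; ring.
case: k => n yE; first exact: nat_case yE.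
apply: rst_sym; apply: (nat_case n.+1) => e; rewrite yE NegzE; ring.
Qed.

End Framed.

Section Step.
Variables (a b c d e : 'I_5).
Hypothesis labels : uniq [:: a; b; c; d; e].
Hypothesis pair_ab : mp_pair a b.
Hypothesis pair_de : mp_pair d e.

Let neqs : [/\ [/\ a != b, a != c, a != d & a != e], [/\ b != c, b != d & b != e],
              c != d /\ c != e & d != e].
Proof.
move: labels => /= /and5P[]; rewrite !inE !negb_or.
by move=> /and4P[-> -> -> ->] /and3P[-> -> ->] /andP[-> ->] -> _.
Qed.

Let rest_ab (i : 'I_5) : ~~ removed a b i -> [\/ i = c, i = d | i = e].
Proof.
rewrite /removed !inE negb_or => /andP[/negbTE ia /negbTE ib].
by have := label_cases i labels; rewrite ia ib /= => /or3P[]/eqP ->; [constructor 1|constructor 2|constructor 3].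
Qed.

Let rest_de (i : 'I_5) : ~~ removed d e i -> [\/ i = a, i = b | i = c].
Proof.
rewrite /removed !inE negb_or => /andP[/negbTE id /negbTE ie].
by have := label_cases i labels; rewrite id ie !orbF => /or3P[]/eqP ->; [constructor 1|constructor 2|constructor 3].
Qed.

Let lt_neq (i j : 'I_5) : i != j -> (i < j)%N = ~~ (j < i)%N.
Proof. by rewrite -val_eqE /=; case: ltngtP. Qed.

Lemma pairs_not_below : ~~ ((a < d)%N && (b < d)%N).
Proof.
have [ab nlow nhigh] := pair_ab; have [de nlow' nhigh'] := pair_de.
have [[_ ac ad ae] [bc bd be] [cd ce] _] := neqs.
apply/negP => /andP[lad lbd]; case: (boolP ((a < c)%N && (b < c)%N)) => [/andP[lac lbc]|].
  apply: nlow => i /rest_ab[] ->; rewrite ?lac ?lbc ?lad ?lbd //.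
  by rewrite (ltn_trans lad de) (ltn_trans lbd de).
rewrite negb_and -!lt_neq 1?eq_sym // => h.
have lcd : (c < d)%N by case/orP: h => h; apply: ltn_trans h _.
apply: nhigh' => i /rest_de[] ->; rewrite ?lad ?lbd ?lcd ?(ltn_trans _ de) //.
Qed.

Lemma pairs_not_above : ~~ ((e < a)%N && (e < b)%N).
Proof.
have [ab nlow nhigh] := pair_ab; have [de nlow' nhigh'] := pair_de.
have [[_ ac ad ae] [bc bd be] [cd ce] _] := neqs.
apply/negP => /andP[lea leb]; case: (boolP ((c < a)%N && (c < b)%N)) => [/andP[lca lcb]|].
  apply: nhigh => i /rest_ab[] ->; rewrite ?lca ?lcb ?lea ?leb //.
  by rewrite (ltn_trans de lea) (ltn_trans de leb).
rewrite negb_and -!lt_neq // => h.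
have lec : (e < c)%N by case/orP: h; apply: ltn_trans.
apply: nlow' => i /rest_de[] ->; rewrite ?lea ?leb ?lec ?(ltn_trans de) //.
Qed.

Let f (l : 'I_5) : int := dot_chain (pos c d) (pos c e) (pos c l).

Let posne (i j : 'I_5) : i != c -> j != c -> (pos c i == pos c j) = (i == j).
Proof. by move=> ic jc; apply/eqP/eqP => [/pos_inj->|->]. Qed.

Lemma dot_chain_labels (k1 k2 m1 m2 : 'I_4) : uniq [:: k1; k2; m1; m2] ->
  sigma k1 k2 m2 * dot_chain (pos c d) (pos c e) m1 +
  sigma k1 k2 m1 * dot_chain (pos c d) (pos c e) m2 =
  dot_weight k1 k2 - ((k1 \in [:: pos c d; pos c e]) == (k2 \in [:: pos c d; pos c e]))%:Z.
Proof.
have [[ab ac ad ae] [bc bd be] [cd ce] de] := neqs; have [lde _ _] := pair_de.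
have un : uniq [:: pos c d; pos c e; pos c a; pos c b].
  rewrite /= !inE !negb_or !posne // 1?eq_sym // ?de ?ab ![d == _]eq_sym ![e == _]eq_sym.
  by rewrite de ad bd ae be.
have dc : d != c by rewrite eq_sym.
have ec : e != c by rewrite eq_sym.
have lt : (pos c d < pos c e)%N by rewrite pos_ltE.
have nb : ~~ ((pos c a < pos c d)%N && (pos c b < pos c d)%N).
  by rewrite !pos_ltE //; apply: pairs_not_below.
have na : ~~ ((pos c e < pos c a)%N && (pos c e < pos c b)%N).
  by rewrite !pos_ltE //; apply: pairs_not_above.
exact: (dot_chainP un lt nb na).
Qed.

Lemma dot_chain_coboundary (p q : 'I_5) : (p < q)%N ->
  full_coboundary (tet_chain c f) p q =
  (dot_in c p q)%:Z - ((p, q) == (a, b))%:Z - ((p, q) == (d, e))%:Z.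
Proof.
have [[ab ac ad ae] [bc bd be] [cd ce] de] := neqs => pq.
have [lab _ _] := pair_ab; have [lde _ _] := pair_de.
have [cpq|] := boolP ((c == p) || (c == q)).
  rewrite tet_coboundary_out // /dot_in ![_ == c]eq_sym !xpair_eqE.
  have ne i : (i == c) || (c == i) -> (i == a) || (i == b) || (i == d) || (i == e) = false.
    rewrite [c == i]eq_sym orbb => /eqP->.
    by rewrite (eq_sym c a) (eq_sym c b) (negbTE ac) (negbTE bc) (negbTE cd) (negbTE ce).
  have [cp|cq] := orP cpq; [have := ne p|have := ne q]; rewrite ?cp ?cq orbT => /(_ isT)/negbT;
  by rewrite !negb_or -!andbA => /and4P[/negbTE h1 /negbTE h2 /negbTE h3 /negbTE h4];
  rewrite ?h1 ?h2 ?h3 ?h4 ?andbF.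
rewrite negb_or => /andP[cp cq].
have pq' : p != q by rewrite -val_eqE ltn_eqF.
have [l1 [l2 un]] : exists l1 l2, uniq [:: c; p; q; l1; l2].
  have /eqP/cards2P[l1 [l2 [l12 E]]] : #|~: [set p; q; c]| = 2%N.
    rewrite cardsCs setCK card_ord setUC cardsU1 cards2 !inE negb_or cp cq pq'.
    by [].
  exists l1, l2; have m k : (k \in ~: [set p; q; c]) = (k \in [set l1; l2]) by rewrite E.
  have := m l1; have := m l2; rewrite !inE !eqxx orbT /= !negb_or -!andbA.
  move=> /and3P[n1 n2 n3] /and3P[n4 n5 n6].
  by rewrite !(eq_sym c l1) !(eq_sym c l2) !(eq_sym p l1) !(eq_sym p l2) !(eq_sym q l1) !(eq_sym q l2)
    cp cq pq' n1 n2 n3 n4 n5 n6 l12.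
have dc : d != c by rewrite eq_sym.
have ec : e != c by rewrite eq_sym.
rewrite (tet_coboundary_in _ un) /f.
have l1c : l1 != c by apply: contraTneq un => ->; rewrite /= !inE eqxx !orbT.
have l2c : l2 != c by apply: contraTneq un => ->; rewrite /= !inE eqxx !orbT.
have pc : p != c by rewrite eq_sym.
have qc : q != c by rewrite eq_sym.
rewrite (sigma_pos pc qc l1c) (sigma_pos pc qc l2c) dot_chain_labels ?uniq_pos //.
rewrite /dot_in pc qc /= -addrA -opprD; congr (_ - _).
rewrite !inE !posne // !xpair_eqE.
have := label_cases p labels; have := label_cases q labels.
rewrite (negbTE pc) (negbTE qc) /=.
have nba : (b < a)%N = false by rewrite ltnNge ltnW.
have ned : (e < d)%N = false by rewrite ltnNge ltnW.
have E := (negbTE ab, negbTE ad, negbTE ae, negbTE bd, negbTE be, negbTE de).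
have E' := (eq_sym b a, eq_sym d a, eq_sym e a, eq_sym d b, eq_sym e b, eq_sym e d).
by case/or4P=> /eqP qE; case/or4P=> /eqP pE; rewrite qE pE ?eqxx ?E' ?E //=;
  move: pq; rewrite qE pE ?ltnn ?nba ?ned.
Qed.

Lemma alternating_coboundary (k : int) (p q : 'I_5) : p != q ->
  full_coboundary (tet_chain d (fun l => k * (-1) ^+ odd (pos d l))) p q = 0.
Proof.
move=> pq'; have [cpq|] := boolP ((d == p) || (d == q)); first exact: tet_coboundary_out.
rewrite negb_or => /andP[cp cq].
have [l1 [l2 un]] : exists l1 l2, uniq [:: d; p; q; l1; l2].
  have /eqP/cards2P[l1 [l2 [l12 E]]] : #|~: [set p; q; d]| = 2%N.
    rewrite cardsCs setCK card_ord setUC cardsU1 cards2 !inE negb_or cp cq pq'.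
    by [].
  exists l1, l2; have m k0 : (k0 \in ~: [set p; q; d]) = (k0 \in [set l1; l2]) by rewrite E.
  have := m l1; have := m l2; rewrite !inE !eqxx orbT /= !negb_or -!andbA.
  move=> /and3P[n1 n2 n3] /and3P[n4 n5 n6].
  by rewrite !(eq_sym d l1) !(eq_sym d l2) !(eq_sym p l1) !(eq_sym p l2) !(eq_sym q l1) !(eq_sym q l2)
    cp cq pq' n1 n2 n3 n4 n5 n6 l12.
rewrite (tet_coboundary_in _ un).
have l1c : l1 != d by apply: contraTneq un => ->; rewrite /= !inE eqxx !orbT.
have l2c : l2 != d by apply: contraTneq un => ->; rewrite /= !inE eqxx !orbT.
have pc : p != d by rewrite eq_sym.
have qc : q != d by rewrite eq_sym.
rewrite (sigma_pos pc qc l1c) (sigma_pos pc qc l2c) !(mulrCA _ k) -mulrDr.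
by rewrite alternating_chainP ?uniq_pos // mulr0.
Qed.

Variables (w : bipyramid_weight) (h k : int).
Hypothesis Wadm : admissible a b w.

Let alt (l : 'I_5) : int := k * (-1) ^+ odd (pos d l).

(* Chosen so that the two moves together change the weights by a chain of D_c
   only: [tet_chain d alt] is the contribution of an H-move at D_d. *)
Definition step_weight : bipyramid_weight := fun S =>
  tet_chain c f S - (if S == (~: [set a; b])%SET then 0 else w S) - h * tet_chain d alt S.

Hypothesis w_de : w (~: [set d; e])%SET + h * alt e = 0.

Lemma step_weight_admissible : admissible d e step_weight.
Proof.
have [[ab ac ad ae] [bc bd be] [cd ce] de] := neqs.
have [lab _ _] := pair_ab; have [lde _ _] := pair_de.
have ED : (~: [set d; e] == ~: [set a; b]) = false.
  by rewrite eq_setC2 ![d == _]eq_sym (negbTE ad) (negbTE bd).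
apply/(admissibleP _ lde) => p q pq; have pq' : p != q by rewrite -val_eqE ltn_eqF.
rewrite (@bip_coboundary_full d e step_weight step_weight) //; last first.
  rewrite /step_weight ED tet_chain_other 1?eq_sym // tet_chain_self 1?eq_sym //.
  by rewrite sub0r -opprD w_de oppr0.
rewrite /step_weight !full_coboundaryB full_coboundaryZ alternating_coboundary // mulr0 subr0.
rewrite dot_chain_coboundary //.
rewrite -(@bip_coboundary_full a b _ w) ?eqxx //; last by move=> S /negbTE->.
have /(admissibleP _ lab)/(_ p q pq) := Wadm.
rewrite mulrnBl => ->.
have sum5 (F : 'I_5 -> nat) : (\sum_(i < 5) F i = F a + F b + F c + F d + F e)%N.
  rewrite (bigD1 a) //= (bigD1 b) //= 1?eq_sym // (bigD1 c) /=; last by rewrite ![c == _]eq_sym ac bc.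
  rewrite (bigD1 d) /=; last by rewrite !(eq_sym d) ad bd cd.
  rewrite (bigD1 e) /=; last by rewrite !(eq_sym e) ae be ce de.
  rewrite big1 ?addn0 ?addnA // => i /andP[/andP[/andP[/andP[ia ib] ic] id] ie].
  by have := label_cases i labels; rewrite (negbTE ia) (negbTE ib) (negbTE ic) (negbTE id) (negbTE ie).
have sumP (P : pred 'I_5) : (\sum_(i < 5 | P i) dot_in i p q =
    (if P a then dot_in a p q : nat else 0) + (if P b then dot_in b p q : nat else 0) +
    (if P c then dot_in c p q : nat else 0) + (if P d then dot_in d p q : nat else 0) +
    (if P e then dot_in e p q : nat else 0))%N by rewrite big_mkcond sum5.
rewrite /new_dots /removed_dots !sumP /removed !inE !eqxx.
rewrite ?(eq_sym b a) ?(eq_sym c a) ?(eq_sym c b) ?(eq_sym d a) ?(eq_sym d b) ?(eq_sym d c)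
  ?(eq_sym e a) ?(eq_sym e b) ?(eq_sym e c) ?(eq_sym e d).
rewrite (negbTE ab) (negbTE ac) (negbTE ad) (negbTE ae) (negbTE bc) (negbTE bd) (negbTE be).
rewrite (negbTE cd) (negbTE ce) (negbTE de) /=.
rewrite ?addn0 ?add0n !PoszD; ring.
Qed.

End Step.

Lemma perm_eq_four (T : eqType) (x y p q : T) :
  [/\ perm_eq [:: x; p; q; y] [:: x; y; p; q], perm_eq [:: x; q; p; y] [:: x; y; p; q],
      perm_eq [:: y; p; q; x] [:: x; y; p; q], perm_eq [:: y; q; p; x] [:: x; y; p; q]
    & perm_eq [:: p; q; y; x] [:: x; y; p; q]].
Proof. by split; apply/seq.permP => P /=; lia. Qed.

(** * Weights *)

Section StepWeights.
Variables (a b al be c d e : 'I_5) (eps : bool) (G G' : ograph) (D : mp_data a b eps G G').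
Hypothesis labels : uniq [:: a; b; c; d; e].
Hypothesis albe : (al = a /\ be = b) \/ (al = b /\ be = a).
Hypothesis pair_ab : mp_pair a b.
Hypothesis pair_de : mp_pair d e.
Let A := cut_face1 al c D.
Let B := cut_face2 be c D.
Hypothesis first : triangle A = triangle B -> ~~ inc A.

Variables (w : bipyramid_weight) (x : edge G -> int) (x' : edge G' -> int).
Hypothesis W : mp_weights D w x x'.

Let Y := mp_pillow D labels albe.
Let Told := mp_told D.
Let Tnew := mp_tnew D.
Let B0 : bistellar (removed a b) Told Tnew (mp_far_rel D) := mp_bistellar D.
Let k0 : int := if ~~ eps (+) odd d then 1 else -1.
Let alt (l : 'I_5) : int := k0 * (-1) ^+ odd (pos d l).
Let f (l : 'I_5) : int := dot_chain (pos c d) (pos c e) (pos c l).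
Let s : bool := eps (+) odd c.

Variable h : int.
Hypothesis w_de : w (~: [set d; e])%SET + h * alt e = 0.
Let w1 : bipyramid_weight := step_weight a b c d e w h k0.

Variable x2 : edge G' -> int.
Hypothesis x2E : forall e', x2 e' = x' e' + h * H_weight (Tnew d) e'.

Variable D' : mp_data d e (~~ eps) G' Y.
Hypothesis D'E : [/\ mp_told D' = Tnew, mp_tnew D' = pillow_tet D labels albe
                   & mp_far D' = pillow_far D labels albe].
Variable y : edge Y -> int.
Hypothesis W' : mp_weights D' w1 x2 y.

Let H_side_alt l : H_side (Tnew d) (Tnew d, pos d l) = alt l.
Proof.
have [_ _ _ nd _] := removed_ab_labels labels.
rewrite /H_side /= eqxx /inc /= mp_tnew_sign // /incoming /alt /k0.
by case: (~~ eps (+) odd d); case: (odd _).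
Qed.

Let H_side_other i k : ~~ removed a b i -> i != d -> H_side (Tnew d) (Tnew i, k) = 0.
Proof.
have [_ _ _ nd _] := removed_ab_labels labels.
move=> Si id; rewrite /H_side /=; case: eqP => // /(bs_inj' B0 Si nd) e'.
by rewrite e' eqxx in id.
Qed.

Lemma step_inner_weight : x2 (triangle (Tnew d, pos d e)) = 0.
Proof.
have [_ xin _] := W; have [_ _ _ nd ne] := removed_ab_labels labels.
have [_ _ _ de] := labels_neq labels; have ed : e != d by rewrite eq_sym.
rewrite x2E H_weight_sides (bs_glue' B0) // H_side_alt H_side_other // addr0.
by rewrite xin.
Qed.

Let w1E i j : w1 (~: [set i; j])%SET = tet_chain c f (~: [set i; j])%SET -
  (if ~: [set i; j] == (~: [set a; b])%SET then 0 else w (~: [set i; j])%SET)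
  - h * tet_chain d alt (~: [set i; j])%SET.
Proof. by []. Qed.

Let not_ab i j : ~~ removed a b i || ~~ removed a b j -> (~: [set i; j] == ~: [set a; b]) = false.
Proof.
rewrite eq_setC2 /removed !inE; case: (i == a); case: (j == b) => //=; case: (i == b) => //=;
by case: (j == a).
Qed.

Let ow2 : face G' -> int := outer_weight d e Tnew w1.

Let ow2_outer i j : removed d e i -> ~~ removed d e j -> ow2 (Tnew i, pos i j) = w1 (~: [set i; j])%SET.
Proof. by move=> Si Sj; have [E _ _] := D'E; rewrite /ow2 -E; apply: outer_weight_outer. Qed.

Let ow2_far t k : (forall i, removed d e i -> Tnew i <> t) -> ow2 (t, k) = 0.
Proof. by have [E _ _] := D'E; rewrite /ow2 -E; apply: outer_weight_far. Qed.

Let ow := outer_weight a b Told w.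

Let zeta (F : face G) : int :=
  (if F == A then w (~: [set al; c])%SET else 0) + (if F == B then w (~: [set be; c])%SET else 0).

Let zeta_cut i : removed a b i -> zeta (Told i, pos i c) = w (~: [set i; c])%SET.
Proof.
move=> Si; have AB : A != B := cut_faces_neq D labels albe.
have : i = al \/ i = be.
  by move: Si; rewrite /removed !inE; case: albe => -[-> ->] /orP[]/eqP; tauto.
case=> ->; rewrite /zeta -/A -/B ?eqxx ?(negbTE AB) ?addr0 //.
by rewrite eq_sym (negbTE AB) add0r.
Qed.

Let zeta_other F : F != A -> F != B -> zeta F = 0.
Proof. by rewrite /zeta => /negbTE-> /negbTE->; rewrite addr0. Qed.

Let side_sum F0 F1 : bs_corr (removed a b) Told Tnew (mp_far_rel D) F0 F1 ->
  ow F0 + h * H_side (Tnew d) F1 + ow2 F1 = zeta F0.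
Proof.
have [[_ ac ad ae] [bc bd be'] [cd ce] de] := labels_neq labels.
have [ra rb nc nd ne] := removed_ab_labels labels.
have [na2 nb2 nc2 rd2 re2] := removed_de_labels labels.
have [Sal Sbe] : removed a b al /\ removed a b be by case: albe => -[-> ->].
case=> [t t' k ft|i j Si Sj].
  have nT i : removed a b i -> Told i <> t by apply: (bs_far B0 ft).
  rewrite /ow outer_weight_far // ow2_far; last by move=> i; apply: (far_not_de labels ft).
  have -> : H_side (Tnew d) (t', k) = 0.
    by rewrite /H_side /=; case: eqP => // e'; case: (bs_far' B0 ft nd).
  rewrite zeta_other ?mulr0 ?addr0 //; apply/eqP => -[e' _].
    by case: (nT al Sal).
  by case: (nT be Sbe).
rewrite /ow outer_weight_outer //; have [nSi ic] := removed_ab_kept labels Si.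
have [jc|jc] := eqVneq j c.
  rewrite jc zeta_cut // H_side_other // ow2_far; last by move=> l; apply: (tet_c_not_de labels).
  by rewrite mulr0 !addr0.
have Sj2 : removed d e j.
  by have := @kept_de _ _ _ _ _ labels j; case: (removed d e j) => // /(_ isT); rewrite (negbTE jc) (negbTE Sj).
have ji : j != i by apply: contraNneq Sj => ->.
have Ne C k : removed a b k -> C = (Told k, pos k c) -> (Told i, pos i j) != C.
  by move=> Sk ->; rewrite (cut_face_neq D labels).
rewrite zeta_other ?(Ne A al) ?(Ne B be) // ow2_outer // w1E not_ab ?Sj //.
rewrite tet_chain_other ?jc ?ic // setUC.
have [jd|jd] := eqVneq j d.
  rewrite jd H_side_alt tet_chain_self; last by rewrite -jd eq_sym.
  by rewrite setUC; ring.
have id : i != d by apply: contraNneq nd => <-.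
rewrite H_side_other // tet_chain_other //.
by rewrite mulr0 subr0 addr0 sub0r setUC subrr.
Qed.

Lemma pillow_weight_seen F0 F1 : bs_corr (removed a b) Told Tnew (mp_far_rel D) F0 F1 ->
  y (triangle (pillow_seen al be c D F0 : face Y)) = x (triangle F0) + zeta F0 + zeta (mate F0).
Proof.
move=> FF; have [_ _ xout] := W; have [_ _ yout] := W'.
have FFm := bs_outer B0 FF.
have := yout F1 (pillow_seen al be c D F0); have := D'E => -[-> -> ->] /(_ (pillow_seen_corr labels albe FF)) ->.
rewrite -!/(ow2 _) x2E H_weight_sides.
have /mp_corrP/xout -> := FF.
rewrite -!/(ow _) -(side_sum FF) -(side_sum FFm) /ow2 /ow; ring.
Qed.

Let y_in i j : ~~ removed d e i -> ~~ removed d e j -> i != j ->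
  y (triangle ((pillow_tet D labels albe i, pos i j) : face Y)) = w1 (~: [set i; j])%SET.
Proof. by have [_ h' _] := W'; have := D'E => -[_ <- _]; apply: h'. Qed.

Lemma pillow_weight_cut i : removed a b i ->
  y (triangle ((inl (Told i), pos i c) : face Y)) = f i - w (~: [set i; c])%SET.
Proof.
move=> Si; have [nSi ic] := removed_ab_kept labels Si.
have [_ _ nc _ _] := removed_ab_labels labels; have [_ _ nc2 _ _] := removed_de_labels labels.
have [_ _ [cd _] _] := labels_neq labels.
have -> : (inl (Told i) : Y) = pillow_tet D labels albe i by rewrite /pillow_tet ic.
rewrite y_in ?ic // w1E not_ab ?nc ?orbT // setUC tet_chain_self ?ic // tet_chain_other //.
  by rewrite mulr0 subr0.
by apply: contraNneq nSi => ->; rewrite /removed mem_head.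
Qed.

Lemma pillow_weight_inner i x0 : removed d e i -> y (triangle ((inr x0, pos c i) : face Y)) = f i.
Proof.
move=> Si; have [nSi ic] := removed_de_kept labels Si.
have [_ _ nc nd _] := removed_ab_labels labels; have [_ _ nc2 _ _] := removed_de_labels labels.
have [_ _ [cd _] _] := labels_neq labels.
suff H : y (triangle ((inr s, pos c i) : face Y)) = f i.
  have [->//|xs] := eqVneq x0 s; rewrite -H -triangle_mate (mate_inner_face D labels albe) //.
  by have -> : ~~ x0 = s by move: xs; case: x0; case: s.
have [_ xin _] := W; have [_ _ yout] := W'.
have := yout (Tnew i, pos i c) (inr s, pos c i); have := D'E => -[-> -> ->].
have -> : (inr s : Y) = pillow_tet D labels albe c by rewrite /pillow_tet eqxx.
move=> -> //; last by apply: OuterFace.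
rewrite -!/(ow2 _) x2E H_weight_sides xin // ow2_outer // (bs_glue' B0) //.
rewrite [ow2 (Tnew c, _)]ow2_far; last by move=> l; apply: (tet_c_not_de labels).
rewrite [H_side _ (Tnew c, _)]H_side_other // w1E not_ab ?nSi //.
rewrite setUC tet_chain_self // setUC.
have [->|id] := eqVneq i d.
  by rewrite H_side_alt tet_chain_self //; ring.
by rewrite H_side_other // tet_chain_other //; ring.
Qed.

Lemma pillow_weight_ab i j : removed a b i -> removed a b j -> i != j ->
  y (triangle ((inl (Told i), pos i j) : face Y)) = 0.
Proof.
move=> Si Sj ij; have [nSi ic] := removed_ab_kept labels Si; have [nSj jc] := removed_ab_kept labels Sj.
have nd k : ~~ removed d e k -> k != d by apply: contraNneq => ->; rewrite /removed mem_head.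
have -> : (inl (Told i) : Y) = pillow_tet D labels albe i by rewrite /pillow_tet ic.
rewrite y_in // w1E -removedE // Si Sj !tet_chain_other ?ic ?jc ?nd //.
by rewrite mulr0 !subr0.
Qed.

Let triangle_old (F : face G) : ~~ inc F ->
  triangle ((inl F.1, F.2) : face Y) = map_edge (inl : G -> Y) (triangle F).
Proof.
by move=> oF; rewrite /triangle [incoming (og_sign F.1) _](negbTE oF).
Qed.

Let pout_triangle (k : 'I_4) :
  pillow_out (inr : bool -> Y) k = triangle ((inr (odd k), k) : face Y).
Proof.
rewrite /triangle [incoming _ _](_ : inc ((inr (odd k), k) : face Y) = false) //.
by rewrite /inc /= /incoming addbb.
Qed.

Let corr_cut i : removed a b i ->
  bs_corr (removed a b) Told Tnew (mp_far_rel D) (Told i, pos i c) (Tnew c, pos c i).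
Proof. by have [_ _ nc _ _] := removed_ab_labels labels => Si; apply: BsOuter. Qed.

Let y_pillow i : removed a b i ->
  y (triangle ((inr s, pos c i) : face Y)) = f i - w (~: [set i; c])%SET /\
  y (triangle ((inr (~~ s), pos c i) : face Y)) =
    x (triangle (Told i, pos i c)) + w (~: [set i; c])%SET + zeta (mate (Told i, pos i c)).
Proof.
move=> Si; split.
  by rewrite -(mate_cut_face D labels albe Si) triangle_mate pillow_weight_cut.
by rewrite -(pillow_seen_cut D labels albe Si) (pillow_weight_seen (corr_cut Si)) zeta_cut.
Qed.

Let y_mate_old (F : face G) i : removed a b i -> F = (Told i, pos i c) -> mate F != A -> mate F != B ->
  y (triangle ((inl (mate F).1, (mate F).2) : face Y)) = x (triangle F) + w (~: [set i; c])%SET.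
Proof.
move=> Si FE mA mB; have := pillow_weight_seen (bs_outer B0 (corr_cut Si)); rewrite -FE.
rewrite [pillow_seen _ _ _ _ _](pillow_tau_inl _ _ _ mA mB) => ->.
by rewrite mateK triangle_mate (zeta_other mA mB) addr0 FE zeta_cut.
Qed.

Let y_old (e0 : edge G) : e0 <> triangle A -> e0 <> triangle B ->
  y (map_edge (inl : G -> Y) e0) = x e0.
Proof.
move=> eA eB; rewrite -[e0]triangle_out; set F := out_side e0.
have oF : ~~ inc F by rewrite inc_out.
rewrite -(triangle_old oF).
have FA : triangle F <> triangle A by rewrite triangle_out.
have FB : triangle F <> triangle B by rewrite triangle_out.
have [[i [j [Si Sj ij FE]]]|[F1 FF]] := bs_faceP B0 F.
  have [x0 _ _] := W; rewrite FE pillow_weight_ab //.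
  move: Si Sj ij; rewrite /removed !inE => /orP[]/eqP-> /orP[]/eqP->; rewrite ?eqxx //= => _.
  have [ra rb _ _ _] := removed_ab_labels labels; have [[ab _ _ _] _ _ _] := labels_neq labels.
  by rewrite -triangle_mate (bs_glue B0) // eq_sym.
have ne C : triangle F <> triangle C -> F != C by move=> h'; apply: contra_notN h' => /eqP->.
have nem C : triangle F <> triangle C -> mate F != C.
  by move=> h'; apply: contra_notN h' => /eqP <-; rewrite triangle_mate.
have := pillow_weight_seen FF; rewrite [pillow_seen _ _ _ _ _](pillow_tau_inl _ _ _ (ne _ FA) (ne _ FB)) => ->.
by rewrite !zeta_other ?ne ?nem // !addr0.
Qed.

Lemma step_sliding : (forall c' : corner Y, (c'.2.1 < c'.2.2)%N -> euler_at y c') ->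
  integral_sliding x y.
Proof.
move=> eu; have [[ab ac ad ae] [bc bd be'] [cd ce] de] := labels_neq labels.
have [_ _ _ rd2 re2] := removed_de_labels labels; have [lde _ _] := pair_de.
have [ra rb nc nd ne] := removed_ab_labels labels.
have [Sal Sbe] : removed a b al /\ removed a b be by case: albe => -[-> ->].
have alc : al != c by case: albe => -[-> _].
have bec : be != c by case: albe => -[_ ->].
have dc : d != c by rewrite eq_sym.
have ec : e != c by rewrite eq_sym.
set x0 := pos c d; set y0 := pos c e; set q := pos c al; set p := pos c be.
have un : uniq [:: x0; y0; p; q].
  have : uniq [:: c; d; e; be; al].
    rewrite /= !inE !negb_or cd ce de eq_sym bec eq_sym alc !andbT /=.
    case: albe => -[-> ->]; rewrite !(eq_sym d) !(eq_sym e) ad ae bd be' ?ab //=.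
    by rewrite eq_sym ab.
  exact: uniq_pos.
have lt : (x0 < y0)%N by rewrite pos_ltE.
have nb : ~~ ((p < x0)%N && (q < x0)%N).
  rewrite !pos_ltE //; have := pairs_not_below labels pair_ab pair_de.
  by case: albe => -[-> ->]; rewrite // andbC.
have na : ~~ ((y0 < p)%N && (y0 < q)%N).
  rewrite !pos_ltE //; have := pairs_not_above labels pair_ab pair_de.
  by case: albe => -[-> ->]; rewrite // andbC.
have se : same_edge (face_side A (pos q p)) (face_side B (pos p q)).
  have side i j : removed a b i -> removed a b j -> i != j -> i != c -> j != c ->
      face_side (Told i, pos i c) (pos (pos c i) (pos c j)) = (Told i, (pos i d, pos i e)).
    move=> Si Sj ij ic jc; rewrite face_sideE.
    have di : d != i by apply: contraNneq nd => ->.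
    have ei : e != i by apply: contraNneq ne => ->.
    have [m m0 m1] := sideP ic lde di dc ei ec.
    suff -> : pos (pos c i) (pos c j) = m by rewrite m0 m1.
    have third : lift i (lift (pos i c) m) = j.
      set r := lift i (lift (pos i c) m).
      have ri : r != i by rewrite eq_sym neq_lift.
      have rc : r != c by rewrite /r lift_lift_pos // eq_sym neq_lift.
      have rd : r != d by rewrite -m0 /side0 !(inj_eq lift_inj) neq_lift.
      have re : r != e by rewrite -m1 /side1 !(inj_eq lift_inj) neq_lift.
      have := label_cases r labels; rewrite (negbTE rc) (negbTE rd) (negbTE re) !orbF.
      move: Si Sj ij ri; rewrite /removed !inE => /orP[]/eqP-> /orP[]/eqP->; rewrite ?eqxx //= => _ /negbTE->.
        by move/eqP.
      by rewrite orbF => /eqP.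
    have ci : c != i by rewrite eq_sym.
    by rewrite -third lift_lift_pos // !pos_lift.
  have albe' : al != be.
    by case: albe => -[-> ->]; rewrite // eq_sym.
  rewrite /A /B /cut_face1 /cut_face2 side // side // 1?eq_sym //.
  have nS i : removed a b i -> (d != i) && (e != i).
    by move=> Si; apply/andP; split; [apply: contraNneq nd => ->|apply: contraNneq ne => ->].
  have /andP[? ?] := nS _ Sal; have /andP[? ?] := nS _ Sbe.
  by apply: (same_edge_new (bistellar_sym B0)); rewrite //= negbK.
have [Ds [E1 E2 E3 E4]] := pillow_sliding (cut_faces_neq D labels albe) (cut_pos_neq labels albe)
  (cut_face1_inc D labels albe) (cut_face2_inc D labels albe) first un lt nb na se.
have [yq1 yq2] := y_pillow Sal; have [yp1 yp2] := y_pillow Sbe.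
have oddq : odd q = inc A (+) ~~ s.
  by rewrite (cut_face1_inc D labels albe) /incoming -/q -/s; case: (s); case: (odd q).
have oddp : odd p = inc B (+) ~~ s.
  by rewrite (cut_face2_inc D labels albe) /incoming -/p -/s; case: (s); case: (odd p).
have mAB : mate A = B <-> triangle A = triangle B.
  split=> [<-|e']; first by rewrite triangle_mate.
  case: (triangle_eq e') => [e''|->]; last by rewrite mateK.
  by case/eqP: (cut_faces_neq D labels albe).
have mBA : mate B = A -> triangle A = triangle B by move<-; rewrite triangle_mate.
have wq := zeta_cut Sal; have wp := zeta_cut Sbe.
pose g := dot_chain x0 y0.
have eq1 (k1 k2 m1 m2 : 'I_4) : uniq [:: k1; k2; m1; m2] -> sigma k1 k2 m2 * g m1 + sigma k1 k2 m1 * g m2 =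
  dot_weight k1 k2 - ((k1 \in [:: x0; y0]) == (k2 \in [:: x0; y0]))%:Z.
  exact: (dot_chain_labels labels pair_ab pair_de).
pose wA := w (~: [set al; c])%SET; pose wB := w (~: [set be; c])%SET.
pose e1 := triangle A; pose e2 := triangle B.
pose vq := y (pillow_out (inr : bool -> Y) q); pose vp := y (pillow_out (inr : bool -> Y) p).
pose v1 := y (map_edge (inl : G -> Y) e1); pose v2 := y (map_edge (inl : G -> Y) e2).
have vz (k : 'I_4) i : k = pos c i -> removed d e i -> y (pillow_out (inr : bool -> Y) k) = g k.
  by move=> -> Si; rewrite pout_triangle pillow_weight_inner.
have ypout (k : 'I_4) : y (pillow_out (inr : bool -> Y) k) = y (triangle ((inr (odd k), k) : face Y)).
  by rewrite pout_triangle.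
have split_ne : e1 <> e2 -> v1 + vq = x e1 + g q /\ v2 + vp = x e2 + g p.
  move=> e12; have nAB : mate A != B by apply/eqP => /mAB.
  have nBA : mate B != A by apply/eqP => /mBA.
  split.
    rewrite /v1 /vq ypout oddq; case iA: (inc A) => /=.
      have o : ~~ inc (mate A) by rewrite inc_mate iA.
      rewrite negbK yq1 /e1 -triangle_mate -triangle_old //.
      by rewrite (y_mate_old Sal) ?mate_neq // triangle_mate addrC addrA [_ - _ + _]addrAC subrK addrC.
    rewrite yq2 zeta_other ?mate_neq // addr0 -triangle_old ?iA // pillow_weight_cut //.
    by rewrite addrC addrA [X in X - _]addrAC addrK.
  rewrite /v2 /vp ypout oddp; case iB: (inc B) => /=.
    have o : ~~ inc (mate B) by rewrite inc_mate iB.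
    rewrite negbK yp1 /e2 -triangle_mate -triangle_old //.
    by rewrite (y_mate_old Sbe) ?mate_neq // triangle_mate addrC addrA [_ - _ + _]addrAC subrK addrC.
  rewrite yp2 zeta_other ?mate_neq // addr0 -triangle_old ?iB // pillow_weight_cut //.
  by rewrite addrC addrA [X in X - _]addrAC addrK.
have split_eq : e1 = e2 -> [/\ v1 = g q - wA, vq = x e1 + wA + wB & vp = g p - wB].
  move=> e12; have iA : inc A = false by apply/negbTE/first.
  have mA : mate A = B by apply/mAB.
  have iB : inc B by rewrite -mA inc_mate iA.
  split.
  - by rewrite /v1 -triangle_old ?iA // pillow_weight_cut.
  - by rewrite /vq ypout oddq iA /= yq2 -[(Told al, _)]/A mA wp.
  by rewrite /vp ypout oddp iB /= negbK yp1.
have sums : exists u1 u2 y1 y1' y2 y2' : int,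
  [/\ if e1 == e2 then u1 + u2 = x e1 else u1 = x e1 /\ u2 = x e2,
      if e1 == e2 then [/\ v1 = y1, vq = y1' + y2 & vp = y2']
      else [/\ v1 = y1, vq = y1', v2 = y2 & vp = y2'],
      y1 + y1' = u1 + g q & y2 + y2' = u2 + g p].
  have [e12|/eqP e12] := eqVneq e1 e2.
    have [h1 h2 h3] := split_eq e12.
    exists (x e1), 0, (g q - wA), (x e1 + wA), wB, (g p - wB); split; rewrite ?addr0 ?h2 //; ring.
  have [h1 h2] := split_ne e12.
  by exists (x e1), (x e2), v1, vq, v2, vp; split.
have [u1 [u2 [y1 [y1' [y2 [y2' [h1 h2 h3 h4]]]]]]] := sums.
have uq (k1 k2 m1 m2 : 'I_4) : perm_eq [:: k1; k2; m1; m2] [:: x0; y0; p; q] ->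
    uniq [:: k1; k2; m1; m2] by move/perm_uniq => ->.
have [pm1 pm2 pm3 pm4 pm5] := perm_eq_four x0 y0 p q.
have px0 : (p \in [:: x0; y0]) = false.
  move: un; rewrite /= !inE !negb_or => /and4P[/and3P[_ h5 _] /andP[h6 _] _ _].
  by rewrite !(eq_sym p) (negbTE h5) (negbTE h6).
have qx0 : (q \in [:: x0; y0]) = false.
  move: un; rewrite /= !inE !negb_or => /and4P[/and3P[_ _ h5] /andP[_ h6] _ _].
  by rewrite !(eq_sym q) (negbTE h5) (negbTE h6).
have x0in : x0 \in [:: x0; y0] by rewrite inE eqxx.
have y0in : y0 \in [:: x0; y0] by rewrite !inE eqxx orbT.
have E5 : sigma x0 p y0 * g q + sigma x0 p q * g y0 = dot_weight x0 p.
  rewrite (eq1 x0 p q y0) ?x0in ?px0 ?subr0 //; exact: uq.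
have E6 : sigma x0 q y0 * g p + sigma x0 q p * g y0 = dot_weight x0 q.
  rewrite (eq1 x0 q p y0) ?x0in ?qx0 ?subr0 //; exact: uq.
have E7 : sigma y0 p x0 * g q + sigma y0 p q * g x0 = dot_weight y0 p.
  rewrite (eq1 y0 p q x0) ?y0in ?px0 ?subr0 //; exact: uq.
have E8 : sigma y0 q x0 * g p + sigma y0 q p * g x0 = dot_weight y0 q.
  rewrite (eq1 y0 q p x0) ?y0in ?qx0 ?subr0 //; exact: uq.
have E9 : sigma p q x0 * g y0 + sigma p q y0 * g x0 = -1 + dot_weight p q.
  rewrite (eq1 p q y0 x0) ?px0 ?qx0 1?addrC //; exact: uq.
exists x0, y0, p, q, Ds, u1, u2, y1, y1', y2, y2', (g y0), (g x0).
rewrite /= E1 E2 E3 E4; split.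
- exact: h1.
- split; [exact: y_old|exact: (vz y0 e)|exact: (vz x0 d)|exact: h2].
- rewrite h3 h4 -E5 -E6 -E7 -E8; split; ring.
- exact: E9.
by move=> s0; apply: eu.
Qed.

End StepWeights.

Definition derivable_mp (R : realType) (a b : 'I_5) (eps : bool) : Prop :=
  forall (G G' : ograph) (D : mp_data a b eps G G') w (x : edge G -> int) (x' : edge G' -> int)
    (hx : framed_integral R x) (hx' : framed_integral R x'),
  admissible a b w -> mp_weights D w x x' -> derivable_by_steps (framed_of hx) (framed_of hx').

Lemma mp_framed (R : realType) a b eps (G G' : ograph) (D : mp_data a b eps G G') w x x' :
  mp_pair a b -> admissible a b w -> mp_weights D w x x' ->
  framed_integral R x -> framed_integral R x'.
Proof.
move=> ab wa W [cl eu]; have [lab _ _] := ab; split; first exact: mp_closed ab _ _ _ D cl.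
exact: mp_euler lab wa W eu.
Qed.

(* The pillow is inserted between the faces D_a D_c and D_b D_c around the edge
   de; the weights x2 differ from x' by an H-move that makes x2 vanish on the
   triangle abc, as the move of type (d, e) requires. *)
Lemma derivable_mp_step (R : realType) (a b c d e : 'I_5) eps : uniq [:: a; b; c; d; e] ->
  mp_pair a b -> mp_pair d e -> derivable_mp R d e (~~ eps) -> derivable_mp R a b eps.
Proof.
move=> labels pab pde IH G G' D w x x' hx hx' wa W.
have [al [be [albe first]]] : exists al be, ((al = a /\ be = b) \/ (al = b /\ be = a)) /\
    (triangle (cut_face1 al c D) = triangle (cut_face2 be c D) -> ~~ inc (cut_face1 al c D)).
  have [iA|nA] := boolP (inc (cut_face1 a c D)); last by exists a, b; split; [left|].
  exists b, a; split; first by right.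
  have h : (b = a /\ a = b) \/ (b = b /\ a = a) by right.
  case/triangle_eq => [e'|->]; first by case/eqP: (cut_faces_neq D labels h).
  by rewrite inc_mate iA.
have [D' D'E] := pillow_mp D labels albe.
pose k0 : int := if ~~ eps (+) odd d then 1 else -1.
pose alt (l : 'I_5) : int := k0 * (-1) ^+ odd (pos d l).
pose h : int := - (w (~: [set d; e])%SET * alt e).
have w_de : w (~: [set d; e])%SET + h * alt e = 0.
  have : alt e * alt e = 1 by rewrite /alt /k0; case: (_ (+) _); case: (odd _).
  by move=> a1; rewrite /h mulNr -[_ * alt e * alt e]mulrA a1 mulr1 subrr.
pose v := mp_tnew D d.
pose x2 e' := x' e' + h * H_weight v e'.
have hx2 : framed_integral R x2 by exact: (framed_H (fun=> erefl) hx').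
have x20 : x2 (triangle (mp_told D' d, pos d e)) = 0.
  have [-> _ _] := D'E; exact: (step_inner_weight labels W w_de).
have [y Wy] := mp_weights_ex (D := D') (step_weight a b c d e w h k0) x20.
have adm := step_weight_admissible labels pab pde wa w_de.
have hy : framed_integral R y := mp_framed pde adm Wy hx2.
apply: rst_trans (rst_trans _ _ _ _ _ (rst_sym _ _ _ _ (IH _ _ D' _ _ _ hx2 hy adm Wy)) _).
  apply: rst_step; apply: Or42; apply: framed_of_move.
  apply: (step_sliding pab pde first W (fun=> erefl) D'E Wy).
  by case: hy.
by apply: rst_sym; apply: (derivable_H hx' hx2 (v := v) (k := h)).
Qed.

(** * The sixteen types *)

Section Primary.
Let o (n : nat) : 'I_5 := inord n.

Let oE n : (n < 5)%N -> o n = n :> nat. Proof. exact: inordK. Qed.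

Let o_eq n m : (n < 5)%N -> (m < 5)%N -> (o n == o m) = (n == m).
Proof. by move=> n5 m5; rewrite -val_eqE /= !oE. Qed.

Lemma labels_ord (s : seq nat) : all (fun n => n < 5)%N s -> uniq (map o s) = uniq s.
Proof.
move=> s5; rewrite map_inj_in_uniq // => n m /(allP s5) n5 /(allP s5) m5 /eqP.
by rewrite o_eq // => /eqP.
Qed.

Lemma mp_pair_ord n m : (n < m < 5)%N -> (n, m) != (0, 1)%N -> (n, m) != (3, 4)%N ->
  mp_pair (o n) (o m).
Proof.
move=> /andP[nm m5] n01 n34; have n5 := ltn_trans nm m5.
split=> [|h|h]; first by rewrite !oE.
  have [n0|n0] := posnP n.
    have := h (o 1); rewrite /removed !inE !o_eq // !oE // n0 in n01 *.
    by case: (m) n01 nm => [|[|k]] //= _ _ /(_ isT).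
  by have := h (o 0); rewrite /removed !inE !o_eq // !oE //; case: (n) n0 nm => [//|k] _; case: (m) => [//|l] _ /(_ isT).
have [m4|m4] := eqVneq m 4%N.
  have := h (o 3); rewrite /removed !inE !o_eq // !oE // m4.
  by rewrite m4 in n34 nm; case: (n) n34 nm => [|[|[|[|k]]]] //= _ _ /(_ isT).
have := h (o 4); rewrite /removed !inE !o_eq // !oE //.
have -> : (4 == m)%N = false by rewrite eq_sym (negbTE m4).
have -> : (4 == n)%N = false by apply/negbTE; rewrite neq_ltn; lia.
by move=> /(_ isT) /andP[]; lia.
Qed.

Lemma full_coboundary3 (u : bipyramid_weight) (p q r1 r2 r3 : 'I_5) :
  uniq [:: p; q; r1; r2; r3] -> full_coboundary u p q =
  sigma p q r1 * u (~: [set r2; r3])%SET + sigma p q r2 * u (~: [set r1; r3])%SET +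
  sigma p q r3 * u (~: [set r1; r2])%SET.
Proof.
move=> un; have lab r := label_cases r un.
have E1 : [set p; q; r1] = ~: [set r2; r3] by apply: compl3; rewrite (perm_uniq (s2 := [:: p; q; r1; r2; r3])) //; apply/seq.permP => P /=; lia.
have E2 : [set p; q; r2] = ~: [set r1; r3] by apply: compl3; rewrite (perm_uniq (s2 := [:: p; q; r1; r2; r3])) //; apply/seq.permP => P /=; lia.
have E3 : [set p; q; r3] = ~: [set r1; r2] by apply: compl3; rewrite (perm_uniq (s2 := [:: p; q; r1; r2; r3])) //; apply/seq.permP => P /=; lia.
move: un => /= /and5P[]; rewrite !inE !negb_or.
move=> /and4P[pq p1 p2 p3] /and3P[q1 q2 q3] /andP[r12 r13] r23 _.
rewrite /full_coboundary (bigD1 r1) /=; last by rewrite !inE negb_or !(eq_sym r1) p1 q1.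
rewrite (bigD1 r2) /=; last by rewrite !inE negb_or !(eq_sym r2) p2 q2 r12.
rewrite (bigD1 r3) /=; last by rewrite !inE negb_or !(eq_sym r3) p3 q3 r13 r23.
rewrite big1 ?addr0 ?E1 ?E2 ?E3 ?addrA // => r.
rewrite !inE negb_or -!andbA => /and5P[rp rq n1 n2 n3].
by have := lab r; rewrite (negbTE rp) (negbTE rq) (negbTE n1) (negbTE n2) (negbTE n3).
Qed.

Let dot_inE n p q : (n < 5)%N -> (p < 5)%N -> (q < 5)%N -> dot_in (o n) (o p) (o q) =
  [&& p != n, q != n & dotted (p - (n < p)) (q - (n < q))].
Proof.
move=> n5 p5 q5; rewrite /dot_in !o_eq //; case: eqVneq => //= pn; case: eqVneq => //= qn.
by rewrite !val_pos ?o_eq // !oE.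
Qed.

Lemma primary_admissible : admissible (o 1) (o 3) (fun=> 0).
Proof.
have sum5 (F : 'I_5 -> nat) : (\sum_(i < 5) F i = F (o 0) + F (o 1) + F (o 2) + F (o 3) + F (o 4))%N.
  have ordE k (k5 : (k < 5)%N) (i : 'I_5) : i = k :> nat -> F i = F (o k).
    by move=> ik; congr F; apply: val_inj; rewrite /= oE.
  rewrite !big_ord_recl big_ord0 addn0 !addnA.
  by congr (_ + _ + _ + _ + _)%N; apply: ordE.
have sumP (P : pred 'I_5) p q : (\sum_(i < 5 | P i) dot_in i p q =
    (if P (o 0) then dot_in (o 0) p q : nat else 0) + (if P (o 1) then dot_in (o 1) p q : nat else 0) +
    (if P (o 2) then dot_in (o 2) p q : nat else 0) + (if P (o 3) then dot_in (o 3) p q : nat else 0) +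
    (if P (o 4) then dot_in (o 4) p q : nat else 0))%N by rewrite big_mkcond sum5.
apply/admissibleP; first by rewrite !oE.
move=> p q; rewrite -[p](inord_val p) -[q](inord_val q) -/(o p) -/(o q) !oE // => pq.
have -> : bipyramid_coboundary (o 1) (o 3) (fun=> 0) (o p) (o q) = 0.
  by apply: big1 => r _; rewrite mulr0.
rewrite /new_dots /removed_dots !sumP /removed !inE !o_eq // !dot_inE //= xpair_eqE !o_eq //.
by case: p q pq => [[|[|[|[|[|//]]]]] ip] [[|[|[|[|[|//]]]]] iq].
Qed.
Section Cycle.
Variable w : bipyramid_weight.
Hypothesis wa : admissible (o 1) (o 3) w.
Let U (i j : nat) : int :=
  if (~: [set o i; o j] == ~: [set o 1; o 3])%SET then 0 else w (~: [set o i; o j])%SET.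

Let UC i j : U i j = U j i. Proof. by rewrite /U setUC. Qed.

Let rel (p q r1 r2 r3 : nat) : all (fun n => n < 5)%N [:: p; q; r1; r2; r3] ->
  uniq [:: p; q; r1; r2; r3] -> (p < q)%N ->
  sigma p q r1 * U r2 r3 + sigma p q r2 * U r1 r3 + sigma p q r3 * U r1 r2 = 0.
Proof.
move=> s5 un pq; have un5 : uniq (map o [:: p; q; r1; r2; r3]) by rewrite labels_ord.
have /and5P[p5 q5 r15 r25 /andP[r35 _]] := s5.
have lt : (o p < o q)%N by rewrite !oE.
have l13 : (o 1 < o 3)%N by rewrite !oE.
pose u S := if S == (~: [set o 1; o 3])%SET then 0 else w S.
have := full_coboundary3 u un5; rewrite !oE // => <-.
rewrite -(@bip_coboundary_full (o 1) (o 3) u w) /u ?eqxx //; last by move=> S /negbTE->.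
have /(admissibleP _ l13)/(_ _ _ lt) := wa.
have /(admissibleP _ l13)/(_ _ _ lt) <- := primary_admissible.
rewrite [X in _ = X *+ 2](_ : _ = 0); last by apply: big1 => r _; rewrite mulr0.
by rewrite mul0rn => /eqP; rewrite mulrn_eq0 /= => /eqP.
Qed.

Let K (i : nat) : int := if i == 0%N then U 0 1 else if i == 2%N then - U 1 2
  else if i == 4%N then - U 1 4 else 0.

Let alt_pos i j : (i < 5)%N -> (j < 5)%N -> i != j ->
  (-1) ^+ odd (pos (o i) (o j)) = (-1) ^+ odd (j - (i < j)) :> int.
Proof. by move=> i5 j5 ij; rewrite val_pos ?o_eq 1?eq_sym // !oE. Qed.

Let U_cycle i j : (i < 5)%N -> (j < 5)%N -> i != j ->
  U i j = K i * (-1) ^+ odd (pos (o i) (o j)) + K j * (-1) ^+ odd (pos (o j) (o i)).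
Proof.
move=> i5 j5 ij; rewrite !alt_pos // 1?eq_sym //.
have U13 : U 1 3 = 0 by rewrite /U eqxx.
have e1 := @rel 0 4 1 2 3 isT isT isT; have e2 := @rel 2 4 0 1 3 isT isT isT.
have e3 := @rel 0 2 1 3 4 isT isT isT; have e4 := @rel 3 4 0 1 2 isT isT isT.
have e5 := @rel 2 3 0 1 4 isT isT isT; have e6 := @rel 0 3 1 2 4 isT isT isT.
rewrite /sigma /= in e1 e2 e3 e4 e5 e6.
have U02 : U 0 2 = - U 0 1 - U 1 2 by lia.
have U03 : U 0 3 = U 0 1 by lia.
have U04 : U 0 4 = - U 0 1 - U 1 4 by lia.
have U23 : U 2 3 = - U 1 2 by lia.
have U24 : U 2 4 = U 1 2 - U 1 4 by lia.
have U34 : U 3 4 = U 1 4 by lia.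
have flip := (UC 1 0, UC 2 0, UC 3 0, UC 4 0, UC 2 1, UC 3 1, UC 4 1, UC 3 2, UC 4 2, UC 4 3).
move: i j i5 j5 ij => [|[|[|[|[|//]]]]] [|[|[|[|[|//]]]]] // _ _ _;
by rewrite /K /= ?flip ?U02 ?U03 ?U04 ?U13 ?U23 ?U24 ?U34 ?subn0 /=; ring.
Qed.

Variables (G G' : ograph) (D : mp_data (o 1) (o 3) false G G').
Variables (x : edge G -> int) (y x' : edge G' -> int).
Hypothesis Wy : mp_weights D (fun=> 0) x y.
Hypothesis Wx : mp_weights D w x x'.
Let T := mp_told D.
Let T' := mp_tnew D.
Let B : bistellar (removed (o 1) (o 3)) T T' (mp_far_rel D) := mp_bistellar D.

Let sideK (F : face G') : int :=
  K 0 * H_side (T' (o 0)) F + K 2 * H_side (T' (o 2)) F + K 4 * H_side (T' (o 4)) F.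

Let remE i : (i < 5)%N -> removed (o 1) (o 3) (o i) = (i == 1%N) || (i == 3%N).
Proof. by move=> i5; rewrite /removed !inE !o_eq. Qed.

Let sideK_new i k : (i < 5)%N -> ~~ removed (o 1) (o 3) (o i) ->
  sideK (T' (o i), k) = K i * (-1) ^+ odd k.
Proof.
move=> i5 Si; have H m : (m < 5)%N -> ~~ removed (o 1) (o 3) (o m) ->
    H_side (T' (o m)) (T' (o i), k) = if i == m then (-1) ^+ odd k else 0.
  move=> m5 Sm; rewrite /H_side /= -(@o_eq i m) //.
  have [->|ne] := eqVneq (o i) (o m); last first.
    by case: eqP => // /(bs_inj' B Si Sm) e; rewrite e eqxx in ne.
  rewrite eqxx /inc /= mp_tnew_sign // /incoming oE //.
  by move: Sm; rewrite remE // negb_or; case: (m) m5 => [|[|[|[|[|//]]]]] //= _ _; case: (odd k).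
rewrite /sideK !H ?remE //; move: Si; rewrite remE // /K.
by move: i i5 {H} => [|[|[|[|[|//]]]]] //= _ _; rewrite !mulr0 ?addr0 ?add0r.
Qed.

Let sideK_far t k : (forall i, ~~ removed (o 1) (o 3) i -> T' i <> t) -> sideK (t, k) = 0.
Proof.
move=> h; have H m : (m < 5)%N -> ~~ removed (o 1) (o 3) (o m) -> H_side (T' (o m)) (t, k) = 0.
  by move=> m5 Sm; rewrite /H_side /=; case: eqP => // e; case: (h _ Sm).
by rewrite /sideK !H ?remE // !mulr0 !addr0.
Qed.

Let w_U i j : (i < 5)%N -> (j < 5)%N -> ~~ (removed (o 1) (o 3) (o i) && removed (o 1) (o 3) (o j)) ->
  i != j -> w (~: [set o i; o j])%SET = U i j.
Proof.
by move=> i5 j5 S ij; rewrite /U -removedE ?o_eq // (negbTE S).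
Qed.

Let K_removed i : (i < 5)%N -> removed (o 1) (o 3) (o i) -> K i = 0.
Proof. by move=> i5; rewrite remE // => /orP[]/eqP->. Qed.

Let side_cycle F F' : bs_corr (removed (o 1) (o 3)) T T' (mp_far_rel D) F F' ->
  outer_weight (o 1) (o 3) T w F = sideK F'.
Proof.
case=> [t t' k ft|i j Si Sj].
  rewrite outer_weight_far; last by move=> i; apply: (bs_far B ft).
  by rewrite sideK_far // => i; apply: (bs_far' B ft).
rewrite outer_weight_outer //.
have ij : i != j by apply: contraTneq Si => ->.
rewrite -[i](inord_val i) -[j](inord_val j) -/(o i) -/(o j) in Si Sj ij *.
have ij' : (i : nat) != j by move: ij; rewrite o_eq.
rewrite sideK_new // w_U ?(negbTE Sj) ?andbF // U_cycle // (K_removed _ Si) //.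
by rewrite mul0r add0r.
Qed.

Lemma primary_cycle : exists k0 k2 k4, forall e, x' e = y e + k0 * H_weight (T' (o 0)) e +
  k2 * H_weight (T' (o 2)) e + k4 * H_weight (T' (o 4)) e.
Proof.
exists (K 0), (K 2), (K 4) => e; rewrite -[e]triangle_out !H_weight_sides; set F' := out_side e.
have [_ yin yout] := Wy; have [_ xin xout] := Wx.
transitivity (y (triangle F') + sideK F' + sideK (mate F')); last by rewrite /sideK; ring.
have B' := bistellar_sym B.
have [[i [j [/= Si Sj ij FE]]]|[F FF]] := bs_faceP B' F'.
  rewrite FE xin // yin // (bs_glue' B) //.
  rewrite -[i](inord_val i) -[j](inord_val j) -/(o i) -/(o j) in Si Sj ij *.
  have ij' : (i : nat) != j by move: ij; rewrite o_eq.
  by rewrite !sideK_new // w_U ?(negbTE Sj) ?andbF // U_cycle // add0r.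
have {}FF := proj2 (bs_corr_sym (removed (o 1) (o 3)) T T' (mp_far_rel D) F F') FF.
have z F0 : outer_weight (o 1) (o 3) T (fun=> 0) F0 = 0.
  by rewrite /outer_weight big1 // => i _; rewrite big1 // => j _; rewrite if_same.
have /mp_corrP FF' := FF; rewrite (xout F F') // (yout F F') // !z !addr0.
by rewrite (side_cycle FF) (side_cycle (bs_outer B FF)).
Qed.

End Cycle.

Lemma derivable_mp_primary (R : realType) : derivable_mp R (o 1) (o 3) false.
Proof.
move=> G G' D w x x' hx hx' wa Wx; have [x0 _ _] := Wx.
have p13 : mp_pair (o 1) (o 3) by apply: mp_pair_ord.
have [y Wy] := mp_weights_ex (D := D) (fun=> 0) x0.
have hy : framed_integral R y := mp_framed p13 primary_admissible Wy hx.
apply: rst_trans (framed_of hy) _ _ _.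
  by apply: rst_step; apply: Or41; apply: framed_of_move; exists D.
have [k0 [k2 [k4 xE]]] := primary_cycle wa Wy Wx.
pose y0 e := y e + k0 * H_weight (mp_tnew D (o 0)) e.
pose y2 e := y0 e + k2 * H_weight (mp_tnew D (o 2)) e.
have h0 : framed_integral R y0 by exact: (framed_H (fun=> erefl) hy).
have h2 : framed_integral R y2 by exact: (framed_H (fun=> erefl) h0).
apply: rst_trans (derivable_H hy h0 (fun=> erefl)) _.
apply: rst_trans (derivable_H h0 h2 (fun=> erefl)) _.
exact: (derivable_H h2 hx' xE).
Qed.

Lemma derivable_mp_all (R : realType) a b eps : mp_pair a b -> derivable_mp R a b eps.
Proof.
pose P n m eps' := derivable_mp R (o n) (o m) eps'.
have step n m eps' n1 m1 c : all (fun i => i < 5)%N [:: n; m; c; n1; m1] ->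
    uniq [:: n; m; c; n1; m1] -> [&& n < m, (n, m) != (0, 1) & (n, m) != (3, 4)]%N ->
    [&& n1 < m1, (n1, m1) != (0, 1) & (n1, m1) != (3, 4)]%N -> P n1 m1 (~~ eps') -> P n m eps'.
  move=> s5 un /and3P[lt h1 h2] /and3P[lt' h1' h2']; have /and5P[_ m5 _ _ /andP[m15 _]] := s5.
  apply: (derivable_mp_step (c := o c)).
  - by rewrite -(labels_ord s5) in un.
  - by apply: mp_pair_ord; rewrite ?lt.
  by apply: mp_pair_ord; rewrite ?lt'.
have p13 : P 1%N 3%N false := @derivable_mp_primary R.
have p02t : P 0%N 2%N true := step 0 2 true 1 3 4 isT isT isT isT p13.
have p04t : P 0%N 4%N true := step 0 4 true 1 3 2 isT isT isT isT p13.
have p24t : P 2%N 4%N true := step 2 4 true 1 3 0 isT isT isT isT p13.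
have p14f : P 1%N 4%N false := step 1 4 false 0 2 3 isT isT isT isT p02t.
have p12f : P 1%N 2%N false := step 1 2 false 0 4 3 isT isT isT isT p04t.
have p23f : P 2%N 3%N false := step 2 3 false 0 4 1 isT isT isT isT p04t.
have p03f : P 0%N 3%N false := step 0 3 false 2 4 1 isT isT isT isT p24t.
have p03t : P 0%N 3%N true := step 0 3 true 1 4 2 isT isT isT isT p14f.
have p23t : P 2%N 3%N true := step 2 3 true 1 4 0 isT isT isT isT p14f.
have p12t : P 1%N 2%N true := step 1 2 true 0 3 4 isT isT isT isT p03f.
have p14t : P 1%N 4%N true := step 1 4 true 0 3 2 isT isT isT isT p03f.
have p24f : P 2%N 4%N false := step 2 4 false 0 3 1 isT isT isT isT p03t.
have p04f : P 0%N 4%N false := step 0 4 false 1 2 3 isT isT isT isT p12t.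
have p02f : P 0%N 2%N false := step 0 2 false 1 4 3 isT isT isT isT p14t.
have p13t : P 1%N 3%N true := step 1 3 true 2 4 0 isT isT isT isT p24f.
rewrite -[a](inord_val a) -[b](inord_val b) -/(o a) -/(o b) => pab.
have [lt nlow nhigh] := pab; rewrite !oE // in lt nlow nhigh.
have not01 : ((a : nat), (b : nat)) != (0, 1)%N.
  apply/eqP => -[a0 b1]; apply: nlow => i.
  by rewrite /removed !inE negb_or -!val_eqE /= !oE // a0 b1; case: (i : nat) => [|[]].
have not34 : ((a : nat), (b : nat)) != (3, 4)%N.
  apply/eqP => -[a3 b4]; apply: nhigh => i.
  by rewrite /removed !inE negb_or -!val_eqE /= !oE // a3 b4; case: i => [[|[|[|[|[|]]]]]].
have b5 := ltn_ord b; rewrite -/(P _ _ _).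
move: (a : nat) (b : nat) lt not01 not34 b5 => n m {pab nlow nhigh}.
case: n => [|[|[|[|n]]]]; case: m => [|[|[|[|[|m]]]]] // _ _ _ _; by case: eps.
Qed.

End Primary.

Theorem corollary3p4 (R : realType) (W : mp_choice) (hW : admissible_choice W)
    (X X' : framed_ograph R) :
  framed (integral_mp W) X X' -> derivable_by_steps X X'.
Proof.
case=> x [x' [hx hx' xz xz' [a [b [eps [pab [D Wx]]]]]]].
apply: rst_trans (framed_of_self hx xz) _.
apply: rst_trans (derivable_mp_all pab hx hx' (hW a b eps pab) Wx) _.
exact: rst_sym (framed_of_self hx' xz').
Qed.
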